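(* Let $(\mathfrak{D},\mathfrak{I},\sigma)$ be a Dynkin triple with $\sigma\ne1$, $\mathfrak{I}^{\ge2}\ne\emptyset$, and such that the actions of $\sigma$ and $-w_{0,\mathfrak{I}}$ on $\mathfrak{I}$ coincide. Then $\mathfrak{D}$ is connected, of type $A_n$ ($n\ge2$), $D_n$ ($n\ge4$) or $E_6$. More precisely, the conditions $\sigma\ne1$, $\mathfrak{I}^{\ge2}\ne\emptyset$ and ''the actions of $\sigma$ and $-w_{0,\mathfrak{I}}$ on $\mathfrak{I}$ coincide'' hold jointly precisely in the following cases: (1) $\mathfrak{D}$ is of type $A_n$ for some $n\ge2$, $\sigma=-w_0$ is the opposition involution of $\mathfrak{D}$, and there is $m$ with $2\le m\le n$ and $m\equiv n\pmod 2$ such that $\mathfrak{I}^{\ge2}$ is the unique $\sigma$-stable sub-diagram of type $A_m$; (2) $\mathfrak{D}$ is of type $D_4$, $\sigma$ is one of the three transpositions in $\mathrm{Aut}(\mathfrak{D})\cong S_3$, and $\mathfrak{I}^{\ge2}=\mathfrak{I}\cong D_3\cong A_3$ is obtained by removing one of the three extremal vertices; (3) $\mathfrak{D}$ is of type $D_n$ for some $n\ge5$, $\sigma$ is the unique nontrivial element of $\mathrm{Aut}(\mathfrak{D})$, and $\mathfrak{I}^{\ge2}$ is the unique sub-diagram of type $D_{2m+1}$ for some $1\le m\le(n-1)/2$; (4) $\mathfrak{D}$ is of type $E_6$, $\sigma=-w_0$ is the opposition involution, and $\mathfrak{I}^{\ge2}$ is the unique $-w_0$-stable sub-diagram of type $A_3$,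 $A_5$ or $E_6$.
   Context: A Dynkin triple $(\mathfrak{D},\mathfrak{I},\sigma)$ consists of a Dynkin diagram $\mathfrak{D}$ (of a reduced root system, vertices = simple roots), a diagram automorphism $\sigma\in\mathrm{Aut}(\mathfrak{D})$ and a $\sigma$-stable sub-diagram $\mathfrak{I}\subset\mathfrak{D}$ (possibly $\mathfrak{I}=\mathfrak{D}$). $-w_{0,\mathfrak{I}}$ is the opposition involution of $\mathfrak{I}$ (the permutation $\alpha\mapsto-w_{0,\mathfrak{I}}\alpha$ of $\mathfrak{I}$, $w_{0,\mathfrak{I}}$ the longest element of the Weyl group generated by reflections in $\mathfrak{I}$); $-w_0=-w_{0,\mathfrak{D}}$. $\mathfrak{I}^{\ge2}$ is the union of the connected components of $\mathfrak{I}$ having at least two vertices.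
   Formalization: Added: σ permutes the connected components of 𝔇 transitively (else 𝔇=A_2+A_1, 𝔍=A_2 is a counterexample); case (1) also requires 𝔍^{≥2}=𝔍 (else 𝔇=A_6, 𝔍={1,3,4,6} is a counterexample). In (3), D_3 means the A_3 containing both ends of the fork. *)

(* Defs.v *)
From mathcomp Require Import all_boot all_order all_algebra all_fingroup.

Set Implicit Arguments.
Unset Strict Implicit.
Unset Printing Implicit Defensive.

Import Order.TTheory GRing.Theory Num.Theory.
Local Open Scope ring_scope.

(* Diagrams: finite graphs with multiple bonds, and an arrow on the bonds     *)
(* joining vertices of different lengths.  A sub-diagram is a full one and is *)
(* given by its set of vertices.                                              *)

Record diagram := Diagram {
  vertex : finType;
  bonds : vertex -> vertex -> nat;
  arrow : rel vertex
}.

Definition simply_laced (V : finType) (e : rel V) : diagram :=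
  @Diagram V (fun x y => (e x y || e y x : nat)) (fun _ _ => false).

(* In the three diagrams below vertex i is vertex i + 1 of Bourbaki's plates. *)

Definition type_A (n : nat) : diagram :=
  simply_laced (fun i j : 'I_n => i.+1 == j :> nat).

(* The chain 0, ..., n - 2, with n - 1 attached to n - 3; type_D 3 is a chain *)
(* with middle vertex 0.                                                      *)
Definition type_D (n : nat) : diagram :=
  simply_laced (fun i j : 'I_n =>
    (i.+1 == j :> nat) && (j.+1 < n)%N || (i.+2 == j :> nat) && (j.+1 == n)).

Definition type_E6 : diagram :=
  simply_laced (fun i j : 'I_6 =>
    (nat_of_ord i, nat_of_ord j)
      \in [:: (0, 2); (2, 3); (3, 4); (4, 5); (1, 3)]%N).

Definition is_diagram_iso (D E : diagram) (f : vertex D -> vertex E) : Prop :=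
  [/\ bijective f,
      forall x y, bonds (f x) (f y) = bonds x y
    & forall x y, arrow (f x) (f y) = arrow x y].

Definition of_type (D E : diagram) : Prop :=
  exists f : vertex D -> vertex E, is_diagram_iso f.

Definition diagram_Aut (D : diagram) : {set {perm vertex D}} :=
  [set s : {perm vertex D} |
    [forall x, forall y, (bonds (s x) (s y) == bonds x y)
                      && (arrow (s x) (s y) == arrow x y)]].

Definition subdiagram (D : diagram) (J : {set vertex D}) : diagram :=
  @Diagram {x : vertex D | x \in J}
    (fun x y => bonds (val x) (val y)) (fun x y => arrow (val x) (val y)).

Definition stable (D : diagram) (s : {perm vertex D}) (J : {set vertex D}) :
  Prop := [set s x | x in J] = J.

Definition adjacent_in (D : diagram) (J : {set vertex D}) : rel (vertex D) :=
  [rel x y | [&& x \in J, y \in J & 0 < bonds x y]%N].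

Definition components (D : diagram) (J : {set vertex D}) :
  {set {set vertex D}} :=
  equivalence_partition (connect (adjacent_in J)) J.

Definition connected_diagram (D : diagram) : Prop :=
  #|components [set: vertex D]| = 1%N.

Definition big_part (D : diagram) (J : {set vertex D}) : {set vertex D} :=
  \bigcup_(C in components J | (2 <= #|C|)%N) C.

Definition extremal (D : diagram) (x : vertex D) : bool :=
  #|[set y | 0 < bonds x y]%N| == 1%N.

Definition transitive_on_components (D : diagram) (s : {perm vertex D}) :
  Prop :=
  forall C C' : {set vertex D},
    C \in components [set: vertex D] -> C' \in components [set: vertex D] ->
    exists k : nat, [set (s ^+ k)%g x | x in C] = C'.

(* A sub-diagram of type D_k of a diagram D of type D_n: the fork together    *)
(* with the adjacent part of the chain.  For k >= 4 the first clause implies  *)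
(* the second; for k = 3 the second one separates D_3, which contains both    *)
(* ends of the fork, from the other sub-diagrams isomorphic to A_3 = D_3.     *)
Definition D_subdiagram (D : diagram) (n k : nat) (J : {set vertex D}) : Prop :=
  of_type (subdiagram J) (type_D k) /\
  exists2 f : vertex D -> vertex (type_D n),
    is_diagram_iso f & J = [set x | (n - k <= nat_of_ord (f x : 'I_n))%N].

(* Root systems of rank r in the Euclidean space R^r, R real closed (so that  *)
(* every r-dimensional Euclidean space over R is isometric to this one).      *)

Section RootSystem.
Variables (R : archiRcfType) (r : nat).
Implicit Types (u v a : 'rV[R]_r).

Definition dot u v : R := (u *m v^T) 0 0.

Definition pairing v a : R := 2 * dot v a / dot a a.

Definition reflection a v : 'rV[R]_r := v - pairing v a *: a.

Record reduced_root_system (Phi : seq 'rV[R]_r) : Prop := {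
  root_neq0 : 0 \notin Phi;
  root_span : <<Phi>>%VS = fullv;
  root_reflection : forall a b, a \in Phi -> b \in Phi ->
    reflection a b \in Phi;
  root_integral : forall a b, a \in Phi -> b \in Phi ->
    pairing b a \is a Num.int;
  root_reduced : forall a (c : R), a \in Phi -> c *: a \in Phi ->
    c = 1 \/ c = -1
}.

Record is_base (Phi : seq 'rV[R]_r) (Delta : 'I_r -> 'rV[R]_r) : Prop := {
  base_root : forall i, Delta i \in Phi;
  base_basis : basis_of fullv [seq Delta i | i <- enum 'I_r];
  base_sign : forall b, b \in Phi -> exists k : 'I_r -> nat,
    b = \sum_i Delta i *+ k i \/ b = - \sum_i Delta i *+ k i
}.

Variable Delta : 'I_r -> 'rV[R]_r.

(* Vertex i stands for the simple root Delta i; arrows point to short roots.  *)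
Definition dynkin : diagram :=
  @Diagram 'I_r
    (fun i j => if i == j then 0%N else
       Num.truncn (pairing (Delta i) (Delta j) * pairing (Delta j) (Delta i)))
    (fun i j => (dot (Delta i) (Delta j) != 0) &&
       (dot (Delta j) (Delta j) < dot (Delta i) (Delta i))).

Definition word_action (s : seq 'I_r) v : 'rV[R]_r :=
  foldr (fun i => reflection (Delta i)) v s.

Variable I : {set 'I_r}.

(* w lies in the group generated by the reflections in the simple roots of I, *)
(* and has length l there.                                                    *)
Definition weyl_length (w : 'rV[R]_r -> 'rV[R]_r) (l : nat) : Prop :=
  (exists s : seq 'I_r, [/\ {subset s <= I}, size s = l & w =1 word_action s])
  /\ (forall s : seq 'I_r, {subset s <= I} -> w =1 word_action s ->
        (l <= size s)%N).

Definition longest_element (w : 'rV[R]_r -> 'rV[R]_r) : Prop :=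
  exists2 l, weyl_length w l
    & forall w' l', weyl_length w' l' -> (l' <= l)%N.

(* The actions of s and - w_{0,I} on I coincide.                              *)
Definition acts_as_opposition (s : {perm 'I_r}) : Prop :=
  exists2 w, longest_element w
    & forall i, i \in I -> Delta (s i) = - w (Delta i).

End RootSystem.

(* Main.v *)
Require Import Defs.
From HB Require Import structures.
From mathcomp Require Import all_boot all_order all_algebra all_fingroup.
From mathcomp Require Import zify ring lra.
From Stdlib Require Import Classical.

Set Implicit Arguments.
Unset Strict Implicit.
Unset Printing Implicit Defensive.

Import Order.TTheory GRing.Theory Num.Theory.

(* Writing a vector in the base of simple roots of [I], a weight [v] and its  *)
(* image under the longest element [w] of [W_I] differ by an integral         *)
(* combination of roots; hence, if [- w] permutes the simple roots of [I] by  *)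
(* [t], the coefficients of every weight satisfy [c_i + c_(t i)] in [Z].      *)
(* Evaluated on one weight of each component of [I], this determines [t]: the *)
(* component is reversed for [A_m], the two half-spin nodes of [D_k] are      *)
(* exchanged exactly when [k] is odd, and [t] is not trivial on [E_6].        *)
(* The existence of [w] and [t] comes from the deletion condition.  As [t]    *)
(* preserves the components of [D], the latter is connected; the connected    *)
(* diagrams with a nontrivial automorphism are found by looking at a longest  *)
(* chain, the extended diagrams being excluded by vectors of norm [<= 0].     *)

Local Open Scope ring_scope.

(** * Root systems and words *)

(** Let [w] be the longest element of [W_I] and [t] the permutation of [I] with
    [Delta (t i) = - w (Delta i)]; [opposition_exists] provides them. Three facts about [t] carry
    the proof: it preserves bonds ([opposition_bonds]), it maps every component of the whole diagram
    to itself ([opposition_closed]), and, as [w] is trivial on weights modulo roots, it acts there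
    as [- 1] ([opposition_congruence]).

    If [sigma] agrees with [t] on a nonempty [I], the second fact shows that [sigma] stabilizes a
    component of the diagram, and transitivity on components makes the diagram connected
    ([opposition_connected]). A connected diagram with a nontrivial automorphism is of type A, D or
    E_6 ([classification]): nonzero vectors of norm [<= 0] would come from other shapes, except for
    the trees with arms of lengths 1, 2 and at least 3, which have no symmetry.

    In each type the vertices are numbered, and [sigma] becomes an explicit map: the reversal of the
    chain, the exchange of the two ends of the fork, or the flip of E_6. It remains to compare it
    with [t] on the components of [I]. By the congruence, [t] reverses a component of type A_m
    ([opposition_chain]). In type A each component is thus reversed about its own centre, and
    [sigma] reverses about the centre of the diagram; hence there is only one component and it is
    centred ([opposition_centred]). In type D_n with [n >= 5], [sigma] fixes the chain, so a
    component inside the chain is a single vertex, while the component D_k containing the fork has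
    its ends exchanged exactly when [k] is odd ([opposition_fork], [fork_opposition]). D_4, with its
    larger automorphism group, is treated as a star with three leaves ([star_forward],
    [star_backward]). In E_6 the sixteen flip-stable subsets are inspected ([flip_list_cases],
    [E6_forward]), the full diagram being settled by a weight of order 3 modulo roots
    ([opposition_E6]). *)

Section Euclidean.
Variables (R : archiRcfType) (r : nat).
Implicit Types (u v w a : 'rV[R]_r) (s : seq 'I_r).

Lemma dotE u v : dot u v = \sum_i u 0 i * v 0 i.
Proof. by rewrite /dot mxE; apply: eq_bigr => i _; rewrite mxE. Qed.

Lemma dotC u v : dot u v = dot v u.
Proof. by rewrite !dotE; apply: eq_bigr => i _; rewrite mulrC. Qed.

Lemma dotDl u v w : dot (u + v) w = dot u w + dot v w.
Proof. by rewrite /dot mulmxDl mxE. Qed.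

Lemma dotZl (c : R) u w : dot (c *: u) w = c * dot u w.
Proof. by rewrite /dot -scalemxAl mxE. Qed.

Lemma dotDr u v w : dot w (u + v) = dot w u + dot w v.
Proof. by rewrite dotC dotDl !(dotC w). Qed.

Lemma dotZr (c : R) u w : dot w (c *: u) = c * dot w u.
Proof. by rewrite dotC dotZl dotC. Qed.

Lemma dotNl u w : dot (- u) w = - dot u w.
Proof. by rewrite -scaleN1r dotZl mulN1r. Qed.

Lemma dotNr u w : dot w (- u) = - dot w u.
Proof. by rewrite dotC dotNl dotC. Qed.

Lemma dot0l u : dot 0 u = 0.
Proof. by rewrite -(scale0r 0) dotZl mul0r. Qed.

Lemma dot_suml (J : Type) (l : seq J) (P : pred J) (F : J -> 'rV[R]_r) w :
  dot (\sum_(i <- l | P i) F i) w = \sum_(i <- l | P i) dot (F i) w.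
Proof. by elim/big_rec2: _ => [|i x y _ <-]; rewrite ?dot0l ?dotDl. Qed.

Lemma dot_ge0 v : 0 <= dot v v.
Proof. by rewrite dotE sumr_ge0 // => i _; rewrite -expr2 sqr_ge0. Qed.

Lemma dot_eq0 v : (dot v v == 0) = (v == 0).
Proof.
apply/eqP/eqP => [|->]; last by rewrite dot0l.
rewrite dotE => /eqP; rewrite psumr_eq0 => [/allP h|i _]; last first.
  by rewrite -expr2 sqr_ge0.
apply/rowP => i; rewrite mxE; apply/eqP.
by have := h i (mem_index_enum i); rewrite -expr2 sqrf_eq0.
Qed.

Lemma dot_gt0 v : v != 0 -> 0 < dot v v.
Proof. by move=> h; rewrite lt_def dot_ge0 dot_eq0 h. Qed.

Lemma dot_le0 v : dot v v <= 0 -> v = 0.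
Proof.
move=> h; apply/eqP; rewrite -dot_eq0; apply/eqP/le_anti.
by rewrite h dot_ge0.
Qed.

Lemma pairingDl u v a : pairing (u + v) a = pairing u a + pairing v a.
Proof. by rewrite /pairing dotDl mulrDr mulrDl. Qed.

Lemma pairingZl (c : R) u a : pairing (c *: u) a = c * pairing u a.
Proof. by rewrite /pairing dotZl; ring. Qed.

Lemma pairing_self a : a != 0 -> pairing a a = 2.
Proof. by rewrite -dot_eq0 /pairing => h; rewrite mulfK. Qed.

Lemma reflection_is_linear a : linear (reflection a).
Proof.
move=> c u v; rewrite /reflection pairingDl pairingZl scalerBr scalerDl.
by rewrite scalerA opprD addrACA.
Qed.

Lemma reflection_self a : a != 0 -> reflection a a = - a.
Proof.
by move=> h; rewrite /reflection pairing_self // scaler_nat mulr2n opprD addNKr.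
Qed.

Lemma reflectionK a : a != 0 -> involutive (reflection a).
Proof.
move=> h v; rewrite /reflection pairingDl -scaleNr pairingZl pairing_self //.
rewrite -addrA -scaleNr -scalerDl -[RHS]addr0; congr (_ + _).
by rewrite (_ : - _ + _ = 0) ?scale0r //; ring.
Qed.

Lemma dot_reflection a u v : a != 0 ->
  dot (reflection a u) (reflection a v) = dot u v.
Proof.
rewrite -dot_eq0 => h; rewrite /reflection !(dotDl, dotDr, dotNl, dotNr).
by rewrite !(dotZl, dotZr) /pairing (dotC a v); field.
Qed.

End Euclidean.

HB.instance Definition _ (R : archiRcfType) (r : nat) (a : 'rV[R]_r) :=
  GRing.isLinear.Build R 'rV[R]_r 'rV[R]_r _ (reflection a)
    (@reflection_is_linear R r a).

Section Words.
Variables (R : archiRcfType) (r : nat) (Delta : 'I_r -> 'rV[R]_r).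
Implicit Types (u v : 'rV[R]_r) (s t : seq 'I_r).

Lemma word_cons i s v :
  word_action Delta (i :: s) v = reflection (Delta i) (word_action Delta s v).
Proof. by []. Qed.

Lemma word_is_linear s : linear (word_action Delta s).
Proof. by elim: s => // i s IHs c u v; rewrite !word_cons IHs linearP. Qed.

HB.instance Definition _ s :=
  GRing.isLinear.Build R 'rV[R]_r 'rV[R]_r _ (word_action Delta s)
    (word_is_linear s).

Lemma word_cat s t v :
  word_action Delta (s ++ t) v = word_action Delta s (word_action Delta t v).
Proof. by rewrite /word_action foldr_cat. Qed.

Hypothesis Delta_neq0 : forall i, Delta i != 0.

Lemma wordK s : cancel (word_action Delta s) (word_action Delta (rev s)).
Proof.
elim: s => // i s IHs v; rewrite rev_cons -cats1 word_cat !word_cons.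
by rewrite reflectionK.
Qed.

Lemma wordVK s : cancel (word_action Delta (rev s)) (word_action Delta s).
Proof. by move=> v; rewrite -{1}(revK s) wordK. Qed.

Lemma dot_word s u v :
  dot (word_action Delta s u) (word_action Delta s v) = dot u v.
Proof. by elim: s => // i s IHs; rewrite !word_cons dot_reflection. Qed.

Lemma pairing_word s u v :
  pairing (word_action Delta s u) (word_action Delta s v) = pairing u v.
Proof. by rewrite /pairing !dot_word. Qed.

Lemma word_reflection s u v :
  word_action Delta s (reflection u v) =
  reflection (word_action Delta s u) (word_action Delta s v).
Proof. by rewrite /reflection linearB linearZ /= pairing_word. Qed.

End Words.

(** * Coefficients in a base, reduced words and the longest element *)

Section Base.
Variables (R : archiRcfType) (r : nat).
Variables (Phi : seq 'rV[R]_r) (Delta : 'I_r -> 'rV[R]_r).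
Hypothesis hPhi : reduced_root_system Phi.
Hypothesis hDelta : is_base Phi Delta.
Implicit Types (u v b : 'rV[R]_r) (s t : seq 'I_r) (I : {set 'I_r}).

Definition cf (v : 'rV[R]_r) (j : 'I_r) : R :=
  coord [tuple Delta i | i < r] j v.

Lemma cfD u v j : cf (u + v) j = cf u j + cf v j.
Proof. by rewrite /cf linearD. Qed.

Lemma cfZ a u j : cf (a *: u) j = a * cf u j.
Proof. by rewrite /cf linearZ. Qed.

Lemma cfN u j : cf (- u) j = - cf u j.
Proof. by rewrite /cf linearN. Qed.

Lemma cf_sum (K : Type) (l : seq K) (P : pred K) (F : K -> 'rV[R]_r) j :
  cf (\sum_(i <- l | P i) F i) j = \sum_(i <- l | P i) cf (F i) j.
Proof. by rewrite /cf linear_sum. Qed.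

Lemma cf_Delta i j : cf (Delta i) j = (i == j)%:R.
Proof.
have /andP[_ free_D] := base_basis hDelta.
have -> : Delta i = [tuple Delta i | i < r]`_i.
  by rewrite -(tnth_nth 0) tnth_mktuple.
exact: coord_free.
Qed.

Lemma cf_expand v : v = \sum_i cf v i *: Delta i.
Proof.
have /andP[/eqP span_D _] := base_basis hDelta.
rewrite {1}(@coord_span _ _ _ [tuple Delta i | i < r] v); last first.
  by rewrite span_D memvf.
by apply: eq_bigr => i _; rewrite -(tnth_nth 0) tnth_mktuple.
Qed.

Lemma cf_comb (c : 'I_r -> R) j : cf (\sum_i c i *: Delta i) j = c j.
Proof.
rewrite cf_sum (bigD1 j) //= cfZ cf_Delta eqxx mulr1 big1 ?addr0 // => i.
by rewrite cfZ cf_Delta => /negbTE->; rewrite mulr0.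
Qed.

Lemma cf_inj u v : cf u =1 cf v -> u = v.
Proof.
by move=> e; rewrite (cf_expand u) (cf_expand v); apply: eq_bigr => i _; rewrite e.
Qed.

Lemma Delta_inj : injective Delta.
Proof.
move=> i j e; have := cf_Delta i j; rewrite e cf_Delta eqxx.
by case: eqP => // _ /eqP; rewrite eq_sym eqr_nat.
Qed.

Lemma Delta_neq0 i : Delta i != 0.
Proof.
apply/eqP => e; have := root_neq0 hPhi; rewrite -e.
by rewrite (base_root hDelta).
Qed.

Let Delta_root i : Delta i \in Phi := base_root hDelta i.

(** On roots this is positivity with respect to [Delta]; negativity of a root [b] is written
    [nneg (- b)]. *)
Definition nneg v := forall j, 0 <= cf v j.

Lemma root_cf b : b \in Phi ->
  (nneg b \/ nneg (- b)) /\ (forall j, cf b j \is a Num.int).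
Proof.
move=> /(base_sign hDelta)[k hk].
have e : b = \sum_i (k i)%:R *: Delta i \/ - b = \sum_i (k i)%:R *: Delta i.
  have -> : \sum_i (k i)%:R *: Delta i = \sum_i Delta i *+ k i.
    by apply: eq_bigr => i _; rewrite scaler_nat.
  by case: hk => ->; rewrite ?opprK; [left|right].
case: e => e; split.
- by left => j; rewrite e cf_comb ler0n.
- by move=> j; rewrite e cf_comb rpred_nat.
- by right => j; rewrite e cf_comb ler0n.
by move=> j; rewrite -[b]opprK e cfN cf_comb rpredN rpred_nat.
Qed.

Lemma word_root s b : b \in Phi -> word_action Delta s b \in Phi.
Proof. by elim: s => // i s IHs /IHs; rewrite word_cons;
  apply: (root_reflection hPhi). Qed.

Lemma pairing_int i j : pairing (Delta i) (Delta j) \is a Num.int.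
Proof. exact: (root_integral hPhi). Qed.

(** The reflection of [Delta i] in [Delta j] has coefficient 1 at [i], so it is a positive root, and
    its coefficient at [j] is minus the pairing. *)
Lemma pairing_le0 i j : i != j -> pairing (Delta i) (Delta j) <= 0.
Proof.
move=> ij; have := root_reflection hPhi (Delta_root j) (Delta_root i).
have ji : (j == i) = false by rewrite eq_sym (negbTE ij).
case/root_cf => -[] h _; last first.
  have := h i; rewrite /reflection cfN cfD cfN cfZ !cf_Delta eqxx ji.
  by rewrite mulr0 subr0 oppr_ge0 ler10.
have := h j; rewrite /reflection cfD cfN cfZ !cf_Delta eqxx (negbTE ij).
by rewrite mulr1 add0r oppr_ge0.
Qed.

Lemma pairing_eq0 i j : (pairing (Delta i) (Delta j) == 0) =
  (dot (Delta i) (Delta j) == 0).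
Proof.
have := Delta_neq0 j; rewrite -dot_eq0 /pairing => h.
by rewrite mulf_eq0 invr_eq0 (negbTE h) orbF mulf_eq0 pnatr_eq0.
Qed.

(** As the root system is reduced, [b] has a positive coefficient at some [j != i]; the reflection
    leaves that coefficient unchanged, and one positive coefficient makes a root positive. *)
Lemma simple_reflection_pos i b : b \in Phi -> nneg b -> b != Delta i ->
  nneg (reflection (Delta i) b).
Proof.
move=> hb pb nb.
have [j ji bj] : exists2 j, j != i & 0 < cf b j.
  apply: NNPP => h; move/eqP: nb; apply.
  have e : b = cf b i *: Delta i.
    apply: cf_inj => j; rewrite cfZ cf_Delta; case: eqVneq => [<-|ij].
      by rewrite mulr1.
    rewrite mulr0; apply/eqP/negPn/negP => nz; apply: h; exists j.
      by rewrite eq_sym.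
    by rewrite lt_def nz pb.
  have := hb; rewrite e => /(root_reduced hPhi (Delta_root i))[-> | c].
    by rewrite scale1r.
  by have := pb i; rewrite c oppr_ge0 ler10.
have [[//|h] _] := root_cf (root_reflection hPhi (Delta_root i) hb).
have := h j; rewrite /reflection cfN cfD cfN cfZ cf_Delta eq_sym (negbTE ji).
by rewrite mulr0 subr0 oppr_ge0 leNgt bj.
Qed.

(* The deletion condition: the positive root [Delta i] is turned negative by  *)
(* some letter of [t], which can then be removed.                             *)
Lemma word_exchange t i : nneg (- word_action Delta t (Delta i)) ->
  exists t' : seq 'I_r, [/\ {subset t' <= t}, (size t').+1 = size t &
    word_action Delta t' =1 word_action Delta (rcons t i)].
Proof.
elim: t => [|j t IHt].
  by move/(_ i); rewrite cfN cf_Delta eqxx oppr_ge0 ler10.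
have [[h _|h _]] := root_cf (word_root t (Delta_root i)); last first.
  have [t' [t't st e]] := IHt h; exists (j :: t'); split=> [x||v].
  - by rewrite !inE => /orP[->//|/t't ->]; rewrite orbT.
  - by rewrite /= st.
  by rewrite rcons_cons !word_cons e.
have [e hn|ne] := eqVneq (word_action Delta t (Delta i)) (Delta j); last first.
  have h' := simple_reflection_pos (word_root t (Delta_root i)) h ne.
  move=> h0; case/negP: (Delta_neq0 i); apply/eqP.
  apply: (can_inj (wordK Delta_neq0 (j :: t))); rewrite [RHS]linear0.
  apply: cf_inj => k; apply: le_anti;
    rewrite /cf linear0 -/(cf _ _) [0 <= _]h' andbT.
  by have := h0 k; rewrite cfN oppr_ge0.
exists t; split=> // [x xt|v]; first by rewrite inE xt orbT.
rewrite -cats1 word_cat word_cons word_reflection; last exact: Delta_neq0.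
by rewrite e reflectionK // Delta_neq0.
Qed.

Definition reduced_in I s := {subset s <= I} /\
  forall t, {subset t <= I} ->
    word_action Delta s =1 word_action Delta t -> (size s <= size t)%N.

Lemma reduced_exists I s : {subset s <= I} ->
  exists2 t, reduced_in I t & word_action Delta s =1 word_action Delta t.
Proof.
move=> sI; have [n] := ubnP (size s); elim: n s sI => // n IHn s sI le_sn.
have [hs|nred] := classic (reduced_in I s); first by exists s.
have [t [tI st lt_ts]] : exists t, [/\ {subset t <= I},
    word_action Delta s =1 word_action Delta t & (size t < size s)%N].
  apply: NNPP => no; apply: nred; split=> // t tI st.
  by rewrite leqNgt; apply/negP => lt_ts; apply: no; exists t.
have [|t' h e] := IHn t tI.
  exact: leq_trans lt_ts _.
by exists t' => // v; rewrite st.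
Qed.

Lemma word_eq_Phi s t :
  {in Phi, word_action Delta s =1 word_action Delta t} ->
  word_action Delta s =1 word_action Delta t.
Proof.
move=> h v; rewrite (cf_expand v) !linear_sum; apply: eq_bigr => i _.
by rewrite !linearZ /= h.
Qed.

(* The actions on [Phi] of the suffixes of a reduced word are distinct.       *)
Lemma reduced_bounded I : exists N, forall s, reduced_in I s -> (size s <= N)%N.
Proof.
pose n := size Phi.
exists #|{ffun 'I_n -> 'I_n.+1}| => s [sI red_s].
pose F (i : 'I_(size s)) : {ffun 'I_n -> 'I_n.+1} :=
  [ffun k : 'I_n => inord (index (word_action Delta (drop i s) Phi`_k) Phi)].
suff Finj : injective F by rewrite -[size s]card_ord; apply: leq_card Finj.
move=> i j; wlog : i j / (i <= j)%N => [hw e|].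
  by have [/hw->|/ltnW/hw->] := leqP i j.
rewrite leq_eqVlt => /orP[/eqP/val_inj//|ij] e.
have eij : word_action Delta (drop i s) =1 word_action Delta (drop j s).
  apply: word_eq_Phi => b hb.
  have hk : (index b Phi < n)%N by rewrite index_mem.
  have := congr1 (fun f : {ffun 'I_n -> 'I_n.+1} => f (Ordinal hk)) e.
  rewrite !ffunE /= nth_index //.
  move/(congr1 val); rewrite /= !inordK ?ltnS ?index_size // => ei.
  rewrite -[LHS](nth_index 0 (word_root (drop i s) hb)) ei.
  by rewrite nth_index // word_root.
(* Cutting out the letters between the two suffixes would give a shorter word with the same
   action. *)
have := red_s (take i s ++ drop j s); rewrite size_cat size_take size_drop.
have sub : {subset take i s ++ drop j s <= I}.
  by move=> x; rewrite mem_cat => /orP[/mem_take|/mem_drop]; apply: sI.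
move/(_ sub); rewrite ltn_ord => h; have/h : word_action Delta s =1
    word_action Delta (take i s ++ drop j s).
  by move=> v; rewrite -{1}(cat_take_drop i s) !word_cat eij.
by have := ltn_ord j; lia.
Qed.

Lemma longest_reduced I : exists2 s, reduced_in I s &
  forall t, reduced_in I t -> (size t <= size s)%N.
Proof.
have [N hN] := reduced_bounded I.
suff h n : forall s, reduced_in I s -> (N <= size s + n)%N ->
    exists2 s, reduced_in I s & forall t, reduced_in I t -> (size t <= size s)%N.
  have sub0 : {subset [::] <= I} by [].
  by have [s hs _] := reduced_exists sub0; apply: (h N s) => //; lia.
elim: n => [|n IHn] s hs le_n.
  by exists s => // t /hN; lia.
have [[t [ht st]]|no] := classic (exists t, reduced_in I t /\ (size s < size t)%N).
  by apply: IHn ht _; lia.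
exists s => // t ht; rewrite leqNgt; apply/negP => lt_st; apply: no.
by exists t.
Qed.

(** If the image of [Delta i] were positive, a reduced word [t] for [s] followed by [i] would send
    [Delta i] to a negative root. Deleting a letter of [t] then expresses [s] by a word of size
    [(size t).-1], less than [size s] by maximality, although [s] is reduced. *)
Lemma longest_negative I s : reduced_in I s ->
  (forall t, reduced_in I t -> (size t <= size s)%N) ->
  forall i, i \in I -> nneg (- word_action Delta s (Delta i)).
Proof.
move=> [sI red_s] max_s i iI.
have [[pos|//] _] := root_cf (word_root s (Delta_root i)).
have sub : {subset rcons s i <= I}.
  by move=> x; rewrite mem_rcons inE => /orP[/eqP->|/sI].
have [t red_t et] := reduced_exists sub.
have neg : nneg (- word_action Delta t (Delta i)).
  rewrite -et -cats1 word_cat word_cons reflection_self ?Delta_neq0 //.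
  by rewrite linearN opprK.
have [t' [t't st' et']] := word_exchange neg.
have /red_s : {subset t' <= I} by move=> x /t't; apply: (proj1 red_t).
suff /[swap] /[apply] : word_action Delta s =1 word_action Delta t'.
  by have := max_s t red_t; lia.
move=> v; rewrite et' -cats1 word_cat -et -cats1 word_cat word_cons.
by rewrite reflectionK // Delta_neq0.
Qed.

(** A version of [acts_as_opposition] for a mere function, arbitrary outside [I]: the opposition of
    [I] can be named without extending it to a permutation of the whole diagram. *)
Definition opposition_on I (t : 'I_r -> 'I_r) : Prop :=
  exists2 w, longest_element Delta I w
    & forall i, i \in I -> Delta (t i) = - w (Delta i).

Lemma opposition_onP I (t : 'I_r -> 'I_r) (s : {perm 'I_r}) :
  {in I, t =1 s} -> opposition_on I t <-> acts_as_opposition Delta I s.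
Proof.
by move=> e; split=> -[w hw h]; exists w => // i iI; rewrite -h ?e // -e.
Qed.

Lemma opposition_word I (t : 'I_r -> 'I_r) : opposition_on I t -> exists2 s :
  seq 'I_r,
  {subset s <= I} & forall i, i \in I -> Delta (t i) = - word_action Delta s
    (Delta i).
Proof.
by move=> [w [l [[s [sI _ e]] _] _] h]; exists s => // i iI; rewrite h // e.
Qed.

Lemma word_cf_out s v j : j \notin s -> cf (word_action Delta s v) j = cf v j.
Proof.
elim: s => // i s IHs; rewrite inE negb_or => /andP[ij js].
by rewrite word_cons cfD cfN cfZ cf_Delta eq_sym (negbTE ij) mulr0 subr0 IHs.
Qed.

(** Let [w] be the action of [s]. The inverse image of [Delta i] under [w] is a combination of the
    [Delta k] with [k] in [I]. Were its coefficients nonnegative, applying [w] again would give a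
    nonpositive coefficient at [i], instead of 1. *)
Lemma rev_word_negative I s i : i \in I ->
  {subset s <= I} -> (forall k, k \in I -> nneg (- word_action Delta s (Delta k))) ->
  nneg (- word_action Delta (rev s) (Delta i)).
Proof.
move=> iI sI hs.
have [[pos|//] _] := root_cf (word_root (rev s) (Delta_root i)).
have e := wordVK Delta_neq0 s (Delta i).
have := cf_Delta i i; rewrite eqxx -{1}e (cf_expand (word_action _ (rev s) _)).
rewrite linear_sum cf_sum => eq1.
suff : 1 <= (0 : R) by rewrite ler10.
rewrite -[leLHS]/(1%:R) -{}eq1 -oppr_ge0 -sumrN sumr_ge0 // => k _.
rewrite linearZ /= cfZ -mulrN -cfN.
have [kI|kI] := boolP (k \in I); first by rewrite mulr_ge0 // hs.
rewrite word_cf_out ?mem_rev; last by apply: contra kI => /sI.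
by rewrite cf_Delta (_ : i == k = false) ?mul0r //; apply: contraNF kI => /eqP<-.
Qed.

(** For [w] longest, [- w (Delta i)] is a sum of [n_j Delta j] with [n_j >= 0] and [j] in [I].
    Applying the inverse of [- w], which also preserves positivity on [I], writes [Delta i] as a
    nonnegative combination of nonnegative vectors. If [n_j > 0], the vector coming from [Delta j]
    is therefore a multiple of [Delta i], hence [Delta i] itself since the root system is
    reduced. *)
Lemma opposition_exists I : exists t : 'I_r -> 'I_r, opposition_on I t.
Proof.
have [s red_s max_s] := longest_reduced I.
have neg := longest_negative red_s max_s.
have [sI min_s] := red_s.
have lng : longest_element Delta I (word_action Delta s).
  exists (size s); first by split=> [|t tI /min_s]; [exists s | apply].
  move=> w' l' [[t [tI <- et]] mt]; apply: max_s; split=> // t' t'I e.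
  by apply: mt => // v; rewrite et e.
suff h i : i \in I -> exists j, Delta j = - word_action Delta s (Delta i).
  (* The default value [i] is never taken on [I]. *)
  exists (fun i => if [pick j | Delta j == - word_action Delta s (Delta i)]
                     is Some j then j else i).
  exists (word_action Delta s) => // i iI; case: pickP => [j /eqP //|no].
  by have [j ej] := h i iI; have := no j; rewrite ej eqxx.
move=> iI; have negr k (kI : k \in I) := rev_word_negative kI sI neg.
pose n (j : 'I_r) := cf (- word_action Delta s (Delta i)) j.
have n_out (j : 'I_r) : j \notin I -> n j = 0.
  move=> jI; rewrite /n cfN word_cf_out; last by apply: contra jI => /sI.
  by rewrite cf_Delta (_ : i == j = false) ?oppr0 //; apply: contraNF jI => /eqP<-.
have [j nj] : exists j, 0 < n j.
  apply: NNPP => no; have : - word_action Delta s (Delta i) = 0.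
    apply: cf_inj => j; rewrite [RHS]/cf linear0; apply: le_anti.
    rewrite [0 <= _]neg // andbT leNgt; apply/negP => h; apply: no; by exists j.
  move/eqP; rewrite oppr_eq0 => /eqP e; have := Delta_neq0 i.
  by rewrite -(wordK Delta_neq0 s (Delta i)) e linear0 eqxx.
have jI : j \in I by apply: contraLR nj => /n_out->; rewrite ltxx.
exists j.
have out k : k != i -> cf (word_action Delta (rev s) (Delta j)) k = 0.
  move=> ki; have e : \sum_l n l * cf (- word_action Delta (rev s) (Delta l)) k = 0.
    have : cf (Delta i) k = 0 by rewrite cf_Delta eq_sym (negbTE ki).
    rewrite -(wordK Delta_neq0 s (Delta i)) -[X in word_action _ (rev s) X]opprK.
    rewrite [X in - X]cf_expand -/n -sumrN linear_sum cf_sum => e0; rewrite -[RHS]e0.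
    by apply: eq_bigr => l _; rewrite linearN linearZ -scalerN cfZ.
  have := e; move/eqP; rewrite psumr_eq0 => [/allP h|l _]; last first.
    have [lI|/n_out->] := boolP (l \in I); last by rewrite mul0r.
    by rewrite mulr_ge0 // ?negr //; apply: neg.
  have := h j (mem_index_enum j); rewrite mulf_eq0 gt_eqF //= cfN oppr_eq0.
  by move/eqP.
have e : word_action Delta (rev s) (Delta j) =
    cf (word_action Delta (rev s) (Delta j)) i *: Delta i.
  apply: cf_inj => k; rewrite cfZ cf_Delta; case: (eqVneq i k) => [->|ik].
    by rewrite mulr1.
  by rewrite mulr0 out // eq_sym.
have := word_root (rev s) (Delta_root j); rewrite e.
case/(root_reduced hPhi (Delta_root i)) => c.
  by have := negr j jI i; rewrite cfN c oppr_ge0 ler10.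
by rewrite -(wordVK Delta_neq0 s (Delta j)) e c scaleN1r linearN.
Qed.

End Base.

(** * The opposition involution of a sub-diagram and its action on weights *)

Section Opposition.
Variables (R : archiRcfType) (r : nat).
Variables (Phi : seq 'rV[R]_r) (Delta : 'I_r -> 'rV[R]_r).
Hypothesis hPhi : reduced_root_system Phi.
Hypothesis hDelta : is_base Phi Delta.
Implicit Types (u v : 'rV[R]_r) (I K : {set 'I_r}) (t : 'I_r -> 'I_r).

Local Notation bd := (@bonds (dynkin Delta)).
Local Notation cf := (cf Delta).

Lemma bonds_pairing i j : i != j -> exists a b : nat,
  [/\ pairing (Delta i) (Delta j) = - a%:R,
      pairing (Delta j) (Delta i) = - b%:R,
      bd i j = (a * b)%N & (a == 0)%N = (b == 0)%N].
Proof.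
move=> ij; have ji : j != i by rewrite eq_sym.
have pairing_nat k l : k != l -> exists a : nat, pairing (Delta k) (Delta l) =
  - a%:R.
  move=> kl; have : - pairing (Delta k) (Delta l) \is a Num.nat.
    rewrite natrEint rpredN (pairing_int hPhi hDelta) oppr_ge0.
    exact: (pairing_le0 hPhi hDelta).
  by case/natrP => a ea; exists a; rewrite -ea opprK.
have [a ea] := pairing_nat _ _ ij; have [b eb] := pairing_nat _ _ ji.
exists a, b; split=> //.
  by rewrite /= (negbTE ij) ea eb mulrNN -natrM natrK.
have := pairing_eq0 hPhi hDelta i j.
rewrite (dotC (Delta i)) -(pairing_eq0 hPhi hDelta) ea eb !oppr_eq0.
by rewrite !pnatr_eq0.
Qed.

Lemma bonds_refl i : bd i i = 0%N.
Proof. by rewrite /= eqxx. Qed.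

Lemma bonds_sym i j : bd i j = bd j i.
Proof. by rewrite /= eq_sym mulrC. Qed.

Lemma bonds_eq0 i j : i != j -> (bd i j == 0)%N = (dot (Delta i) (Delta j) == 0).
Proof.
move=> ij; have [a [b [ea _ -> e]]] := bonds_pairing ij.
rewrite -(pairing_eq0 hPhi hDelta) ea oppr_eq0 pnatr_eq0 muln_eq0 -e.
by rewrite orbb.
Qed.

Definition integral v := forall k, cf v k \is a Num.int.

Lemma pairing_expand v i :
  pairing v (Delta i) = \sum_k cf v k * pairing (Delta k) (Delta i).
Proof.
rewrite {1}(cf_expand hDelta v) /pairing dot_suml mulr_sumr mulr_suml.
by apply: eq_bigr => k _; rewrite dotZl; ring.
Qed.

Lemma pairing_integral v i : integral v -> pairing v (Delta i) \is a Num.int.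
Proof.
move=> hv; rewrite pairing_expand rpred_sum // => k _.
by rewrite rpredM // (pairing_int hPhi hDelta).
Qed.

Lemma integral_reflection v i : integral v -> integral (reflection (Delta i) v).
Proof.
move=> hv k; rewrite /reflection cfD cfN cfZ rpredB // rpredM //.
  exact: pairing_integral.
by rewrite (cf_Delta hDelta) rpred_nat.
Qed.

(* [word_action Delta s] is trivial modulo the root lattice on the weights.   *)
Lemma word_weight I (N : R) v s : {subset s <= I} ->
  (forall i, i \in I -> exists m : int, pairing v (Delta i) = N * m%:~R) ->
  exists2 q, integral q & word_action Delta s v = v + N *: q.
Proof.
move=> sI hv; elim: s sI => [|i s IHs] sI.
  by exists 0 => [k|]; rewrite ?scaler0 ?addr0 // /cf linear0.
have [x xs|q hq e] := IHs; first by apply: sI; rewrite inE xs orbT.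
have [m hm] := hv i (sI i (mem_head _ _)).
exists (reflection (Delta i) q - m%:~R *: Delta i) => [k|].
  rewrite cfD cfN cfZ rpredB //; first exact: integral_reflection.
  by rewrite rpredM ?(cf_Delta hDelta) ?rpred_nat // rpred_int.
rewrite word_cons e linearD linearZ /= /reflection hm !scalerBr !scalerA.
by rewrite -addrA; congr (_ + _); rewrite addrC.
Qed.

Section OnI.
Variables (I : {set 'I_r}) (t : 'I_r -> 'I_r).
Hypothesis ht : opposition_on Delta I t.

Lemma opposition_inj : {in I &, injective t}.
Proof.
have [s sI h] := opposition_word ht => i j iI jI e.
have: Delta (t i) = Delta (t j) by rewrite e.
rewrite !h // => /oppr_inj /(can_inj (wordK (Delta_neq0 hPhi hDelta) s)).
exact: (Delta_inj hDelta).
Qed.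

(** A word in [I] does not change coefficients outside [I]. If [t i] were outside, the coefficient
    of [w (Delta i)] there would be 0 or 1, whereas it has to be [- 1]. *)
Lemma opposition_mem i : i \in I -> t i \in I.
Proof.
have [s sI h] := opposition_word ht => iI; apply: contraT => tI.
have := cf_Delta hDelta (t i) (t i); rewrite eqxx {1}h // cfN.
rewrite (word_cf_out hDelta); last by apply: contra tI => /sI.
rewrite (cf_Delta hDelta); case: eqP => _ /eqP.
  by rewrite -subr_eq0 -opprD oppr_eq0 (_ : 1 + 1 = 2%:R) ?pnatr_eq0.
by rewrite oppr0 eq_sym oner_eq0.
Qed.

Lemma opposition_bonds i j : i \in I -> j \in I -> bd (t i) (t j) = bd i j.
Proof.
move=> iI jI; rewrite /= (inj_in_eq opposition_inj) //.
have [s sI h] := opposition_word ht.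
have nz := Delta_neq0 hPhi hDelta.
suff e a b : a \in I -> b \in I ->
    pairing (Delta (t a)) (Delta (t b)) = pairing (Delta a) (Delta b).
  by rewrite !e.
move=> aI bI; rewrite !h // /pairing !(dotNl, dotNr) !opprK.
by rewrite !dot_word.
Qed.

(** The span of the simple roots of [K] is preserved by every word: a reflection in a simple root
    outside [K] fixes it pointwise, all the pairings involved being 0. *)
Lemma opposition_closed K i :
  (forall x y, x \in K -> (0 < bd x y)%N -> y \in K) ->
  i \in I -> i \in K -> t i \in K.
Proof.
move=> hK iI iK; have [s sI h] := opposition_word ht.
suff out k : k \notin K -> cf (word_action Delta s (Delta i)) k = 0.
  apply: contraT => /out; rewrite -[word_action _ _ _]opprK -h //.
  rewrite cfN (cf_Delta hDelta) eqxx => /eqP.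
  by rewrite oppr_eq0 oner_eq0.
elim: s {sI h} k => [|j s IHs] k kK.
  by rewrite (cf_Delta hDelta); case: eqP kK => // <-; rewrite iK.
rewrite word_cons /reflection cfD cfN cfZ IHs // (cf_Delta hDelta) add0r.
case: eqP kK => [<- jK|_ _]; last by rewrite mulr0 oppr0.
rewrite pairing_expand big1 ?mul0r ?oppr0 // => l _.
have [lK|/IHs->] := boolP (l \in K); last by rewrite mul0r.
have lj : l != j by apply: contraTneq lK => ->.
have/eqP : (bd l j == 0)%N.
  by rewrite -leqn0 leqNgt; apply: contra jK; apply: hK.
move/eqP; rewrite bonds_eq0 // -(pairing_eq0 hPhi hDelta) => /eqP->.
by rewrite mulr0.
Qed.

Hypothesis bonds_le1 : forall i j, (bd i j <= 1)%N.

Lemma pairing_adj i j : pairing (Delta i) (Delta j) =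
  if i == j then 2 else - (bd i j)%:R.
Proof.
case: eqVneq => [->|ij]; first by rewrite pairing_self // (Delta_neq0 hPhi hDelta).
have [a [b [-> _ e ab]]] := bonds_pairing ij; have := bonds_le1 i j.
rewrite e => h; congr (- _%:R); have [a0|a0] := posnP a.
  by rewrite a0 mul0n.
have b0 : (0 < b)%N by rewrite lt0n -ab -lt0n.
nia.
Qed.

(* Written as [c / N] the coefficients are those of a weight for the          *)
(* subsystem of [I]; the longest element acts trivially on weights modulo     *)
(* roots, hence [t] acts there as [- 1].                                      *)
Lemma opposition_congruence (N : int) (c : 'I_r -> int) :
  (forall i, i \notin I -> c i = 0) ->
  (forall j, j \in I ->
     (N %| 2 * c j - \sum_(i | (0 < bd i j)%N) c i)%Z) ->
  forall i, i \in I -> (N %| c i + c (t i))%Z.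
Proof.
move=> c_out hc i iI; have [s sI h] := opposition_word ht.
pose v := \sum_k (c k)%:~R *: Delta k.
have [j jI|q hq e] := @word_weight I N%:~R v s sI.
  have /dvdzP[m hm] := hc j jI; exists m; rewrite mulrC -rmorphM -hm.
  rewrite pairing_expand (bigD1 j) //= pairing_adj eqxx (cf_comb hDelta).
  rewrite [_ * 2]mulrC rmorphB rmorphM /= rmorph_sum /=; congr (_ + _).
  rewrite [in RHS]big_mkcond [in RHS](bigD1 j) //= eqxx add0r -sumrN.
  apply: eq_bigr => k kj.
  rewrite [in LHS]pairing_adj (negbTE kj) (cf_comb hDelta).
  have := bonds_le1 k j; rewrite /= (negbTE kj).
  by case: (Num.truncn _) => [|[|n]] // _; rewrite mulrN ?mulr1 ?mulr0.
(* Coefficients are compared at [t i]. By injectivity of [t] on [I], only the term of [i]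
   contributes to the image of [v], and it contributes [- c i]. *)
have := congr1 (fun u => cf u (t i)) e; rewrite /= cfD cfZ (cf_comb hDelta).
rewrite {1}/v linear_sum cf_sum (bigD1 i) //= big1 ?addr0; last first.
  move=> k ki; rewrite linearZ /= cfZ; have [kI|kI] := boolP (k \in I).
    rewrite -[word_action _ _ _]opprK -h // cfN (cf_Delta hDelta).
    by rewrite (inj_in_eq opposition_inj) // (negbTE ki) oppr0 mulr0.
  by rewrite c_out // mul0r.
rewrite linearZ /= cfZ -[word_action _ _ _]opprK -h // cfN (cf_Delta hDelta).
rewrite eqxx mulrN1; case/intrP: (hq (t i)) => m -> e1.
apply/dvdzP; exists (- m); apply: (@intr_inj R).
rewrite mulNr rmorphN rmorphM rmorphD /= mulrC -[RHS]opprK opprK.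
by move: e1; lra.
Qed.

End OnI.
End Opposition.

(** * Excluded diagrams *)

Section Exclusion.
Variables (R : archiRcfType) (r : nat).
Variables (Phi : seq 'rV[R]_r) (Delta : 'I_r -> 'rV[R]_r).
Hypothesis hPhi : reduced_root_system Phi.
Hypothesis hDelta : is_base Phi Delta.
Implicit Types (x y z : 'I_r) (p : seq 'I_r).

Local Notation bd := (@bonds (dynkin Delta)).
Local Notation adj := (fun x y : 'I_r => 0 < bd x y)%N.

Lemma bonds_neq x y : (0 < bd x y)%N -> x != y.
Proof. by apply: contraTneq => ->; rewrite bonds_refl. Qed.

Definition root_length x : R := Num.sqrt (dot (Delta x) (Delta x)).
(* Locked, as [dotZl] would otherwise unfold it. *)
Fact unit_root_key : unit. Proof. by []. Qed.
Definition unit_root x : 'rV[R]_r :=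
  locked_with unit_root_key ((root_length x)^-1 *: Delta x).
Let unit_rootE x : unit_root x = (root_length x)^-1 *: Delta x.
Proof. exact: unlock. Qed.

Let len_gt0 x : 0 < root_length x.
Proof. by rewrite sqrtr_gt0 dot_gt0 // (Delta_neq0 hPhi hDelta). Qed.

Let len_sqr x : root_length x ^+ 2 = dot (Delta x) (Delta x).
Proof. by rewrite sqr_sqrtr // dot_ge0. Qed.

Let E_unit x : dot (unit_root x) (unit_root x) = 1.
Proof.
rewrite unit_rootE dotZl dotZr mulrA -expr2 exprVn len_sqr mulVf // dot_eq0.
exact: (Delta_neq0 hPhi hDelta).
Qed.

Let E_le0 x y : x != y -> dot (unit_root x) (unit_root y) <= 0.
Proof.
move=> xy; have := pairing_le0 hPhi hDelta xy.
have d0 : 0 < dot (Delta y) (Delta y) by rewrite dot_gt0 // (Delta_neq0 hPhi hDelta).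
rewrite /pairing pmulr_lle0 ?invr_gt0 // pmulr_rle0 // => h.
by rewrite !unit_rootE dotZl dotZr mulrA mulr_ge0_le0 // mulr_ge0 // invr_ge0 ltW.
Qed.

Let E_sqr x y : x != y -> (2 * dot (unit_root x) (unit_root y)) ^+ 2 = (bd x y)%:R.
Proof.
move=> xy; have [a [b [ea eb -> _]]] := bonds_pairing hPhi hDelta xy.
rewrite natrM -[RHS]mulrNN -ea -eb /pairing (dotC (Delta y)) !unit_rootE dotZl dotZr.
rewrite -!len_sqr; have := len_gt0 x; have := len_gt0 y => hx hy.
by field; rewrite !gt_eqF.
Qed.

Let E_adj x y : (0 < bd x y)%N -> 2 * dot (unit_root x) (unit_root y) <= -1.
Proof.
move=> e; have xy := bonds_neq e; have := E_sqr xy; have := E_le0 xy.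
have : 1 <= (bd x y)%:R :> R by rewrite ler1n.
by move: (bd x y)%:R (dot _ _) => b d; nra.
Qed.

Definition sqrt2 : R := Num.sqrt 2.

Let h_gt0 : 0 < sqrt2. Proof. by rewrite sqrtr_gt0. Qed.

Let h_sqr : sqrt2 * sqrt2 = 2. Proof. by rewrite -expr2 sqr_sqrtr. Qed.

Let E_double x y : (1 < bd x y)%N -> 2 * dot (unit_root x) (unit_root y) <= - sqrt2.
Proof.
move=> e; have xy : x != y by apply/bonds_neq/ltnW.
have := E_sqr xy; have := E_le0 xy.
have : 2 <= (bd x y)%:R :> R by rewrite ler_nat.
have := h_gt0; have := h_sqr.
by move: (bd x y)%:R (dot _ _) sqrt2 => b d k; nra.
Qed.

(** The linear form with value 1 on every [unit_root]. A combination of unit roots on which it is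
    positive is nonzero, hence of positive norm; the exclusions below exhibit such a combination of
    norm at most 0. *)
Let psi (v : 'rV[R]_r) : R := \sum_k cf Delta v k * root_length k.

Let psiD u v : psi (u + v) = psi u + psi v.
Proof. by rewrite -big_split; apply: eq_bigr => k _; rewrite cfD mulrDl. Qed.

Let psiZ c u : psi (c *: u) = c * psi u.
Proof. by rewrite mulr_sumr; apply: eq_bigr => k _; rewrite cfZ mulrA. Qed.

Let psiE x : psi (unit_root x) = 1.
Proof.
rewrite unit_rootE psiZ /psi (bigD1 x) //= (cf_Delta hDelta) eqxx mul1r big1 ?addr0.
  by rewrite mulVf // gt_eqF.
by move=> k; rewrite (cf_Delta hDelta) eq_sym => /negbTE->; rewrite mul0r.
Qed.

Let psi_pos v : 0 < psi v -> 0 < dot v v.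
Proof.
move=> hv; apply: dot_gt0; apply: contraTneq hv => ->.
by rewrite -(scale0r 0) psiZ mul0r ltxx.
Qed.

Definition sum_roots p := \sum_(x <- p) unit_root x.

Let psiS p : psi (sum_roots p) = (size p)%:R.
Proof.
rewrite /sum_roots; elim: p => [|x p IHp];
  first by rewrite big_nil -(scale0r 0) psiZ mul0r.
by rewrite big_cons psiD psiE IHp [size _]/= -natr1 addrC.
Qed.

Let S_le0 (P : pred 'I_r) x p : x \notin p -> dot (\sum_(y <- p | P y)
  unit_root y) (unit_root x) <= 0.
Proof.
move=> xp; rewrite dot_suml -oppr_ge0 -sumrN big_seq_cond sumr_ge0 // => y.
by case/andP=> yp _; rewrite oppr_ge0 E_le0 //; apply: contraNneq xp => <-.
Qed.

Let S_one x y p : uniq p -> x \notin p -> y \in p ->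
  dot (sum_roots p) (unit_root x) <= dot (unit_root y) (unit_root x).
Proof.
move=> up xp yp; rewrite /sum_roots (bigD1_seq y) //= dotDl gerDl.
exact: S_le0.
Qed.

Let S_two x y z p : uniq p -> x \notin p -> y \in p -> z \in p -> y != z ->
  dot (sum_roots p) (unit_root x) <= dot (unit_root y) (unit_root x) + dot
    (unit_root z) (unit_root x).
Proof.
move=> up xp yp zp yz; rewrite /sum_roots (bigD1_seq y) //= dotDl lerD2l.
rewrite -big_filter (bigD1_seq z) ?filter_uniq //= ?mem_filter ?zp 1?eq_sym ?yz //.
by rewrite dotDl gerDl S_le0 // mem_filter (negbTE xp) andbF.
Qed.

Let S_adj x y p : uniq p -> x \notin p -> y \in p -> adj y x ->
  2 * dot (sum_roots p) (unit_root x) <= -1.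
Proof. by move=> up xp yp /E_adj; have := S_one up xp yp; lra. Qed.

Let S_double x y p : uniq p -> x \notin p -> y \in p -> (1 < bd y x)%N ->
  2 * dot (sum_roots p) (unit_root x) <= - sqrt2.
Proof. by move=> up xp yp /E_double; have := S_one up xp yp; lra. Qed.

(** A new first vertex [x] changes the norm by 1 plus twice the product with the old sum. This is at
    most 0, because [x] is joined to the old first vertex and the other products are nonpositive. *)
Let S_norm p : uniq p -> sorted adj p -> dot (sum_roots p) (sum_roots p) <= 1.
Proof.
elim: p => [|x p IHp]; first by rewrite /sum_roots big_nil dot0l.
move=> /= /andP[xp up] xp';
  rewrite /sum_roots big_cons -/(sum_roots p) !(dotDl, dotDr) E_unit.
case: p xp up xp' IHp => [|y p] xp up xp' IHp.
  by rewrite /sum_roots big_nil !dot0l dotC dot0l; lra.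
have /andP[exy {}xp'] := xp'.
have := IHp up xp'; have := @S_adj x y _ up xp (mem_head _ _).
rewrite bonds_sym => /(_ exy); rewrite (dotC (unit_root x)); lra.
Qed.

(** The extended diagram [A~_n]: the sum of the unit roots of the chain and of [x] has norm at most
    [1 + 1 - 2]. *)
Lemma no_cycle p x y z : uniq p -> sorted adj p -> x \notin p ->
  y \in p -> z \in p -> y != z -> adj y x -> adj z x -> False.
Proof.
move=> up sp xp yp zp yz /E_adj exy /E_adj exz.
have := S_two up xp yp zp yz; have := S_norm up sp.
have : 0 < dot (sum_roots p + unit_root x) (sum_roots p + unit_root x).
  by apply: psi_pos; rewrite psiD psiE psiS ltr_wpDl ?ler0n.
by rewrite !(dotDl, dotDr) E_unit (dotC (unit_root x)); lra.
Qed.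

(* The extended diagrams [D~_n], [C~_n] and [B~_n] and their duals: [p] is    *)
(* the chain between the two branching vertices or double bonds.              *)
Lemma no_two_branchings p a b c d : uniq p -> sorted adj p ->
  uniq [:: a; b; c; d] -> (forall x, x \in [:: a; b; c; d] ->
    x \notin p /\ exists2 y, y \in p & adj y x) -> False.
Proof.
move=> up sp uq hx.
have hS x : x \in [:: a; b; c; d] -> 2 * dot (sum_roots p) (unit_root x) <= -1.
  by move=> /hx[xp [y yp]]; apply: S_adj.
have := hS a; have := hS b; have := hS c; have := hS d.
rewrite !inE !eqxx !orbT => /(_ isT) hd /(_ isT) hc /(_ isT) hb /(_ isT) ha.
move: uq => /and4P[]; rewrite !inE !negb_or => /and3P[ab ac ad] /andP[bc bd'] cd _.
have := E_le0 ab; have := E_le0 ac; have := E_le0 ad; have := E_le0 bc.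
have := E_le0 bd'; have := E_le0 cd.
(* These are the marks of [D~_n]: the norm is at most [4 + 4 - 4 * 2]. *)
pose v := 2 *: sum_roots p + (unit_root a + unit_root b + unit_root c + unit_root d).
have : 0 < dot v v.
  by apply: psi_pos; rewrite !psiD psiZ !psiE psiS; have := ler0n R (size p); lra.
have := S_norm up sp; rewrite /v !(dotDl, dotDr, dotZl, dotZr) !E_unit.
rewrite !(dotC (unit_root _) (sum_roots p)) (dotC (unit_root b) (unit_root a)).
rewrite (dotC (unit_root d) (unit_root a)) (dotC (unit_root d) (unit_root b)).
rewrite (dotC (unit_root d) (unit_root c)) (dotC (unit_root c) (unit_root a)).
by rewrite (dotC (unit_root c) (unit_root b)); lra.
Qed.

Lemma no_two_double_bonds p a b : uniq p -> sorted adj p -> a != b ->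
  a \notin p -> b \notin p -> (exists2 y, y \in p & 1 < bd y a)%N ->
  (exists2 y, y \in p & 1 < bd y b)%N -> False.
Proof.
move=> up sp ab ap bp [y yp ya] [z zp zb].
have := S_double up ap yp ya; have := S_double up bp zp zb => hb ha.
have := E_le0 ab.
(* Roots being normalized to length 1, a double bond brings in [sqrt2]: the norm is at most
   [2 + 2 - 2 * 2]. *)
pose v := sqrt2 *: sum_roots p + (unit_root a + unit_root b).
have : 0 < dot v v.
  apply: psi_pos; rewrite !psiD psiZ !psiE psiS.
  have : 0 <= sqrt2 * (size p)%:R by rewrite mulr_ge0 ?ler0n ?ltW.
  by lra.
have := S_norm up sp; rewrite /v !(dotDl, dotDr, dotZl, dotZr) !E_unit.
rewrite !(dotC (unit_root _) (sum_roots p)) (dotC (unit_root b) (unit_root a)).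
have := ler_wpM2l (ltW h_gt0) ha; have := ler_wpM2l (ltW h_gt0) hb.
have := mulrA sqrt2 sqrt2 (dot (sum_roots p) (sum_roots p)).
by rewrite !mulrN !h_sqr; lra.
Qed.

Lemma no_double_bond_and_branching p a b c : uniq p -> sorted adj p ->
  uniq [:: a; b; c] -> (forall x, x \in [:: a; b; c] ->
    x \notin p /\ exists2 y, y \in p & adj y x) ->
  (exists2 y, y \in p & 1 < bd y a)%N -> False.
Proof.
move=> up sp uq hx [y yp ya].
have [|ap _] := hx a; first by rewrite !inE eqxx.
have hS x : x \in [:: b; c] -> 2 * dot (sum_roots p) (unit_root x) <= -1.
  move=> xbc; have [|xp [z zp]] := hx x; first by rewrite inE xbc orbT.
  exact: S_adj.
have := hS b; have := hS c.
rewrite !inE !eqxx !orbT => /(_ isT) hc /(_ isT) hb.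
have ha := S_double up ap yp ya.
move: uq => /and3P[]; rewrite !inE !negb_or => /andP[ab ac] bc _.
have := E_le0 ab; have := E_le0 ac; have := E_le0 bc.
(* The norm is at most [4 + (2 + 1 + 1) - (4 + 2 + 2)]. *)
pose v := 2 *: sum_roots p + (sqrt2 *: unit_root a + unit_root b + unit_root c).
have : 0 < dot v v.
  apply: psi_pos; rewrite !psiD !psiZ !psiE psiS.
  by have := ler0n R (size p); have := h_gt0; lra.
have := S_norm up sp; rewrite /v !(dotDl, dotDr, dotZl, dotZr) !E_unit.
rewrite !(dotC (unit_root _) (sum_roots p)) (dotC (unit_root b) (unit_root a)).
rewrite (dotC (unit_root c) (unit_root a)) (dotC (unit_root c) (unit_root b)).
have := ler_wpM2l (ltW h_gt0) ha; rewrite mulrN h_sqr.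
have := h_sqr; have := h_gt0; move: hb hc.
do 6!(move: (dot _ _) => ?); nra.
Qed.

Ltac negative_pairs :=
  repeat match goal with H : is_true (?x != ?y) |- _ =>
    move: (E_le0 H); rewrite ?(dotC (unit_root y) (unit_root x)); clear H end.

(* [E~_6] and [E~_7].                                                         *)
Lemma no_three_long_arms z a a' b b' c c' :
  uniq [:: z; a; a'; b; b'; c; c'] ->
  adj z a -> adj a a' -> adj z b -> adj b b' -> adj z c -> adj c c' -> False.
Proof.
move=> uq /E_adj h1 /E_adj h2 /E_adj h3 /E_adj h4 /E_adj h5 /E_adj h6.
(* The marks of [E~_6]: squares contribute 24, and the six edges at most [- 3 * 6 - 3 * 2]. The next
   lemma uses the marks of [E~_7] in the same way. *)
pose v := 3 *: unit_root z + 2 *: (unit_root a + unit_root b + unit_root c) +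
  (unit_root a' + unit_root b' + unit_root c').
have : 0 < dot v v by apply: psi_pos; rewrite !psiD !psiZ !psiD !psiE; lra.
rewrite {}/v !(dotDl, dotDr, dotZl, dotZr) !E_unit.
move: uq; rewrite /= !inE !negb_or -!andbA.
move=> /and5P[? ? ? ? /and5P[? ? ? ? /and5P[? ? ? ? /and5P[? ? ? ? /and5P[? ? ?
  ? /andP[? _]]]]]].
negative_pairs; move=> *; lra.
Qed.

Lemma no_two_longer_arms z a a' a'' b b' b'' c :
  uniq [:: z; a; a'; a''; b; b'; b''; c] ->
  adj z a -> adj a a' -> adj a' a'' -> adj z b -> adj b b' -> adj b' b'' ->
  adj z c -> False.
Proof.
move=> uq /E_adj h1 /E_adj h2 /E_adj h3 /E_adj h4 /E_adj h5 /E_adj h6 /E_adj h7.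
pose v := 4 *: unit_root z + 3 *: (unit_root a + unit_root b) + 2 *: (unit_root
  a' + unit_root b' + unit_root c) + (unit_root a'' + unit_root b'').
have : 0 < dot v v by apply: psi_pos; rewrite !psiD !psiZ !psiD !psiE; lra.
rewrite {}/v !(dotDl, dotDr, dotZl, dotZr) !E_unit => pos.
move: uq; rewrite /= !inE !negb_or -!andbA.
do 7?[move=> /and5P[? ? ? ?]]; move=> *.
repeat match goal with H : is_true (_ && _) |- _ => case/andP: H => ? ? end.
move: pos; negative_pairs; move=> *; lra.
Qed.

(** With equal lengths both pairings would be the same [- a], with [a >= 2], and [Delta x + Delta y]
    would have norm at most 0. This prevents an automorphism from reversing a double bond. *)
Lemma double_bond_arrow x y : (1 < bd x y)%N ->
  @arrow (dynkin Delta) x y != @arrow (dynkin Delta) y x.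
Proof.
move=> e; have xy : x != y by apply/bonds_neq/ltnW.
have [a [b [ea eb e' ab]]] := bonds_pairing hPhi hDelta xy.
have nz : dot (Delta x) (Delta y) != 0.
  by rewrite -(bonds_eq0 hPhi hDelta) //; lia.
rewrite /= nz dotC nz /=; case: ltgtP => // eq_len.
have : pairing (Delta x) (Delta y) = pairing (Delta y) (Delta x).
  by rewrite /pairing eq_len dotC.
rewrite ea eb => /oppr_inj/eqP; rewrite eqr_nat => /eqP eab.
have h2 : (2 <= a)%N by move: e; rewrite e' -eab; nia.
have dx : 0 < dot (Delta x) (Delta x) by rewrite dot_gt0 // (Delta_neq0 hPhi hDelta).
have : dot (Delta x + Delta y) (Delta x + Delta y) <= 0.
  rewrite !(dotDl, dotDr) (dotC (Delta y) (Delta x)) eq_len.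
  have : 2 * dot (Delta x) (Delta y) = - a%:R * dot (Delta x) (Delta x).
    by rewrite -ea /pairing eq_len mulfVK // gt_eqF // -eq_len.
  have h2' : 2 <= a%:R :> R by rewrite ler_nat.
  have := ler_wpM2r (ltW dx) h2'; lra.
move/dot_le0/(congr1 (fun v => cf Delta v x)).
rewrite /= cfD !(cf_Delta hDelta) eqxx eq_sym (negbTE xy) addr0.
by rewrite /cf linear0 => /eqP; rewrite oner_eq0.
Qed.

End Exclusion.

Local Open Scope nat_scope.

(** * Automorphisms of numbered graphs *)

(* [lia] is slow when hypotheses mention [bonds]. *)
Ltac arith :=
  repeat match goal with
  | H : ?T |- _ => lazymatch type of T with Prop => lazymatch T with
    | context [@bonds] => clear H
    | is_true (leq _ _) => fail
    | is_true (andb (leq _ _) (leq _ _)) => fail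
    | is_true (orb (leq _ _) (leq _ _)) => fail
    | is_true (negb (@eq_op _ _ _)) => fail
    | @eq _ _ _ => fail
    | _ /\ _ => fail
    | _ => clear H
    end end
  end; lia.

Definition edge_A (i j : nat) : bool := (i.+1 == j) || (j.+1 == i).

(* The chain [0 - ... - L.-1] with the vertex [L] attached to [k].            *)
Definition edge_T (k L i j : nat) : bool :=
  [|| (i.+1 == j) && (j < L), (j.+1 == i) && (i < L),
      (i == k) && (j == L) | (j == k) && (i == L)].

Definition half_D (n i j : nat) : bool :=
  (i.+1 == j) && (j.+1 < n) || (i.+2 == j) && (j.+1 == n).

Definition edge_D (n i j : nat) : bool := half_D n i j || half_D n j i.

Definition half_E6 (i j : nat) : bool :=
  (i, j) \in [:: (0, 2); (2, 3); (3, 4); (4, 5); (1, 3)].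

Definition edge_E6 (i j : nat) : bool := half_E6 i j || half_E6 j i.

Definition swap_D (n i : nat) : nat :=
  if i == n - 2 then n - 1 else if i == n - 1 then n - 2 else i.

Definition flip_E6 (i : nat) : nat := nth 0 [:: 5; 1; 4; 3; 2; 0] i.

Definition injective_below n (S : nat -> nat) :=
  forall i j, i < n -> j < n -> S i = S j -> i = j.

Definition graph_aut n (e : rel nat) (S : nat -> nat) :=
  [/\ forall i, i < n -> S i < n, injective_below n S &
      forall i j, i < n -> j < n -> e i j -> e (S i) (S j)].

(** An injective walk with steps of length 1 cannot turn back. *)
Lemma walk_monotone m (S : nat -> nat) : injective_below m S ->
  (forall i, i.+1 < m -> edge_A (S i) (S i.+1)) ->
  (forall i, i < m -> S i = S 0 + i) \/ (forall i, i < m -> S i + i = S 0).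
Proof.
move=> injS hS; have [m1|m1] := leqP m 1; first by left=> i im; have -> : i = 0; lia.
have := hS 0 m1; rewrite /edge_A => /orP[]/eqP h01; [left|right].
  suff h i : i.+1 < m -> S i = S 0 + i /\ S i.+1 = S 0 + i.+1.
    by move=> [|i] im; [rewrite addn0 | apply: (proj2 (h i im))].
  elim: i => [|i IHi] im; first by rewrite -h01; lia.
  have [|e1 e2] := IHi; first by lia.
  split=> //; have := hS i.+1 im; rewrite /edge_A.
  by have := injS i i.+2; lia.
suff h i : i.+1 < m -> S i + i = S 0 /\ S i.+1 + i.+1 = S 0.
  by move=> [|i] im; [rewrite addn0 | apply: (proj2 (h i im))].
elim: i => [|i IHi] im; first by rewrite -h01; lia.
have [|e1 e2] := IHi; first by lia.
split=> //; have := hS i.+1 im; rewrite /edge_A.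
by have := injS i i.+2; lia.
Qed.

Lemma aut_A n S : graph_aut n edge_A S ->
  (forall i, i < n -> S i = i) \/ (forall i, i < n -> S i = n.-1 - i).
Proof.
case=> bS injS eS; have [n0|n_gt0] := posnP n; first by left=> i; rewrite n0.
have [i im|h|h] := @walk_monotone n S injS.
- by apply: eS; rewrite /edge_A; lia.
- left=> i lt_in; have := h i lt_in; have := h n.-1; have := bS n.-1.
  by have := bS i lt_in; lia.
right=> i lt_in; have := h i lt_in; have := h n.-1; have := bS 0.
by have := bS i lt_in; lia.
Qed.

(** The vertex [n - 3] is the only one with three neighbours, so it is fixed. Among its neighbours
    only [n - 4] has another neighbour, so it is fixed too; descending the chain fixes the rest,
    except for the two ends of the fork. *)
Lemma aut_D n S : 5 <= n -> graph_aut n (edge_D n) S ->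
  (forall i, i < n -> S i = i) \/ (forall i, i < n -> S i = swap_D n i).
Proof.
move=> n5 [bS injS eS].
have nbr a x : a < n -> a != n - 3 -> edge_D n a x ->
    a < n - 3 /\ (x = a.+1 \/ x.+1 = a) \/ n - 3 < a /\ x = n - 3.
  by rewrite /edge_D /half_D; lia.
have lt_n d : 0 < d -> n - d < n by lia.
have neq d d' : d < d' <= n -> 0 < d -> S (n - d) <> S (n - d').
  move=> /andP[dd' dn] d0 e.
  by have := injS _ _ (lt_n d d0) (lt_n d' (ltn_trans d0 dd')) e; lia.
have e1 : edge_D n (S (n - 3)) (S (n - 4)).
  by apply: eS; rewrite ?lt_n // /edge_D /half_D; lia.
have e2 : edge_D n (S (n - 3)) (S (n - 2)).
  by apply: eS; rewrite ?lt_n // /edge_D /half_D; lia.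
have e3 : edge_D n (S (n - 3)) (S (n - 1)).
  by apply: eS; rewrite ?lt_n // /edge_D /half_D; lia.
have e4 : edge_D n (S (n - 4)) (S (n - 5)).
  by apply: eS; rewrite ?lt_n // /edge_D /half_D; lia.
have n1 := neq 2 4; have n2 := neq 1 4; have n3 := neq 1 2; have n4 := neq 3 5.
have b1 := bS (n - 4) (lt_n 4 isT); have b2 := bS (n - 3) (lt_n 3 isT).
have b3 := bS (n - 2) (lt_n 2 isT); have b4 := bS (n - 1) (lt_n 1 isT).
have s3 : S (n - 3) = n - 3.
  apply/eqP/negPn/negP => ne.
  have := nbr _ _ b2 ne e1; have := nbr _ _ b2 ne e2; have := nbr _ _ b2 ne e3.
  by move: (S (n - 3)) (S (n - 4)) (S (n - 2)) (S (n - 1)) n1 n2 n3; clear -n5; lia.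
have s4 : S (n - 4) = n - 4.
  have : S (n - 4) != n - 3 by apply/eqP => e; apply: (neq 3 4);
    rewrite ?e ?s3 //; lia.
  move: e1 e4 n4 b1; rewrite s3.
  move: (S (n - 4)) (S (n - 5)) => x y e1 e4 n4 b1 ne.
  by have := nbr _ _ b1 ne e4; move: e1 n4; rewrite /edge_D /half_D; clear -n5; lia.
have h d : d.+4 <= n -> S (n - d.+4) = n - d.+4 /\ S (n - d.+3) = n - d.+3.
  elim: d => [|d IHd] le_n; first by rewrite s3 s4.
  have [|f1 f2] := IHd; first by lia.
  have e5 : edge_D n (n - d.+4) (S (n - d.+4.+1)).
    by rewrite -[X in edge_D n X]f1; apply: eS;
      rewrite ?lt_n // /edge_D /half_D; lia.
  have ne : S (n - d.+4.+1) <> n - d.+3.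
    by move=> e; apply: (@neq d.+3 d.+4.+1) => //; [lia | rewrite f2 e].
  split=> //; move: (S _) e5 ne => x e5 ne.
  by case: (nbr _ _ _ _ e5); lia.
have chain i : i < n - 2 -> S i = i.
  move=> lt_i; have [i3'|i3'] := eqVneq i (n - 3); first by rewrite i3'.
  have := h (n - 4 - i); have -> : n - (n - 4 - i).+4 = i by lia.
  by case=> //; lia.
have {neq}n3 := neq 1 2.
have ends : S (n - 2) = n - 2 /\ S (n - 1) = n - 1 \/
            S (n - 2) = n - 1 /\ S (n - 1) = n - 2.
  have := chain (S (n - 2)); have := chain (S (n - 1)).
  have := injS _ _ (lt_n 2 isT) b3; have := injS _ _ (lt_n 1 isT) b4.
  move: (S (n - 2)) (S (n - 1)) b3 b4 n3 => x y b3 b4 n3 i1 i2 cy cx.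
  have : n - 2 <= x by rewrite leqNgt; apply/negP => lt_x;
    have := i2 (esym (cx lt_x)); lia.
  have : n - 2 <= y by rewrite leqNgt; apply/negP => lt_y;
    have := i1 (esym (cy lt_y)); lia.
  by clear -n5 b3 b4 n3; lia.
case: ends => -[s2 s1]; [left|right] => i lt_i; rewrite /swap_D.
  have [/chain//|le_i] := ltnP i (n - 2).
  by have [->|ne] := eqVneq i (n - 2); [|have -> : i = n - 1 by lia].
have [lt_i2|le_i] := ltnP i (n - 2).
  by rewrite chain // !ifN //; apply/eqP; lia.
have [->|ne] := eqVneq i (n - 2); first by rewrite s2.
by have -> : i = n - 1 by [lia]; rewrite eqxx s1.
Qed.

(** The arms at the branching vertex 2 have the distinct lengths 2, [L - 3 >= 3] and 1, so none can
    be moved. *)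
Lemma aut_T2 L S : 6 <= L -> graph_aut L.+1 (edge_T 2 L) S ->
  forall i, i <= L -> S i = i.
Proof.
move=> L6 [bS injS eS].
have nbr a x : a != 2 -> a <= L -> edge_T 2 L a x ->
    a < L /\ (x = a.+1 /\ x < L \/ x.+1 = a) \/ a = L /\ x = 2.
  by rewrite /edge_T; lia.
have nbr2 x : edge_T 2 L 2 x -> [\/ x = 1, x = 3 | x = L].
  rewrite /edge_T => e; have : (x == 1) || (x == 3) || (x == L) by lia.
  by case/orP=> [/orP[]|] /eqP->; [constructor 1|constructor 2|constructor 3].
have edge i j : i <= L -> j <= L -> edge_T 2 L i j -> edge_T 2 L (S i) (S j).
  exact: eS.
have neq i j : i <= L -> j <= L -> i <> j -> S i <> S j.
  by move=> hi hj ij e; apply: ij; apply: injS.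
have e1 : edge_T 2 L (S 2) (S 1) by apply: edge; rewrite /edge_T; lia.
have e2 : edge_T 2 L (S 2) (S 3) by apply: edge; rewrite /edge_T; lia.
have e3 : edge_T 2 L (S 2) (S L) by apply: edge; rewrite /edge_T; lia.
have e4 : edge_T 2 L (S 1) (S 0) by apply: edge; rewrite /edge_T; lia.
have e5 : edge_T 2 L (S 3) (S 4) by apply: edge; rewrite /edge_T; lia.
have e6 : edge_T 2 L (S 4) (S 5) by apply: edge; rewrite /edge_T; lia.
have n13 : S 1 <> S 3 by apply: neq; lia.
have n1L : S 1 <> S L by apply: neq; lia.
have n3L : S 3 <> S L by apply: neq; lia.
have n12 : S 1 <> S 2 by apply: neq; lia.
have n32 : S 3 <> S 2 by apply: neq; lia.
have n20 : S 2 <> S 0 by apply: neq; lia.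
have n24 : S 2 <> S 4 by apply: neq; lia.
have n35 : S 3 <> S 5 by apply: neq; lia.
have s2 : S 2 = 2.
  apply/eqP/negPn/negP => ne.
  have b2 : S 2 <= L by apply: bS; lia.
  have := nbr _ _ ne b2 e1; have := nbr _ _ ne b2 e2; have := nbr _ _ ne b2 e3.
  by move: (S 1) (S 2) (S 3) (S L) n13 n1L n3L; clear; lia.
rewrite s2 in e1 e2 e3 n12 n32 n20 n24.
have [m0 m1 m3 m4] : [/\ S 0 <= L, S 1 <= L, S 3 <= L & S 4 <= L].
  by split; apply: bS; lia.
have s1 : S 1 <> L.
  by move=> e; move: e4 n20; rewrite e /edge_T; clear -L6; lia.
have s3 : S 3 = 3.
  case: (nbr2 _ e2) => // e; last first.
    by move: e5 n24; rewrite e /edge_T; clear -L6; lia.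
  have f4 : S 4 = 0 by move: e5 n24; rewrite e /edge_T; clear -L6; lia.
  by move: e6 n35; rewrite f4 e /edge_T; clear -L6; lia.
have {s1}s1 : S 1 = 1 by case: (nbr2 _ e1) => // e; case: n13; rewrite e s3.
have sL : S L = L.
  by case: (nbr2 _ e3) => // e; [case: n1L; rewrite e s1 | case: n3L; rewrite e s3].
have s0 : S 0 = 0 by move: e4 n20; rewrite s1 /edge_T; clear -L6; lia.
have s4 : S 4 = 4 by move: e5 n24; rewrite s3 /edge_T; clear -L6; lia.
have h i : i.+4 < L -> S i.+3 = i.+3 /\ S i.+4 = i.+4.
  elim: i => [|i IHi] lt_i; first by rewrite s3 s4.
  have [|f1 f2] := IHi; first by lia.
  have e : edge_T 2 L i.+4 (S i.+4.+1).
    by rewrite -[X in edge_T 2 L X]f2; apply: edge; rewrite /edge_T; lia.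
  have ne : S i.+3 <> S i.+4.+1 by apply: neq; lia.
  by split=> //; move: e ne; rewrite f1 /edge_T; clear -lt_i; lia.
move=> i le_i; have [i5|i5] := leqP 5 i; last first.
  by case: i le_i i5 => [|[|[|[|[|]]]]].
have [->//|iL] := eqVneq i L.
by have [] := h (i - 4); have -> : (i - 4).+4 = i by [lia]; lia.
Qed.

Lemma aut_permutation n S : (forall i, i < n -> S i < n) ->
  injective_below n S -> map S (iota 0 n) \in permutations (iota 0 n).
Proof.
move=> bS injS; rewrite mem_permutations.
have U : uniq (map S (iota 0 n)).
  rewrite map_inj_in_uniq ?iota_uniq // => i j; rewrite !mem_iota.
  by move=> /andP[_ hi] /andP[_ hj]; apply: injS.
apply: uniq_perm; rewrite ?iota_uniq // => x.
have [x' /mapP[i]||_ ->//] := uniq_min_size (s2 := iota 0 n) U;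
  last by rewrite size_map.
by rewrite !mem_iota => /andP[_ hi] ->; apply: bS.
Qed.

Definition preserves n (e : rel nat) (l : seq nat) :=
  all (fun i => all (fun j => e i j ==> e (nth 0 l i) (nth 0 l j)) (iota 0 n))
    (iota 0 n).

Lemma aut_preserves n (e : rel nat) S : graph_aut n e S ->
  preserves n e (map S (iota 0 n)).
Proof.
case=> bS injS eS; apply/allP => i; rewrite mem_iota => /andP[_ hi].
apply/allP => j; rewrite mem_iota => /andP[_ hj]; apply/implyP => e_ij.
rewrite !(nth_map 0) ?size_iota // !nth_iota // ?add0n.
exact: eS.
Qed.

(** Reduces a property of all automorphisms to a computation over the list of all permutations,
    feasible for the small graphs E_6 and D_4. *)
Lemma aut_cases n (e : rel nat) (P : pred (seq nat)) S :
  all (fun l => preserves n e l ==> P l) (permutations (iota 0 n)) ->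
  graph_aut n e S -> P (map S (iota 0 n)).
Proof.
move=> /allP h autS; have [bS injS _] := autS.
have /h/implyP : map S (iota 0 n) \in permutations (iota 0 n).
  by apply: aut_permutation.
by apply; apply: aut_preserves.
Qed.

Lemma aut_E6 S : graph_aut 6 edge_E6 S ->
  (forall i, i < 6 -> S i = i) \/ (forall i, i < 6 -> S i = flip_E6 i).
Proof.
have h : all (fun l => preserves 6 edge_E6 l ==>
    ((l == map id (iota 0 6)) || (l == map flip_E6 (iota 0 6)))) (permutations
      (iota 0 6)).
  by vm_compute.
by case/(aut_cases h)/orP => /eqP/eq_in_map e; [left|right] => i i6;
   apply: e; rewrite mem_iota.
Qed.

Lemma aut_D4 S : graph_aut 4 (edge_D 4) S -> S 1 = 1.
Proof.
have h : all (fun l => preserves 4 (edge_D 4) l ==> (nth 0 l 1 == 1))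
    (permutations (iota 0 4)) by vm_compute.
by move/(aut_cases h)/eqP.
Qed.

(** * Classification *)

Section Charts.
Variable D : diagram.

(** A numbering [h] of the vertices, with inverse [q], under which the simply laced diagram becomes
    the graph [e] on [0, ..., n - 1]. Values of [q] from [n] on are arbitrary. *)
Record chart n (e : rel nat) (h : vertex D -> nat) (q : nat -> vertex D) : Prop := {
  chart_lt : forall x, h x < n;
  chartK : cancel h q;
  chartVK : forall i, i < n -> h (q i) = i;
  chart_bonds : forall x y, bonds x y = e (h x) (h y);
  chart_arrow : forall x y : vertex D, arrow x y = false
}.

Lemma of_type_chart n (e : rel nat) : 0 < n ->
  of_type D (simply_laced (fun i j : 'I_n => e i j)) ->
  exists h q, chart n (fun i j => e i j || e j i) h q.
Proof.
case: n => // n _ [f [[g fK gK] fb fa]].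
exists (fun x => f x : 'I_n.+1), (fun i => g (inord i)); split => [x|x|i hi|x y|x y].
- exact: ltn_ord.
- by rewrite inord_val fK.
- by rewrite gK /= inordK.
- by rewrite -fb.
by rewrite -fa.
Qed.

Lemma chart_of_type n (e : rel nat) h q :
  chart n (fun i j => e i j || e j i) h q ->
  of_type D (simply_laced (fun i j : 'I_n => e i j)).
Proof.
move=> [lt_h hK qK hb ha]; exists (fun x => Ordinal (lt_h x)); split=> //.
exists (fun i => q (nat_of_ord i)) => [x|i]; first by rewrite /= hK.
by apply: val_inj; rewrite /= qK.
Qed.

End Charts.

(** Reverses the chain of [edge_T] and fixes the attached vertex, which moves the branching from [k]
    to [L.-1 - k]. *)
Definition rev_T (L i : nat) : nat := if i == L then L else L.-1 - i.

Lemma rev_TP L i : 0 < L -> i <= L ->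
  i = L /\ rev_T L i = L \/ i < L /\ rev_T L i = L.-1 - i.
Proof.
rewrite /rev_T => L0 le_i; case: eqVneq => [->|ne]; [left|right] => //.
by rewrite ltn_neqAle ne.
Qed.

Lemma rev_T_le L i : rev_T L i <= L.
Proof. by rewrite /rev_T; case: eqP; lia. Qed.

Lemma rev_TK L i : 0 < L -> i <= L -> rev_T L (rev_T L i) = i.
Proof.
move=> L0 le_i; have := rev_TP L0 le_i; have := rev_TP L0 (rev_T_le L i).
by lia.
Qed.

Lemma edge_T_rev k L i j : 0 < k < L.-1 -> i <= L -> j <= L ->
  edge_T (L.-1 - k) L (rev_T L i) (rev_T L j) = edge_T k L i j.
Proof.
move=> hk hi hj; have L0 : 0 < L by lia.
case: (rev_TP L0 hi) => -[{}hi ->]; case: (rev_TP L0 hj) => -[{}hj ->].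
- by rewrite /edge_T; lia.
- by rewrite /edge_T; lia.
- by rewrite /edge_T; lia.
by apply/idP/idP; rewrite /edge_T => /or4P[]; lia.
Qed.

Lemma edge_D_rev L i j : 2 < L -> i <= L -> j <= L ->
  edge_D L.+1 (rev_T L i) (rev_T L j) = edge_T 1 L i j.
Proof.
move=> hk hi hj; have L0 : 0 < L by lia.
case: (rev_TP L0 hi) => -[{}hi ->]; case: (rev_TP L0 hj) => -[{}hj ->];
  rewrite /edge_D /half_D /edge_T; lia.
Qed.

Section Classification.
Variables (R : archiRcfType) (r : nat).
Variables (Phi : seq 'rV[R]_r) (Delta : 'I_r -> 'rV[R]_r).
Hypothesis hPhi : reduced_root_system Phi.
Hypothesis hDelta : is_base Phi Delta.

Local Notation D := (dynkin Delta).
Local Notation bd := (@bonds (dynkin Delta)).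
Local Notation adj := (fun x y : 'I_r => 0 < bd x y).

(** With single bonds the two pairings of adjacent simple roots are equal, and so are the lengths;
    the arrow is not defined on orthogonal roots. *)
Lemma simply_laced_arrow : (forall x y, bd x y <= 1) ->
  forall x y, @arrow D x y = false.
Proof.
move=> sl x y; rewrite /=; have [->|xy] := eqVneq x y; first by rewrite ltxx andbF.
have [//|nz /=] := eqVneq (dot (Delta x) (Delta y)) 0%R.
have: pairing (Delta x) (Delta y) = pairing (Delta y) (Delta x).
  rewrite (pairing_adj hPhi hDelta sl x y) (pairing_adj hPhi hDelta sl y x).
  by rewrite (eq_sym y) (negbTE xy) (bonds_sym y x).
have dx := Delta_neq0 hPhi hDelta x; have dy := Delta_neq0 hPhi hDelta y.
rewrite -dot_eq0 in dx; rewrite -dot_eq0 in dy.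
rewrite /pairing (dotC (Delta y) (Delta x)).
have nz2 : (2 * dot (Delta x) (Delta y) != 0)%R by rewrite mulf_neq0 ?pnatr_eq0.
by move/(mulfI nz2)/invr_inj => ->; rewrite ltxx.
Qed.

Hypothesis conn : forall x y : 'I_r, connect adj x y.

Lemma closed_all (P : pred 'I_r) x0 : P x0 ->
  (forall x y, P x -> adj x y -> P y) -> forall x, P x.
Proof.
move=> P0 hP x; have /connectP[p hp ->] := conn x0 x.
elim: p x0 P0 hp => //= y p IHp x0 P0 /andP[e hp].
by apply: IHp hp; apply: hP e.
Qed.

Lemma longest_path : 0 < r -> exists p : seq 'I_r,
  [/\ uniq p, sorted adj p, p != [::] &
      forall q : seq 'I_r, uniq q -> sorted adj q -> size q <= size p].
Proof.
move=> r0; pose P n := [exists t : n.-tuple 'I_r, uniq t && sorted adj t].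
have exP : exists n, P n.
  by exists 1; apply/existsP; exists [tuple Ordinal r0].
have bdP n : P n -> n <= r.
  case/existsP=> t /andP[ut _].
  rewrite -(size_tuple t) -(card_uniqP ut).
  by apply: leq_trans (max_card _) _; rewrite card_ord.
have [n /existsP[t /andP[ut st]] max_n] := ex_maxnP exP bdP.
have hmax (s : seq 'I_r) : uniq s -> sorted adj s -> size s <= n.
  by move=> us ss; apply: max_n; apply/existsP; exists (in_tuple s); rewrite us.
exists t; split=> // [|s]; last by rewrite size_tuple; apply: hmax.
by rewrite -size_eq0 size_tuple -lt0n; apply: (hmax [:: Ordinal r0]).
Qed.

Variable sigma : {perm 'I_r}.
Hypothesis sigma_aut : sigma \in diagram_Aut D.
Hypothesis sigma_neq1 : sigma != 1%g.

Lemma aut_bonds (s : {perm 'I_r}) : s \in diagram_Aut D ->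
  forall x y, bd (s x) (s y) = bd x y.
Proof. by rewrite inE => /forallP h x y; have /forallP/(_ y)/andP[/eqP] := h x. Qed.

Lemma aut_arrow (s : {perm 'I_r}) : s \in diagram_Aut D ->
  forall x y, @arrow D (s x) (s y) = @arrow D x y.
Proof. by rewrite inE => /forallP h x y;
  have /forallP/(_ y)/andP[_ /eqP] := h x. Qed.

Lemma chart_graph_aut n (e : rel nat) (h : 'I_r -> nat) (q : nat -> 'I_r)
    (s : {perm 'I_r}) :
  (forall x, h x < n) -> cancel h q -> (forall i, i < n -> h (q i) = i) ->
  (forall x y, adj x y = e (h x) (h y)) ->
  s \in diagram_Aut D -> graph_aut n e (fun i => h (s (q i))).
Proof.
move=> lt_h hK qK hb autS; split=> // [i j hi hj /(can_inj hK)/perm_inj|i j hi hj].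
  by move/(congr1 h); rewrite !qK.
by rewrite -hb (aut_bonds autS) hb !qK.
Qed.

Lemma perm_neq1 (h : 'I_r -> nat) (q : nat -> 'I_r) n : cancel h q ->
  (forall x, h x < n) -> (forall i, i < n -> h (sigma (q i)) = i) -> False.
Proof.
move=> hK lt_h hS; move/eqP: sigma_neq1; apply; apply/permP => x.
by rewrite perm1 -{1}(hK x); apply: (can_inj hK); rewrite hS.
Qed.

(** The arms have lengths [k], [L.-1 - k] and 1, and the first may be taken not longer than the
    second. If [k = 1] this is D_n; if [k >= 3] it contains [E~_7]; if [k = 2], then [L = 5] gives
    E_6, and for larger [L] no nontrivial [sigma] exists. *)
Lemma chart_T_type L k h q : 0 < k < L.-1 -> @chart D L.+1 (edge_T k L) h q ->
  (exists2 n, 4 <= n & of_type D (type_D n)) \/ of_type D type_E6.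
Proof.
wlog le_k : k h q / k <= L.-1 - k => [hw hk ch|].
  have [/hw|lt_k] := leqP k (L.-1 - k); first by apply; eauto.
  have [lt_h hK qK hb ha] := ch; have L0 : 0 < L by lia.
  apply: (hw (L.-1 - k) (rev_T L \o h) (q \o rev_T L)); try lia.
  split=> // [x|x|i hi|x y].
  - by rewrite /= ltnS rev_T_le.
  - by rewrite /= rev_TK ?hK //; apply: lt_h.
  - by rewrite /= qK ?rev_TK // ltnS rev_T_le.
  by rewrite hb /= edge_T_rev //; apply: lt_h.
move=> hk ch; have [lt_h hK qK hb ha] := ch; have L0 : 0 < L by lia.
have [k1|k1] := leqP k 1.
  left; exists L.+1; first lia.
  apply: (@chart_of_type D L.+1 (half_D L.+1) (rev_T L \o h) (q \o rev_T L)).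
  split=> // [x|x|i hi|x y].
  - by rewrite /= ltnS rev_T_le.
  - by rewrite /= rev_TK ?hK //; apply: lt_h.
  - by rewrite /= qK ?rev_TK // ltnS rev_T_le.
  have k_eq : k = 1 by lia.
  rewrite hb /= -/(edge_D _ _ _) edge_D_rev ?k_eq //; try exact: lt_h; lia.
have bE i j : i <= L -> j <= L -> edge_T k L i j -> adj (q i) (q j).
  by move=> hi hj e; rewrite hb !qK ?ltnS // e.
have [k2|k2] := leqP 3 k.
  have qinj : {in iota 0 L.+1 &, injective q}.
    by move=> i j; rewrite !mem_iota => hi hj /(congr1 h); rewrite !qK.
  pose l := [:: k; k - 1; k - 2; k - 3; k + 1; k + 2; k + 3; L].
  have ul : uniq (map q l).
    rewrite (map_inj_in_uniq (sub_in2 _ qinj)); first by rewrite /= !inE; lia.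
    by move=> i; rewrite !inE mem_iota; lia.
  case: (no_two_longer_arms hPhi hDelta ul); apply: bE; rewrite /edge_T; lia.
have {}k2 : k = 2 by lia.
rewrite {}k2 in le_k hk hb bE ch; have [L6|L6] := leqP 6 L.
  case: (@perm_neq1 h q L.+1) => // i hi;
    apply: (@aut_T2 L (fun i => h (sigma (q i)))) => //.
  by apply: chart_graph_aut => // x y; rewrite hb lt0b.
have eL : L = 5 by lia.
rewrite {}eL in lt_h qK hb; right.
(* The renumbering of [type_E6]: the chain becomes 0, 2, 3, 4, 5, and the attached vertex 5 becomes
   1. *)
pose rv i := nth 0 [:: 0; 2; 3; 4; 5; 1] i; pose rw i := nth 0 [:: 0; 5; 1; 2;
  3; 4] i.
apply: (@chart_of_type D 6 half_E6 (rv \o h) (q \o rw)); split=> // [x|x|i hi|x y].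
- by rewrite /=; move: (h x) (lt_h x) => [|[|[|[|[|[|]]]]]].
- by rewrite -[RHS]hK /=; move: (h x) (lt_h x) => [|[|[|[|[|[|]]]]]].
- by rewrite /= qK; case: i hi => [|[|[|[|[|[|]]]]]].
rewrite hb /=; move: (h x) (lt_h x) => [|[|[|[|[|[|]]]]]] // _;
  by move: (h y) (lt_h y) => [|[|[|[|[|[|]]]]]].
Qed.

(** A longest chain [v 0, ..., v L.-1] has no chord. If it is the whole diagram, [sigma] must
    reverse it, which rules out double bonds. Otherwise some [u] hangs on an inner vertex [v k]. A
    further vertex would create a second branching or three long arms, and a double bond cannot
    coexist with the branching, so the diagram is the tree of [chart_T_type]. *)
Lemma classification :
  [\/ exists2 n, 2 <= n & of_type D (type_A n),
      exists2 n, 4 <= n & of_type D (type_D n) | of_type D type_E6].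
Proof.
have [x0 sx0] : exists x0, sigma x0 != x0.
  apply/existsP; apply: contraR sigma_neq1 => /existsPn h.
  by apply/eqP/permP => x; rewrite perm1; apply/eqP; have := h x; rewrite negbK.
have [|p [up sp p0 max_p]] := longest_path; first exact: leq_ltn_trans (ltn_ord x0).
have adj_sym x y : adj x y = adj y x by rewrite bonds_sym.
pose L := size p; pose v := nth x0 p.
have L0 : 0 < L by rewrite lt0n size_eq0.
have vp i : i < L -> v i \in p by apply: mem_nth.
have vinj i j : i < L -> j < L -> v i = v j -> i = j.
  by move=> hi hj /eqP; rewrite nth_uniq // => /eqP.
have vS i : i.+1 < L -> adj (v i) (v i.+1).
  by move=> hi; have /(sortedP x0)/(_ i hi) := sp.
have slice i j : i <= j -> j < L -> exists s : seq 'I_r,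
    [/\ uniq s, sorted adj s, forall k, i <= k <= j -> v k \in s &
        forall x, x \in s -> exists2 k, i <= k <= j & x = v k].
  move=> ij jL; exists (take (j - i).+1 (drop i p)).
  have sz : size (take (j - i).+1 (drop i p)) = (j - i).+1.
    by rewrite size_takel // size_drop -/L; arith.
  split=> [||k hk|x]; first by rewrite take_uniq ?drop_uniq.
  - by rewrite take_sorted ?drop_sorted.
  - apply/(nthP x0); exists (k - i); first by rewrite sz; arith.
    by rewrite nth_take ?nth_drop ?subnKC //; arith.
  case/(nthP x0) => k; rewrite sz => hk <-; exists (i + k); first by arith.
  by rewrite nth_take // nth_drop.
have chord i j : i < j -> j < L -> adj (v i) (v j) -> j = i.+1.
  move=> ij jL e; apply/eqP/negPn/negP => ne.
  have [|//|s [us ss hs sv]] := slice i.+1 j; first arith.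
  apply: (@no_cycle _ _ _ _ hPhi hDelta s (v i) (v i.+1) (v j)) => //.
  - by apply/negP => /sv[k hk] /vinj; arith.
  - by apply: hs; arith.
  - by apply: hs; arith.
  - by apply/negP => /eqP/vinj; arith.
  - by rewrite adj_sym; apply: vS; arith.
  by rewrite adj_sym.
have sorted_cons x s : s != [::] -> sorted adj s -> adj x (nth x0 s 0) ->
    sorted adj (x :: s).
  by case: s => // y s _ hs e; apply/andP.
have sorted_rcons x s : s != [::] -> sorted adj s -> adj x (nth x0 s (size s).-1) ->
    sorted adj (rcons s x).
  case: s => // y s _ hs; rewrite nth_last adj_sym => e.
  by rewrite /= rcons_path; apply/andP.
have first_nbr x : adj x (v 0) -> x \in p.
  move=> e; apply: contraT => xp; have := max_p (x :: p).
  by rewrite cons_uniq xp up sorted_cons // ltnn => /(_ isT isT).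
have last_nbr x : adj x (v L.-1) -> x \in p.
  move=> e; apply: contraT => xp; have := max_p (rcons p x).
  by rewrite rcons_uniq xp up size_rcons sorted_rcons // ltnn => /(_ isT isT).
pose idx x := index x p.
have vK x : x \in p -> v (idx x) = x by apply: nth_index.
have Kv i : i < L -> idx (v i) = i by move=> hi; apply: index_uniq.
have lt_idx x : x \in p -> idx x < L by rewrite /L index_mem.
have edgeE i j : i < L -> j < L -> adj (v i) (v j) = edge_A i j.
  move=> hi hj; apply/idP/idP => [e|/orP[]/eqP eq_ij]; last 2 first.
  - by rewrite -eq_ij in hj *; apply: vS.
  - by rewrite -eq_ij adj_sym in hi *; apply: vS.
  have := bonds_neq e; rewrite /edge_A; case: (ltngtP i j) => [ij _|ji _|->].
  - by rewrite (chord i j) // eqxx.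
  - by rewrite (chord j i) ?eqxx ?orbT // adj_sym.
  by rewrite eqxx.
have slice_out i j s k : (forall x, x \in s -> exists2 k, i <= k <= j & x = v k) ->
    j < L -> k < L -> (k < i) || (j < k) -> v k \notin s.
  by move=> hs jL hk hk'; apply/negP => /hs[l hl] /vinj; arith.
have [all_p|] := boolP [forall x, x \in p].
  have {}all_p x : x \in p by have /forallP := all_p.
  have ik x : v (idx x) = x by apply: vK.
  have il x : idx x < L by apply: lt_idx.
  have [|hS|hS] := @aut_A L (fun i => idx (sigma (v i))).
  - apply: (@chart_graph_aut L edge_A idx v) => // x y.
    by rewrite -{1}(ik x) -{1}(ik y) edgeE.
  - by case: (@perm_neq1 idx v L).
  constructor 1; exists L.
    rewrite ltn_neqAle L0 andbT; apply/eqP => L1; case/eqP: sx0.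
    by rewrite -(ik x0) -[LHS]ik; congr v; have := il x0;
      have := il (sigma (v (idx x0))); arith.
  have sv i : i < L -> sigma (v i) = v (L.-1 - i).
    by move=> hi; rewrite -[LHS]ik hS.
  have two_double i j : i < j -> j.+1 < L -> 1 < bd (v i) (v i.+1) ->
      1 < bd (v j) (v j.+1) -> False.
    move=> ij jL dbl dbl'; have [//||s [us ss hs hsv]] := slice i.+1 j; first arith.
    apply: (@no_two_double_bonds _ _ _ _ hPhi hDelta s (v i) (v j.+1)) => //.
    - by apply/negP => /eqP/vinj; arith.
    - by apply: slice_out hsv _ _ _; arith.
    - by apply: slice_out hsv _ _ _; arith.
    - by exists (v i.+1); [apply: hs; arith | rewrite bonds_sym].
    by exists (v j); first by apply: hs; arith.
  have bd1 i : i.+1 < L -> bd (v i) (v i.+1) <= 1.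
    move=> hi; rewrite leqNgt; apply/negP => dbl.
    (* The reversal carries the edge [i, i.+1] to [j, j.+1] with its ends exchanged. If [i = j] the
       bond is in the middle and its arrow would be reversed; otherwise there are two double
       bonds. *)
    pose j := L.-1 - i.+1; have ej : L.-1 - i = j.+1 by rewrite /j; arith.
    have dbl' : 1 < bd (v j) (v j.+1).
      by rewrite bonds_sym -ej -!sv ?(aut_bonds sigma_aut) // ltnW.
    have jL : j.+1 < L by rewrite /j; arith.
    case: (ltngtP i j) => [ij|ji|ij];
      [exact: two_double dbl dbl'| exact: two_double dbl' dbl|].
    have := double_bond_arrow hPhi hDelta dbl.
    by rewrite -(aut_arrow sigma_aut) !sv ?ej -/j -?ij ?eqxx // ltnW.
  have sl x y : bd x y <= 1.
    rewrite -(ik x) -(ik y); have [e|] := boolP (adj (v (idx x)) (v (idx y)));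
      last by arith.
    have := e; rewrite edgeE // => /orP[]/eqP eq_xy; rewrite -eq_xy.
      by apply: bd1; rewrite eq_xy.
    by rewrite bonds_sym; apply: bd1; rewrite eq_xy.
  apply: (@chart_of_type D L (fun i j => i.+1 == j) idx v); split=> // [x y|].
    rewrite -/(edge_A _ _) -edgeE // !ik.
    by have := sl x y; case: (bd x y) => [|[|]].
  exact: simply_laced_arrow.
move=> not_all.
have [u [k [u_p kL e_ku]]] : exists u k, [/\ u \notin p, k < L & adj (v k) u].
  apply: NNPP => no; case/negP: not_all; apply/forallP.
  apply: (@closed_all (mem p) (v 0)) => [|x y xp e]; first exact: vp.
  apply: contraT => yp; case: no; exists y, (idx x).
  by rewrite vK // lt_idx.
have inner x i : x \notin p -> i < L -> adj (v i) x -> 0 < i < L.-1.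
  move=> xp iL e; apply/andP; split.
    rewrite lt0n; apply: contraNneq xp => i0; apply: first_nbr.
    by rewrite adj_sym; move: e; rewrite i0.
  suff: i != L.-1 by arith.
  by apply: contraNneq xp => i0; rewrite last_nbr // adj_sym -i0.
have hk := inner u k u_p kL e_ku.
have out x i : x \notin p -> i < L -> x != v i.
  by move=> xp iL; apply: contraNneq xp => ->; apply: vp.
have neqv x i : x \notin p -> i < L -> v i != x.
  by move=> xp iL; rewrite eq_sym out.
have vneq i j : i < L -> j < L -> (v i != v j) = (i != j).
  by move=> iL jL; rewrite nth_uniq.
have slice_notin i j s x : (forall y, y \in s -> exists2 k, i <= k <= j & y = v k) ->
    j < L -> x \notin p -> x \notin s.
  by move=> hs jL xp; apply: contra xp => /hs[l hl ->]; apply: vp; arith.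
(* A further vertex [w] attached to some [v j] gives two branchings, at [k] and [j], possibly equal.
   One attached to [u] makes this arm of length 2. *)
have all_pu w : (w \in p) || (w == u).
  apply: (@closed_all (fun w => (w \in p) || (w == u)) u);
    first by rewrite eqxx orbT.
  move=> y {}w; case/orP => [yp e|/eqP-> e]; apply: contraT;
    rewrite negb_or => /andP[wp wu].
    have jL := lt_idx _ yp; have ej := vK _ yp; move: (idx y) jL ej => j jL ej.
    rewrite -ej in e; have hj := inner w j wp jL e.
    have [||s [us ss hs hsv]] := slice (minn k j) (maxn k j); [arith | arith |].
    have aL : (minn k j).-1 < L by arith.
    have bL : (maxn k j).+1 < L by arith.
    have ul : uniq [:: v (minn k j).-1; v (maxn k j).+1; u; w].
      by rewrite /= !inE !negb_or !vneq ?neqv // (eq_sym u) wu; arith.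
    case: (@no_two_branchings _ _ _ _ hPhi hDelta s _ _ _ _ us ss ul) => x.
    rewrite !inE => /or4P[]/eqP->.
    - split; first by apply: slice_out hsv _ _ _; arith.
      exists (v (minn k j)); first by apply: hs; arith.
      by rewrite edgeE /edge_A; arith.
    - split; first by apply: slice_out hsv _ _ _; arith.
      exists (v (maxn k j)); first by apply: hs; arith.
      by rewrite edgeE /edge_A; arith.
    - split; first by apply: slice_notin hsv _ u_p; arith.
      by exists (v k) => //; apply: hs; arith.
    split; first by apply: slice_notin hsv _ wp; arith.
    by exists (v j) => //; apply: hs; arith.
  (* Replacing [v 0, ..., v k.-1] by [w, u] yields a chain of size [L - k + 2], at most [L] by
     maximality; the other side is bounded likewise. *)
  have k2 : 2 <= k.
    have := max_p [:: w, u & drop k p]; rewrite /= size_drop -/L !inE negb_or wu.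
    have d0 : drop k p != [::] by rewrite -size_eq0 size_drop -/L; arith.
    rewrite (contra (@mem_drop _ _ _ _) wp) (contra (@mem_drop _ _ _ _) u_p).
    rewrite drop_uniq //= adj_sym e /=.
    have := @sorted_cons u _ d0 (drop_sorted _ sp).
    rewrite nth_drop addn0 -/v adj_sym e_ku => /(_ isT)/= -> /(_ isT isT); arith.
  have k3 : k + 2 < L.
    have := max_p (rcons (rcons (take k.+1 p) u) w).
    have sz : size (take k.+1 p) = k.+1 by rewrite size_takel.
    have d0 : take k.+1 p != [::] by rewrite -size_eq0 sz.
    rewrite !size_rcons sz !rcons_uniq mem_rcons inE negb_or wu take_uniq //=.
    rewrite (contra (@mem_take _ _ _ _) wp) (contra (@mem_take _ _ _ _) u_p).
    rewrite sorted_rcons ?nth_rcons ?size_rcons ?sz /= ?ltnn ?eqxx 1?adj_sym //.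
    - by move=> /(_ isT isT); rewrite -/L; arith.
    - by rewrite -size_eq0 size_rcons.
    by rewrite sorted_rcons ?take_sorted // sz nth_take // adj_sym.
  have ul : uniq [:: v k; v k.-1; v k.-2; v k.+1; v k.+2; u; w].
    have [i1 i2 i3 i4] : [/\ k.-1 < L, k.-2 < L, k.+1 < L & k.+2 < L] by split;
      arith.
    by rewrite /= !inE !negb_or !vneq ?neqv // (eq_sym u) wu; arith.
  case: (@no_three_long_arms _ _ _ _ hPhi hDelta _ _ _ _ _ _ _ ul) => //;
    rewrite edgeE /edge_A; arith.
have chord_u i : i < L -> adj (v i) u = (i == k).
  move=> iL; apply/idP/eqP => [e|->//]; apply/eqP/negPn/negP => ik.
  apply: (@no_cycle _ _ _ _ hPhi hDelta p u (v i) (v k)) => //; try exact: vp.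
  by rewrite nth_uniq.
have sl : forall x y, bd x y <= 1.
  have bd_u : bd (v k) u <= 1.
    rewrite leqNgt; apply/negP => dbl.
    have [//|//|s [us ss hs hsv]] := slice k k.
    have ul : uniq [:: u; v k.-1; v k.+1].
      have [i1 i3] : k.-1 < L /\ k.+1 < L by arith.
      by rewrite /= !inE !negb_or !vneq ?out //; arith.
    have ks : v k \in s by apply: hs; rewrite leqnn.
    apply: (@no_double_bond_and_branching _ _ _ _ hPhi hDelta s _ _ _ us ss
      ul); last by exists (v k).
    move=> x; rewrite !inE => /or3P[]/eqP->; split.
    - exact: slice_notin hsv kL u_p.
    - by exists (v k).
    - by apply: slice_out hsv _ _ _; arith.
    - by exists (v k); rewrite // edgeE /edge_A; arith.
    - by apply: slice_out hsv _ _ _; arith.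
    by exists (v k); rewrite // edgeE /edge_A; arith.
  have bd_v i : i.+1 < L -> bd (v i) (v i.+1) <= 1.
    move=> iL; rewrite leqNgt; apply/negP => dbl.
    have [ki|ik] := leqP k i.
      have [//||s [us ss hs hsv]] := slice k i; first arith.
      have ul : uniq [:: v i.+1; v k.-1; u].
        have i1 : k.-1 < L by arith.
        by rewrite /= !inE !negb_or !vneq ?neqv //; arith.
      apply: (@no_double_bond_and_branching _ _ _ _ hPhi hDelta s _ _ _ us ss ul);
        last by exists (v i) => //; apply: hs; arith.
      move=> x; rewrite !inE => /or3P[]/eqP->; split.
      - by apply: slice_out hsv _ _ _; arith.
      - by exists (v i); [apply: hs; arith | rewrite edgeE /edge_A; arith].
      - by apply: slice_out hsv _ _ _; arith.
      - by exists (v k); [apply: hs; arith | rewrite edgeE /edge_A; arith].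
      - by apply: slice_notin hsv _ u_p; arith.
      by exists (v k); first by apply: hs; arith.
    have [//||s [us ss hs hsv]] := slice i.+1 k; first arith.
    have ul : uniq [:: v i; v k.+1; u].
      have [i1 i3] : i < L /\ k.+1 < L by arith.
      by rewrite /= !inE !negb_or !vneq ?neqv //; arith.
    apply: (@no_double_bond_and_branching _ _ _ _ hPhi hDelta s _ _ _ us ss ul);
      last by exists (v i.+1); [apply: hs; arith | rewrite bonds_sym].
    move=> x; rewrite !inE => /or3P[]/eqP->; split.
    - by apply: slice_out hsv _ _ _; arith.
    - by exists (v i.+1); [apply: hs; arith | rewrite edgeE /edge_A; arith].
    - by apply: slice_out hsv _ _ _; arith.
    - by exists (v k); [apply: hs; arith | rewrite edgeE /edge_A; arith].
    - by apply: slice_notin hsv _ u_p; arith.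
    by exists (v k); first by apply: hs; arith.
  have bd_pu i : i < L -> bd (v i) u <= 1.
    move=> iL; have := chord_u i iL; case: eqP => [->//|_].
    by case: (bd _ _).
  have bd_vv i j : i < L -> j < L -> bd (v i) (v j) <= 1.
    move=> iL jL; have := edgeE i j iL jL; rewrite /edge_A.
    case: eqP => [eq_ij _|_]; first by rewrite -eq_ij; apply: bd_v; rewrite eq_ij.
    case: eqP => [eq_ij _|_]; last by case: (bd _ _).
    by rewrite -eq_ij bonds_sym; apply: bd_v; rewrite eq_ij.
  move=> x y; case/orP: (all_pu x) => [xp|/eqP->];
    case/orP: (all_pu y) => [yp|/eqP->].
  - by rewrite -(vK x xp) -(vK y yp); apply: bd_vv; apply: lt_idx.
  - by rewrite -(vK x xp); apply: bd_pu; apply: lt_idx.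
  - by rewrite -(vK y yp) bonds_sym; apply: bd_pu; apply: lt_idx.
  by rewrite bonds_refl.
have bd01 x y b : adj x y = b -> bd x y = b by have := sl x y;
  case: (bd x y) b => [|[|]] // [].
pose h x := if x == u then L else idx x.
pose q i := if i == L then u else v i.
have hP x : [/\ x = u, h x = L & x \notin p] \/ [/\ h x = idx x, x = v (idx x)
  & idx x < L].
  rewrite /h; case: eqVneq => [->|xu]; [left|right] => //.
  have := all_pu x; rewrite (negbTE xu) orbF => xp; split=> //; first by rewrite vK.
  exact: lt_idx.
have ch : @chart D L.+1 (edge_T k L) h q.
  split=> [x|x|i hi|x y|].
  - by case: (hP x) => [[_ -> _]|[-> _]] //; apply: ltnW.
  - case: (hP x) => [[-> -> _]|[-> e lt_x]]; first by rewrite /q eqxx.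
    by rewrite /q ltn_eqF.
  - rewrite /q; case: eqVneq => [->|iL]; first by rewrite /h eqxx.
    have lt_i : i < L by rewrite ltn_neqAle iL.
    by rewrite /h (negbTE (neqv _ _ u_p lt_i)) Kv.
  - apply: bd01; case: (hP x) => [[-> -> _]|[-> ex lt_x]];
      case: (hP y) => [[-> -> _]|[-> ey lt_y]].
    + by rewrite bonds_refl /edge_T; arith.
    + by move: (idx y) ey lt_y => j -> jL;
        rewrite bonds_sym chord_u // /edge_T; arith.
    + by move: (idx x) ex lt_x => i -> iL; rewrite chord_u // /edge_T; arith.
    move: (idx x) ex lt_x (idx y) ey lt_y => i -> iL j -> jL.
    by rewrite edgeE // /edge_A /edge_T; arith.
  exact: simply_laced_arrow.
by case: (chart_T_type hk ch) => ?; [constructor 2 | constructor 3].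
Qed.

End Classification.

(** * The union of the components with at least two vertices *)

Section BigPart.
Variables (R : archiRcfType) (r : nat) (Delta : 'I_r -> 'rV[R]_r).
Local Notation D := (dynkin Delta).
Local Notation bd := (@bonds (dynkin Delta)).
Local Notation adj := (fun x y : 'I_r => 0 < bd x y).
Implicit Types (I : {set 'I_r}) (x y : 'I_r).

Lemma adjacent_sym I : symmetric (@adjacent_in D I).
Proof.
move=> x y; rewrite /adjacent_in /= andbCA; congr [&& _, _ & 0 < _].
exact: (bonds_sym x y).
Qed.

(** The component of [x] has a second vertex exactly when [x] has a neighbour in [I]: the first
    vertex of a path leaving [x] is one. *)
Lemma big_partP I x :
  reflect (x \in I /\ exists2 y, y \in I & 0 < bd x y) (x \in @big_part D I).
Proof.
have sym := sym_connect_sym (adjacent_sym I).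
apply: (iffP bigcupP) => [[C /andP[/imsetP[z zI eC] card_C] xC]|[xI [y yI xy]]].
  have inC y : (y \in C) = (y \in I) && connect (@adjacent_in D I) z y.
    by rewrite eC inE.
  have := xC; rewrite inC => /andP[xI zx]; split=> //.
  have [y] : exists y, y \in C :\ x.
    by apply/set0Pn; move: card_C; rewrite -card_gt0 (cardsD1 x C) xC add1n ltnS.
  rewrite in_setD1 inC => /and3P[yx yI zy].
  have /connectP[[|w p] /= hp e] : connect (@adjacent_in D I) x y.
  - by apply: connect_trans zy; rewrite sym.
  - by rewrite e eqxx in yx.
  by case/andP: hp => /and3P[_ wI xw] _; exists w.
exists [set z in I | connect (@adjacent_in D I) x z];
  last by rewrite inE xI connect0.
rewrite imset_f //=.
have xy_neq : x != y by apply: bonds_neq xy.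
have -> : 2 = #|[set x; y]| by rewrite cards2 xy_neq.
apply/subset_leq_card/subsetP => z; rewrite !inE => /orP[]/eqP->.
  by rewrite xI connect0.
by rewrite yI connect1 // /adjacent_in /= xI yI.
Qed.

Lemma big_part_sub I : @big_part D I \subset I.
Proof. by apply/subsetP => x /big_partP[]. Qed.

Hypothesis r_gt0 : 0 < r.

Lemma connected_diagramP :
  (forall x y, connect adj x y) -> connected_diagram D.
Proof.
move=> conn; rewrite /connected_diagram /components /equivalence_partition.
suff -> : [set [set y in [set: 'I_r] | connect (@adjacent_in D [set: 'I_r]) x y]
           | x in [set: 'I_r]] = [set [set: 'I_r]] by rewrite cards1.
have full x : [set y in [set: 'I_r] | connect (@adjacent_in D [set: 'I_r]) x y]
  = [set: 'I_r].
  apply/setP => y; rewrite !inE /=; have := conn x y.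
  by rewrite (@eq_connect _ _ adj) // => u v; rewrite /adjacent_in /= !inE.
apply/setP => C; rewrite inE; apply/imsetP/eqP => [[x _ ->]|->]; first exact: full.
by exists (Ordinal r_gt0).
Qed.

End BigPart.

(** * Connectedness of the diagram, and the opposition on chains *)

Section Chain.
Variables (R : archiRcfType) (r : nat).
Variables (Phi : seq 'rV[R]_r) (Delta : 'I_r -> 'rV[R]_r).
Hypothesis hPhi : reduced_root_system Phi.
Hypothesis hDelta : is_base Phi Delta.
Local Notation D := (dynkin Delta).
Local Notation bd := (@bonds (dynkin Delta)).
Local Notation adj := (fun x y : 'I_r => 0 < bd x y).
Implicit Types (I : {set 'I_r}) (x y : 'I_r).

(** The opposition keeps [x0] in its component, so [sigma] and all its powers stabilize this
    component; by transitivity there is no other. *)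
Lemma opposition_connected I (sigma : {perm 'I_r}) x0 : x0 \in I ->
  sigma \in diagram_Aut D -> @transitive_on_components D sigma ->
  opposition_on Delta I sigma -> forall x y, connect adj x y.
Proof.
move=> x0I autS trans opp.
have sym : connect_sym adj by apply: sym_connect_sym => x y; rewrite bonds_sym.
pose comp x := [set y | connect adj x y].
have compE x : comp x \in @components D [set: 'I_r].
  apply/imsetP; exists x => //; apply/setP => y; rewrite !inE /=.
  by apply: eq_connect => u v; rewrite /adjacent_in /= !inE.
have aut_connect x y : connect adj x y -> connect adj (sigma x) (sigma y).
  case/connectP=> p hp ->; elim: p x hp => [|z p IHp] x /=;
    first by rewrite connect0.
  case/andP=> xz /IHp; apply: connect_trans; apply: connect1.
  by rewrite (aut_bonds autS).
have x0s : connect adj x0 (sigma x0).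
  have := @opposition_closed _ _ _ _ hPhi hDelta I _ opp (comp x0) x0.
  rewrite !inE; apply=> // x y; rewrite !inE => xx xy.
  exact: connect_trans xx (connect1 xy).
have stab k y : connect adj x0 y -> connect adj x0 ((sigma ^+ k)%g y).
  elim: k y => [|k IHk] y x0y; first by rewrite expg0 perm1.
  by rewrite expgS permM; apply: IHk; apply: connect_trans x0s (aut_connect _ _ x0y).
have all0 x : connect adj x0 x.
  have [k e] := trans _ _ (compE x0) (compE x).
  have : x \in comp x by rewrite inE connect0.
  by rewrite -e => /imsetP[y]; rewrite inE => x0y ->; apply: stab.
by move=> x y; apply: connect_trans (all0 y); rewrite sym.
Qed.

(** Evaluates the neighbour sum of [opposition_congruence] on an explicit list, from which
    neighbours with [c x = 0] may be omitted. *)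
Lemma neighbour_sum (c : 'I_r -> int) (s : seq 'I_r) y : uniq s ->
  (forall x, x \in s -> adj x y) -> (forall x, adj x y -> c x != 0%R -> x \in s) ->
  (\sum_(x | (0 < bd x y)%N) c x = \sum_(x <- s) c x)%R.
Proof.
move=> us s_adj adj_s; rewrite [RHS]big_uniq //= big_mkcond [RHS]big_mkcond /=.
apply: eq_bigr => x _; case: ifP => [xy|xy]; case: ifP => // xs.
  by apply/eqP; apply: contraFT xs; apply: adj_s.
by have := s_adj x xs; rewrite xy.
Qed.

Variables (I : {set 'I_r}) (t : 'I_r -> 'I_r).
Hypothesis ht : opposition_on Delta I t.
Hypothesis bonds_le1 : forall x y, bd x y <= 1.

(* [q 0, ..., q (m - 1)] is a connected component of type [A_m] of [I].  The  *)
(* weight with coefficients [(i + 1) / (m + 1)] determines [t] there.         *)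
Lemma opposition_chain m (q : nat -> 'I_r) :
  (forall i, i < m -> q i \in I) ->
  (forall i j, i < m -> j < m -> q i = q j -> i = j) ->
  (forall i, i.+1 < m -> adj (q i) (q i.+1)) ->
  (forall i y, i < m -> y \in I -> adj (q i) y ->
     exists2 j, j < m & y = q j /\ edge_A i j) ->
  forall i, i < m -> t (q i) = q (m.-1 - i).
Proof.
move=> qI qinj qS q_nbr.
pose c x : int := if [pick i : 'I_m | q i == x] is Some i then i.+1%:Z else 0.
have cq i : i < m -> c (q i) = i.+1%:Z.
  move=> hi; rewrite /c; case: pickP => [j /eqP/qinj -> //|/(_ (Ordinal hi))].
  by rewrite eqxx.
have c_out x : (c x != 0)%R -> exists2 i, i < m & x = q i.
  by rewrite /c; case: pickP => // i /eqP <- _; exists i.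
have cong := @opposition_congruence _ _ _ _ hPhi hDelta I t ht bonds_le1 m.+1%:Z c.
move=> i hi.
have {}cong := cong _ _ _ (qI i hi).
have c0 : forall x, x \notin I -> c x = 0%R.
  by move=> x; apply: contraNeq => /c_out[j hj ->]; apply: qI.
have c_weight : (forall y, y \in I -> (m.+1%:Z %| 2 * c y - \sum_(x | (0 < bd x
  y)%N) c x)%Z)%R.
  move=> y yI; have [cy|] := eqVneq (c y) 0%R.
    rewrite cy big1 ?dvdz0 // => x xy; apply/eqP/negP => /negP/c_out[j hj ex].
    have [|k hk [ey _]] := q_nbr j y hj yI; first by rewrite -ex.
    by move: cy; rewrite ey cq.
  case/c_out=> j hj ey; rewrite ey in yI *.
  pose s1 := if 0 < j then [:: q j.-1] else [::].
  pose s := s1 ++ (if j.+1 < m then [:: q j.+1] else [::]).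
  have e_sum : (\sum_(x | (0 < bd x (q j))%N) c x = \sum_(x <- s) c x)%R.
    apply: neighbour_sum => [|x|x].
    - rewrite /s /s1; case: ifP => j0; case: ifP => j1 //=.
      by rewrite inE andbT; apply/eqP => /qinj; lia.
    - rewrite /s /s1 mem_cat; case: ifP => j0; case: ifP => j1;
        rewrite ?in_nil ?inE ?orbF ?orFb //.
      + case/orP => /eqP->; last by rewrite bonds_sym qS.
        by rewrite -{2}(prednK j0) qS // prednK.
      + by move/eqP->; rewrite -{2}(prednK j0) qS // prednK.
      by move/eqP->; rewrite bonds_sym qS.
    move=> xj /c_out[k hk ex]; rewrite ex in xj *.
    have [|l hl [/qinj el]] := q_nbr j (q k) hj (qI k hk);
      first by rewrite bonds_sym.
    rewrite -el // => /orP[]/eqP ejk; rewrite /s /s1 mem_cat.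
      by rewrite ejk hk inE eqxx orbT.
    by rewrite -ejk /= inE eqxx.
  rewrite e_sum /s big_cat /= cq //.
  have -> : (\sum_(x <- s1) c x = j%:Z)%R.
    rewrite /s1; case: ifP => j0; last by rewrite big_nil; lia.
    by rewrite big_seq1 cq ?prednK //; lia.
  (* Inside the chain [2 (j + 1) - j - (j + 2) = 0]; at its right end [2 m - (m - 1) = m + 1]. *)
  case: ifP => j1; first by rewrite big_seq1 cq //; apply/dvdzP; exists 0%R; lia.
  by rewrite big_nil; apply/dvdzP; exists 1%R; lia.
have := cong c0 c_weight; rewrite cq // => /dvdzP[k hk].
have ci : (0 <= c (t (q i)) <= m%:Z)%R.
  have [->|] := eqVneq (c (t (q i))) 0%R; first by lia.
  by case/c_out=> j hj ->; rewrite cq //; lia.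
(* Both terms are at most [m] and the first is positive, so their sum, a multiple of [m + 1], equals
   [m + 1]. *)
have k1 : k = 1%R by nia.
have : (c (t (q i)) != 0)%R by rewrite k1 in hk; lia.
case/c_out=> j hj e; rewrite e cq // k1 in hk; rewrite e; congr q; lia.
Qed.

Lemma opposition_isolated x : x \in I -> (forall y, y \in I -> ~~ adj x y) -> t
  x = x.
Proof.
move=> xI iso; apply: (@opposition_chain 1 (fun _ => x) _ _ _ _ 0) => // [i j|i
  y _ yI].
  by rewrite !ltnS !leqn0 => /eqP-> /eqP->.
by rewrite (negbTE (iso y yI)).
Qed.

End Chain.

(** * Type A *)

Section SubCharts.
Variables (D : diagram) (J : {set vertex D}).

Record sub_chart m (e : rel nat) (h : vertex D -> nat) (q : nat -> vertex D) :
  Prop := {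
  sub_chart_lt : forall x, x \in J -> h x < m;
  sub_chartK : forall x, x \in J -> q (h x) = x;
  sub_chart_mem : forall i, i < m -> q i \in J;
  sub_chartVK : forall i, i < m -> h (q i) = i;
  sub_chart_bonds : forall x y, x \in J -> y \in J -> bonds x y = e (h x) (h y)
}.

Lemma sub_chart_of_type m (e : rel nat) : 0 < m ->
  of_type (subdiagram J) (simply_laced (fun i j : 'I_m => e i j)) ->
  exists h q, sub_chart m (fun i j => e i j || e j i) h q.
Proof.
move=> m0 /(of_type_chart m0)[h [q [lt_h hK qK hb _]]].
pose h' x := if insub x is Some u then h u else 0.
have h'E x (xJ : x \in J) : h' x = h (exist _ x xJ) by rewrite /h' insubT.
exists h', (fun i => val (q i)); split=> [x xJ|x xJ|i hi|i hi|x y xJ yJ].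
- by rewrite h'E.
- by rewrite h'E hK.
- exact: valP.
- by rewrite -[RHS]qK //; case: (q i) => x xJ; rewrite h'E.
rewrite !h'E; exact: (hb (exist _ x xJ) (exist _ y yJ)).
Qed.

Lemma of_type_sub_chart m (e : rel nat) h q x0 : x0 \in J ->
  (forall x y : vertex D, arrow x y = false) ->
  sub_chart m (fun i j => e i j || e j i) h q ->
  of_type (subdiagram J) (simply_laced (fun i j : 'I_m => e i j)).
Proof.
move=> x0J ha [lt_h hK qJ qK hb].
pose u0 : {x | x \in J} := exist _ x0 x0J.
apply: (@chart_of_type (subdiagram J) m e (fun u => h (val u)) (fun i => insubd
  u0 (q i))).
split=> [[x xJ]|[x xJ]|i hi|[x xJ] [y yJ]|x y] //=.
- exact: lt_h.
- by apply: val_inj; rewrite val_insubd qJ ?lt_h ?hK.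
- by rewrite val_insubd qJ ?qK.
exact: hb.
Qed.

Lemma sub_chart_card m (e : rel nat) h q : sub_chart m e h q -> #|J| = m.
Proof.
move=> [lt_h hK qJ qK _]; rewrite -[RHS]card_ord.
rewrite -(card_in_imset (f := fun i : 'I_m => q i) (D := predT)); last first.
  by move=> i j _ _ /(congr1 h); rewrite !qK // => /val_inj.
apply: eq_card => x; apply/idP/imsetP => [xJ|[i _ ->]]; last exact: qJ.
by exists (Ordinal (lt_h x xJ)); rewrite //= hK.
Qed.

End SubCharts.

(** In a numbered chain, the components of a sub-diagram are its maximal runs. *)
Lemma maximal_run n (P : pred nat) i : i < n -> P i -> exists l b,
  [/\ l <= i <= b, b < n, forall k, l <= k <= b -> P k,
      0 < l -> ~~ P l.-1 & b.+1 < n -> ~~ P b.+1].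
Proof.
move=> lt_in Pi.
have [l [le_li Pl nPl]] : exists l, [/\ l <= i, forall k, l <= k <= i -> P k &
  0 < l -> ~~ P l.-1].
  elim: i {lt_in} Pi => [|i IHi] Pi.
    by exists 0; split=> // k; rewrite leqn0 => /andP[_ /eqP->].
  have [/IHi[l [le_li Pl nPl]]|nPi] := boolP (P i).
    exists l; split=> // [|k /andP[lk]]; first exact: leqW.
    by rewrite leq_eqVlt => /orP[/eqP->//|ki]; apply: Pl; rewrite lk.
  by exists i.+1; split=> // k; rewrite -eqn_leq => /eqP<-.
have [b [le_ib lt_bn Pb nPb]] : exists b, [/\ i <= b, b < n, forall k, i <= k
  <= b -> P k & b.+1 < n -> ~~ P b.+1].
  have [d] := ubnP (n - i);
    elim: d i lt_in Pi {l le_li Pl nPl} => // d IHd i lt_in Pi le_d.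
  have [/andP[lt_i1 Pi1]|] := boolP ((i.+1 < n) && P i.+1); last first.
    rewrite negb_and => no; exists i; split=> // [k|lt_i1];
      last by rewrite lt_i1 in no.
    by rewrite -eqn_leq => /eqP<-.
  have [|b [le_ib lt_bn Pb nPb]] := IHd i.+1 lt_i1 Pi1; first by lia.
  exists b; split=> // [|k /andP[]]; first exact: ltnW.
  by rewrite leq_eqVlt => /orP[/eqP<-//|ik kb]; apply: Pb; rewrite ik.
exists l, b; split; rewrite ?le_li // => k /andP[lk kb].
by have [ki|/ltnW ik] := leqP k i; [apply: Pl; rewrite lk | apply: Pb; rewrite ik].
Qed.

Section TypeA.
Variables (R : archiRcfType) (r : nat).
Variables (Phi : seq 'rV[R]_r) (Delta : 'I_r -> 'rV[R]_r).
Hypothesis hPhi : reduced_root_system Phi.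
Hypothesis hDelta : is_base Phi Delta.
Local Notation D := (dynkin Delta).
Local Notation bd := (@bonds (dynkin Delta)).
Local Notation adj := (fun x y : 'I_r => 0 < bd x y).
Implicit Types (I J : {set 'I_r}) (x y : 'I_r).

Variables (n : nat) (h : 'I_r -> nat) (q : nat -> 'I_r).
Hypothesis ch : @chart D n edge_A h q.
Variable sigma : {perm 'I_r}.

Let lt_h : forall x, h x < n := chart_lt ch.
Let hK : cancel h q := chartK ch.
Let qK : forall i, i < n -> h (q i) = i := chartVK ch.
Let hb : forall x y, bd x y = edge_A (h x) (h y) := chart_bonds ch.
Let bd_le1 x y : bd x y <= 1. Proof. by rewrite hb leq_b1. Qed.

Definition reverses := forall x, h (sigma x) = n.-1 - h x.

(** What is left of the chain after removing [a] vertices at each end. *)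
Definition centred a I := forall x, (x \in I) = (a <= h x <= n.-1 - a).

Lemma opposition_run I t l b : opposition_on Delta I t -> l <= b -> b < n ->
  (forall k, l <= k <= b -> q k \in I) ->
  (0 < l -> q l.-1 \notin I) -> (b.+1 < n -> q b.+1 \notin I) ->
  forall k, l <= k <= b -> t (q k) = q (l + b - k).
Proof.
move=> opp lb bn inI out_l out_b k hk.
have := @opposition_chain _ _ _ _ hPhi hDelta I t opp bd_le1 (b - l).+1 (fun i
  => q (l + i)).
have e : l + (k - l) = k by lia.
move=> hc; rewrite -{1}e hc; last by lia.
- by congr q; lia.
- by move=> i hi; apply: inI; lia.
- by move=> i j hi hj /(congr1 h); rewrite !qK; lia.
- by move=> i hi; rewrite hb !qK /edge_A; lia.
move=> i y hi yI; rewrite hb qK => [e_iy|]; last by lia.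
have hy : l <= h y <= b.
  apply/andP; split; rewrite leqNgt; apply/negP => lt_y.
    have ey : h y = l.-1 by move: e_iy; rewrite /edge_A; lia.
    have l0 : 0 < l by apply: leq_ltn_trans lt_y.
    by have := out_l l0; rewrite -ey hK yI.
  have ey : h y = b.+1 by move: e_iy; rewrite /edge_A; lia.
  have b1 : b.+1 < n by rewrite -ey.
  by have := out_b b1; rewrite -ey hK yI.
exists (h y - l); first by lia.
have ey : l + (h y - l) = h y by lia.
by rewrite ey hK; split=> //; move: e_iy; rewrite /edge_A; lia.
Qed.

Lemma reverses_aut : sigma \in diagram_Aut D -> sigma != 1%g -> reverses.
Proof.
move=> autS nt.
have [|hS|hS] := @aut_A n (fun i => h (sigma (q i))).
- by apply: (@chart_graph_aut _ _ Delta) => // x y; rewrite hb lt0b.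
- by case: (perm_neq1 nt hK lt_h).
by move=> x; rewrite -[in LHS](hK x) hS.
Qed.

Lemma reverses_opposition : opposition_on Delta [set: 'I_r] sigma -> reverses.
Proof.
move=> opp x; have lt_x := lt_h x.
have e : sigma (q (h x)) = q (0 + n.-1 - h x).
  by apply: (opposition_run opp) => [||k _|//||]; rewrite ?inE //; lia.
by rewrite -{1}(hK x) e qK //; lia.
Qed.

Hypothesis sigma_rev : reverses.

Lemma reverses_neq1 : 2 <= n -> sigma != 1%g.
Proof.
move=> n2; apply/eqP => e; have := sigma_rev (q 0).
by rewrite e perm1 qK; lia.
Qed.

Lemma centred_opposition I a : a.*2 < n -> centred a I ->
  acts_as_opposition Delta I sigma.
Proof.
move=> a2 cI; have [t opp] := opposition_exists hPhi hDelta I.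
suff e : {in I, t =1 sigma} by apply/(opposition_onP _ e).
move=> x xI; have := xI; rewrite cI => hx.
have lt_x := lt_h x.
have e : t (q (h x)) = q (a + (n.-1 - a) - h x).
  apply: (opposition_run opp) => [||k hk|a0|a1|]; rewrite ?cI ?qK; lia.
by rewrite -[RHS](hK (sigma x)) sigma_rev -{1}(hK x) e; congr q; lia.
Qed.

(** A run from [l] to [b] is reversed by the opposition and the whole chain by [sigma], whence
    [l + b = n.-1]. Two runs with the same centre are nested, hence equal by maximality. *)
Lemma opposition_centred I : opposition_on Delta I sigma -> I != set0 ->
  exists2 a, a.*2 < n & centred a I.
Proof.
move=> opp /set0Pn[x xI].
have run y : y \in I -> exists l, [/\ l <= h y <= n.-1 - l,
    forall k, l <= k <= n.-1 - l -> q k \in I & 0 < l -> q l.-1 \notin I].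
  move=> yI; have [|l [b [hy lt_b inI out_l out_b]]] :=
    @maximal_run n (fun k => q k \in I) (h y) (lt_h y); first by rewrite hK.
  have lb : l <= b by lia.
  have := opposition_run opp lb lt_b inI out_l out_b (k := l).
  rewrite leqnn lb => /(_ isT)/(congr1 h); rewrite sigma_rev !qK; try lia.
  by move=> e; exists l; have -> : n.-1 - l = b by lia.
have [l [hx inI out_l]] := run x xI.
exists l; first by have := lt_h x; lia.
move=> y; apply/idP/idP => [yI|hy]; last by rewrite -(hK y); apply: inI.
have [l' [hy inI' out_l']] := run y yI.
case: (ltngtP l l') => [lt_l|lt_l|-> //].
  have l0 : 0 < l' by apply: leq_ltn_trans lt_l.
  by have := out_l' l0; rewrite inI //; have := lt_h x; lia.
have l0 : 0 < l by apply: leq_ltn_trans lt_l.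
by have := out_l l0; rewrite inI' //; have := lt_h x; lia.
Qed.

Lemma centred_type I a : a.*2 < n -> centred a I ->
  of_type (@subdiagram D I) (type_A (n - a.*2)).
Proof.
move=> a2 cI; have aI : q a \in I by rewrite cI qK; lia.
apply: (@of_type_sub_chart D I (n - a.*2) (fun i j => i.+1 == j) (fun x => h x - a)
  (fun i => q (a + i)) (q a) aI).
  exact: (simply_laced_arrow hPhi hDelta bd_le1).
split=> [x|x|i hi|i hi|x y]; rewrite ?cI ?qK //; try lia.
- by move=> hx; rewrite -[RHS]hK; congr q; lia.
by move=> hx hy; rewrite hb /edge_A; congr nat_of_bool; lia.
Qed.

(** A numbering of [J] as a chain is an injective walk in the large chain, so [J] is an interval;
    stability under the reversal centres it. *)
Lemma type_A_centred J m : 0 < m -> @stable D sigma J ->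
  of_type (@subdiagram D J) (type_A m) ->
  exists2 a, n = m + a.*2 & centred a J.
Proof.
move=> m0 stJ /(sub_chart_of_type (e := fun i j => i.+1 == j) m0)[h' [q' [lt_h'
  hK' qJ qK' hb']]].
pose S i := h (q' i).
have [lo lo_n memJ] : exists2 lo, lo + m <= n & forall x, (x \in J) = (lo <= h
  x < lo + m).
  have [i j hi hj /(can_inj hK)/(congr1 h')|i hi||] := @walk_monotone m S.
  - by rewrite !qK'.
  - have := hb' _ _ (qJ i (ltnW hi)) (qJ _ hi); rewrite hb !qK' ?(ltnW hi) //.
    by rewrite eqxx /S; case: (edge_A _ _).
  - move=> hS; exists (S 0) => [|x].
      by have := hS m.-1; have := lt_h (q' m.-1); rewrite -/(S _); lia.
    apply/idP/idP => [xJ|hx].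
      by have := hS _ (lt_h' x xJ); have := lt_h' x xJ; rewrite {1}/S hK' //; lia.
    have lt_m : h x - S 0 < m by lia.
    have := hS _ lt_m; rewrite subnKC; last by lia.
    by move/(can_inj hK) => <-; apply: qJ.
  move=> hS; have S0 : m.-1 <= S 0 by have := hS m.-1; lia.
  exists (S 0 - m.-1) => [|x].
    by have := lt_h (q' 0); rewrite -/(S 0); lia.
  apply/idP/idP => [xJ|hx].
    by have := hS _ (lt_h' x xJ); have := lt_h' x xJ; rewrite {1}/S hK' //; lia.
  have lt_m : S 0 - h x < m by lia.
  have e : S (S 0 - h x) = h x by have := hS _ lt_m; lia.
  by move/(can_inj hK): e => <-; apply: qJ.
have sJ x : x \in J -> sigma x \in J by move=> xJ; rewrite -stJ imset_f.
have := sJ (q lo); rewrite !memJ sigma_rev qK; last by lia.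
have := sJ (q (lo + m.-1)); rewrite !memJ sigma_rev qK; last by lia.
move=> h1 h2; exists lo; first by lia.
by move=> x; rewrite memJ; have := lt_h x; lia.
Qed.

End TypeA.

(** * Type D *)

Section ChartSum.
Variables (R : archiRcfType) (r : nat) (Delta : 'I_r -> 'rV[R]_r).
Local Notation D := (dynkin Delta).
Local Notation bd := (@bonds (dynkin Delta)).

Lemma chart_neighbour_sum n (e : rel nat) h q (C : nat -> int) (L : seq nat) y :
  @chart D n e h q -> uniq L -> (forall i, i \in L -> i < n /\ e i (h y)) ->
  (forall i, i < n -> e i (h y) -> C i != 0%R -> i \in L) ->
  (\sum_(x | (0 < bd x y)%N) C (h x) = \sum_(i <- L) C i)%R.
Proof.
move=> [lt_h hK qK hb _] uL L_e e_L.
rewrite (@neighbour_sum _ _ Delta (fun x => C (h x)) (map q L)).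
- rewrite big_map; apply: eq_big_seq => i /L_e[hi _]; by rewrite qK.
- rewrite map_inj_in_uniq // => i j /L_e[hi _] /L_e[hj _] /(congr1 h).
  by rewrite !qK.
- by move=> x /mapP[i /L_e[hi ei] ->]; rewrite hb qK // ei.
move=> x; rewrite hb lt0b => e_xy Cx; apply/mapP; exists (h x); last by rewrite hK.
exact: e_L.
Qed.

End ChartSum.

Lemma edge_D_chain n i j : i < n - 2 -> j < n - 2 -> edge_D n i j = edge_A i j.
Proof. by rewrite /edge_D /half_D /edge_A; lia. Qed.

Lemma edge_DC n i j : edge_D n i j = edge_D n j i.
Proof. by rewrite /edge_D orbC. Qed.

Lemma edge_D_end n i j : 2 < n -> i < n -> n - 2 <= j < n -> edge_D n i j = (i
  == n - 3).
Proof. by rewrite /edge_D /half_D; lia. Qed.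

Lemma swap_DP n i : 2 < n -> i < n ->
  [\/ i = n - 2 /\ swap_D n i = n - 1, i = n - 1 /\ swap_D n i = n - 2 |
      i < n - 2 /\ swap_D n i = i].
Proof.
move=> n2 hi; rewrite /swap_D; case: eqP => [->|ne2]; first by constructor 1.
case: eqP => [->|ne1]; first by constructor 2.
by constructor 3; split=> //; lia.
Qed.

(* [4] times the weight of a half-spin representation of the subdiagram       *)
(* [a, ..., n - 1], of type [D_(n - a)].                                      *)
Definition spin_weight (n a i : nat) : int :=
  if a <= i then
    if i == n - 2 then (n - a - 2)%:Z else
    if i == n - 1 then (n - a)%:Z else (2 * (i - a).+1)%:Z
  else 0.

Lemma spin_chain n a i : a <= i < n - 2 -> spin_weight n a i = (2 * (i - a).+1)%:Z.
Proof.
move=> /andP[ai hi]; rewrite /spin_weight ai !ifN //; apply/eqP; lia.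
Qed.

Lemma spin_end2 n a : a + 2 <= n -> spin_weight n a (n - 2) = (n - a - 2)%:Z.
Proof. by move=> an; rewrite /spin_weight eqxx ifT //; lia. Qed.

Lemma spin_end1 n a : a + 2 <= n -> spin_weight n a (n - 1) = (n - a)%:Z.
Proof. by move=> an; rewrite /spin_weight eqxx ifT ?ifN //; [apply/eqP | ]; lia. Qed.

Section TypeD.
Variables (R : archiRcfType) (r : nat).
Variables (Phi : seq 'rV[R]_r) (Delta : 'I_r -> 'rV[R]_r).
Hypothesis hPhi : reduced_root_system Phi.
Hypothesis hDelta : is_base Phi Delta.
Local Notation D := (dynkin Delta).
Local Notation bd := (@bonds (dynkin Delta)).
Local Notation adj := (fun x y : 'I_r => 0 < bd x y).
Implicit Types (I J : {set 'I_r}) (x y : 'I_r).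

Variables (n : nat) (h : 'I_r -> nat) (q : nat -> 'I_r).
Hypothesis n5 : 5 <= n.
Hypothesis ch : @chart D n (edge_D n) h q.
Variable sigma : {perm 'I_r}.

Let lt_h : forall x, h x < n := chart_lt ch.
Let hK : cancel h q := chartK ch.
Let qK : forall i, i < n -> h (q i) = i := chartVK ch.
Let hb : forall x y, bd x y = edge_D n (h x) (h y) := chart_bonds ch.
Let bd_le1 x y : bd x y <= 1. Proof. by rewrite hb leq_b1. Qed.
Let adjE x y : (0 < bd x y) = edge_D n (h x) (h y). Proof. by rewrite hb lt0b. Qed.

Definition swaps (s : {perm 'I_r}) := forall x, h (s x) = swap_D n (h x).

Definition upper a I := forall x, (x \in I) = (a <= h x).

Lemma swaps_aut s : s \in diagram_Aut D -> s != 1%g -> swaps s.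
Proof.
move=> autS nt.
have [|hS|hS] := @aut_D n (fun i => h (s (q i))) n5.
- by apply: (@chart_graph_aut _ _ Delta) => // x y; rewrite hb lt0b.
- by case: (perm_neq1 nt hK lt_h).
by move=> x; rewrite -[in LHS](hK x) hS.
Qed.

Lemma swaps_unique s s' : swaps s -> swaps s' -> s = s'.
Proof. by move=> hs hs'; apply/permP => x; apply: (can_inj hK); rewrite hs hs'. Qed.

(** The last condition on [I] treats a run reaching the branching vertex [n - 3]: it is a component
    only if it misses both ends of the fork. *)
Lemma opposition_chain_run I t l b : opposition_on Delta I t -> l <= b -> b < n
  - 2 ->
  (forall k, l <= k <= b -> q k \in I) ->
  (0 < l -> q l.-1 \notin I) -> (b.+1 < n - 2 -> q b.+1 \notin I) ->
  (b = n - 3 -> q (n - 2) \notin I /\ q (n - 1) \notin I) ->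
  forall k, l <= k <= b -> t (q k) = q (l + b - k).
Proof.
move=> opp lb bn inI out_l out_b out_end k hk.
have := @opposition_chain _ _ _ _ hPhi hDelta I t opp bd_le1 (b - l).+1 (fun i
  => q (l + i)).
have e : l + (k - l) = k by lia.
move=> hc; rewrite -{1}e hc; last by lia.
- by congr q; lia.
- by move=> i hi; apply: inI; lia.
- by move=> i j hi hj /(congr1 h); rewrite !qK; lia.
- by move=> i hi; rewrite adjE !qK ?edge_D_chain /edge_A; lia.
move=> i y hi yI; rewrite adjE qK => [e_iy|]; last by lia.
have y_chain : h y < n - 2.
  rewrite ltnNge; apply/negP => ge_y.
  have hy : n - 2 <= h y < n by rewrite ge_y lt_h.
  have := e_iy; rewrite edge_D_end //; try lia.
  move/eqP => eb; have [|o1 o2] := out_end; first by lia.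
  have [e1|e1] : h y = n - 2 \/ h y = n - 1 by lia.
    by rewrite -e1 hK yI in o1.
  by rewrite -e1 hK yI in o2.
rewrite edge_D_chain // in e_iy; last by lia.
have hy : l <= h y <= b.
  apply/andP; split; rewrite leqNgt; apply/negP => lt_y.
    have ey : h y = l.-1 by move: e_iy; rewrite /edge_A; lia.
    have l0 : 0 < l by apply: leq_ltn_trans lt_y.
    by have := out_l l0; rewrite -ey hK yI.
  have ey : h y = b.+1 by move: e_iy; rewrite /edge_A; lia.
  have b1 : b.+1 < n - 2 by rewrite -ey.
  by have := out_b b1; rewrite -ey hK yI.
exists (h y - l); first by lia.
have ey : l + (h y - l) = h y by lia.
by rewrite ey hK; split=> //; move: e_iy; rewrite /edge_A; lia.
Qed.

(** Twice [spin_weight] minus its neighbour sum is 0 at every vertex of [I] except [n - 1], where it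
    is 4. *)
Lemma spin_congruence I t a : opposition_on Delta I t -> a + 3 <= n ->
  (forall x, a <= h x -> x \in I) -> (0 < a -> q a.-1 \notin I) ->
  forall x, x \in I ->
  (4%:Z %| spin_weight n a (h x) + spin_weight n a (h (t x)))%Z%R.
Proof.
move=> opp an inI out_a.
apply: (@opposition_congruence _ _ _ _ hPhi hDelta I t opp bd_le1 4%:Z
  (fun x => spin_weight n a (h x))).
  move=> x xI; rewrite /spin_weight; case: ifP => // /inI xI'.
  by rewrite xI' in xI.
move=> y yI; have lt_y := lt_h y.
have sw i : (spin_weight n a i != 0)%R -> a <= i.
  by rewrite /spin_weight; case: ifP.
have [ay|ya] := leqP a (h y); last first.
  have -> : spin_weight n a (h y) = 0%R by rewrite /spin_weight leqNgt ya.
  rewrite big1 ?dvdz0 // => x; rewrite adjE => e_xy.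
  apply/eqP/negP => /negP/sw ax.
  have ey : h y = a.-1 by move: e_xy; rewrite /edge_D /half_D; lia.
  by have := out_a (leq_ltn_trans (leq0n _) ya); rewrite -ey hK yI.
have [y2|y2] := leqP (n - 2) (h y).
  rewrite (chart_neighbour_sum (C := spin_weight n a) (L := [:: n - 3]) ch) //.
  - rewrite big_seq1 [spin_weight n a (n - 3)]spin_chain; last by lia.
    have [->|->] : h y = n - 2 \/ h y = n - 1 by lia.
      by rewrite spin_end2; [apply/dvdzP; exists 0%R; lia | lia].
    by rewrite spin_end1; [apply/dvdzP; exists 1%R; lia | lia].
  - move=> i; rewrite inE => /eqP->; split; first by lia.
    by rewrite edge_D_end ?eqxx //; lia.
  move=> i hi; rewrite edge_D_end; try lia.
  by rewrite inE.
pose L1 := if a < h y then [:: (h y).-1] else [::].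
pose L := L1 ++ (if h y == n - 3 then [:: n - 2; n - 1] else [:: (h y).+1]).
have sum1 : (\sum_(i <- L1) spin_weight n a i = (2 * (h y - a))%:Z)%R.
  rewrite /L1; case: ifP => ay'; last by rewrite big_nil; lia.
  by rewrite big_seq1 spin_chain; lia.
rewrite (chart_neighbour_sum (C := spin_weight n a) (L := L) ch).
- rewrite big_cat /= sum1 spin_chain ?ay //; case: eqP => ey.
    by rewrite !big_cons big_nil spin_end1 ?spin_end2; lia.
  by rewrite big_seq1 spin_chain; [apply/dvdzP; exists 0%R; lia | lia].
- by rewrite /L /L1; case: ifP => ay'; case: eqP => ey; rewrite /= ?inE; lia.
- move=> i; rewrite /L /L1; case: ifP => ay'; case: eqP => ey;
    rewrite /= !inE /edge_D /half_D; lia.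
move=> i hi e_iy /sw ai; move: e_iy; rewrite /L /L1.
by case: ifP => ay'; case: eqP => ey; rewrite /= !inE /edge_D /half_D; lia.
Qed.

Hypothesis sigma_swaps : swaps sigma.

Lemma swaps_chain x : h x < n - 2 -> sigma x = x.
Proof.
move=> hx; apply: (can_inj hK); rewrite sigma_swaps /swap_D !ifN //; apply/eqP; lia.
Qed.

Lemma swaps_end2 : sigma (q (n - 2)) = q (n - 1).
Proof.
by apply: (can_inj hK); rewrite sigma_swaps !qK /swap_D ?eqxx //; lia.
Qed.

Lemma swaps_end1 : sigma (q (n - 1)) = q (n - 2).
Proof.
apply: (can_inj hK); rewrite sigma_swaps !qK; try lia.
by rewrite /swap_D eqxx ifN //; apply/eqP; lia.
Qed.

Lemma chart_cases x : [\/ h x < n - 2, x = q (n - 2) | x = q (n - 1)].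
Proof.
have lt_x := lt_h x; case: (ltngtP (h x) (n - 2)) => e; first by constructor 1.
  by constructor 3; rewrite -(hK x); congr q; lia.
by constructor 2; rewrite -e hK.
Qed.

Section Fork.
Variable I : {set 'I_r}.
Hypothesis stI : @stable D sigma I.
Hypothesis opp : opposition_on Delta I sigma.

Let stE x : (sigma x \in I) = (x \in I).
Proof.
apply/idP/idP => [|xI]; last by rewrite -stI imset_f.
by rewrite -{1}stI => /imsetP[y yI /perm_inj->].
Qed.

Let ends : (q (n - 1) \in I) = (q (n - 2) \in I).
Proof. by rewrite -swaps_end2 stE. Qed.

(** Otherwise an end of the fork would be isolated in [I], hence fixed by the opposition, whereas
    [sigma] moves it. *)
Lemma fork_center : q (n - 2) \in I -> q (n - 3) \in I.
Proof.
move=> eI; apply: contraT => cI.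
have := @opposition_isolated _ _ _ _ hPhi hDelta I _ opp bd_le1 (q (n - 2)) eI.
rewrite swaps_end2 => iso; have : q (n - 1) = q (n - 2).
  apply: iso => y yI; rewrite adjE edge_DC edge_D_end ?lt_h ?qK //; try lia.
  by apply: contraNneq cI => <-; rewrite hK.
by move/(congr1 h); rewrite !qK; lia.
Qed.

(** If the run of [x] did not continue into the fork it would be a component of type A, reversed by
    the opposition. As [sigma] fixes the chain, it would be reduced to [x], which nevertheless has a
    neighbour in [I]. *)
Lemma big_part_chain x : x \in @big_part D I -> h x < n - 2 ->
  q (n - 2) \in I /\ forall k, h x <= k < n - 2 -> q k \in I.
Proof.
move=> /big_partP[xI [y yI]]; rewrite adjE => e_xy hx.
have [|l [b [hlb lt_b inI out_l out_b]]] :=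
  @maximal_run (n - 2) (fun k => q k \in I) (h x) hx; first by rewrite hK.
have [[eb eI]|no] : (b = n - 3 /\ q (n - 2) \in I) \/ (b = n - 3 -> q (n - 2)
  \notin I).
- by have [eI|eI] := boolP (q (n - 2) \in I); have [eb|nb] := eqVneq b (n - 3);
    [left | right => /eqP; rewrite (negbTE nb) | right | right].
- by split=> // k hk; apply: inI; lia.
have lb : l <= b by lia.
have := opposition_chain_run opp lb lt_b inI out_l out_b _ (k := l).
rewrite leqnn lb addKn swaps_chain ?qK; [|arith|arith].
move=> e_lb; have {}e_lb : l = b.
  have /(congr1 h) : q l = q b by apply: e_lb => // eb; rewrite ends no.
  by rewrite !qK; arith.
have hxl : h x = l by lia.
have [y_chain|ey|ey] := chart_cases y.
- move: e_xy; rewrite edge_D_chain // hxl => /orP[]/eqP ey.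
    by have := out_b; rewrite -e_lb ey hK yI => /(_ y_chain).
  by have := out_l; rewrite -ey hK yI => /(_ isT).
- have eb : b = n - 3.
    by move: e_xy; rewrite edge_D_end ?ey ?qK //; try lia; rewrite -e_lb hxl => /eqP.
  by have := no eb; rewrite -ey yI.
have eb : b = n - 3.
  by move: e_xy; rewrite edge_D_end ?ey ?qK //; try lia; rewrite -e_lb hxl => /eqP.
by have := no eb; rewrite -ends -ey yI.
Qed.

(** If [l] is the first vertex of the component of the fork, the congruence at [n - 2], which
    [sigma] sends to [n - 1], reads [(n - l - 2) + (n - l) = 0] modulo 4, so [n - l] is odd. *)
Lemma opposition_fork : @big_part D I != set0 ->
  exists m, [/\ 1 <= m, (2 * m + 1 <= n)%N & upper (n - (2 * m + 1)) (@big_part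
    D I)].
Proof.
case/set0Pn=> x xB.
have eI : q (n - 2) \in I.
  have [/(big_part_chain xB)[]//|ex|ex] := chart_cases x.
    by rewrite -ex; have /big_partP[] := xB.
  by rewrite -ends -ex; have /big_partP[] := xB.
have cI := fork_center eI.
have [|l [b [hlb lt_b inI out_l _]]] :=
  @maximal_run (n - 2) (fun k => q k \in I) (n - 3) _ cI; first by lia.
have upI y : l <= h y -> y \in I.
  move=> ly; have [hy|->|->] := chart_cases y; rewrite ?ends //.
  by rewrite -(hK y); apply: inI; lia.
have upB : upper l (@big_part D I).
  move=> y; apply/idP/idP => [yB|ly].
    have [hy|->|->] := chart_cases y; rewrite ?qK; try lia.
    have [_ inI'] := big_part_chain yB hy; rewrite leqNgt; apply/negP => yl.
    by have := out_l (leq_ltn_trans (leq0n _) yl); rewrite inI' //; lia.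
  apply/big_partP; split; first exact: upI.
  have [hy|->|->] := chart_cases y.
  - have [h3|h3] := eqVneq (h y) (n - 3).
      by exists (q (n - 2)); rewrite // adjE h3 edge_D_end ?qK //; lia.
    exists (q (h y).+1); first by apply: upI; rewrite qK; lia.
    by rewrite adjE qK ?edge_D_chain /edge_A ?eqxx //; lia.
  - by exists (q (n - 3)); rewrite // adjE edge_DC edge_D_end ?qK ?eqxx //; lia.
  by exists (q (n - 3)); rewrite // adjE edge_DC edge_D_end ?qK ?eqxx //; lia.
have l3 : l + 3 <= n by lia.
have := spin_congruence opp l3 upI out_l eI.
rewrite swaps_end2 !qK ?spin_end1 ?spin_end2; try lia.
case/dvdzP=> k hk.
exists ((n - l) %/ 2); have e : n - l = 2 * ((n - l) %/ 2) + 1 by lia.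
split; try lia.
by rewrite -e subKn //; lia.
Qed.

End Fork.

(** Vertices of [I] below [a] are isolated, hence fixed. Above, [spin_weight] is odd at the ends of
    the fork and even on the chain, and twice its value at an end is 2 modulo 4; by the congruence
    [t] exchanges the ends. *)
Lemma fork_opposition I m : 1 <= m -> 2 * m + 1 <= n ->
  upper (n - (2 * m + 1)) (@big_part D I) -> acts_as_opposition Delta I sigma.
Proof.
move=> m1 mn; set a := n - _ => upB.
have [t opp] := opposition_exists hPhi hDelta I.
suff e : {in I, t =1 sigma} by apply/(opposition_onP _ e).
have BI x : x \in @big_part D I -> x \in I by apply/subsetP/big_part_sub.
have upI x : a <= h x -> x \in I by rewrite -upB; apply: BI.
have out_a : 0 < a -> q a.-1 \notin I.
  move=> a0; apply/negP => aI; have : q a.-1 \in @big_part D I.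
    apply/big_partP; split=> //; exists (q a); first by apply: upI;
      rewrite qK //; lia.
    by rewrite adjE !qK ?edge_D_chain /edge_A; lia.
  by rewrite upB qK; lia.
have isolated x : x \in I -> h x < a -> t x = x.
  move=> xI hx; apply: (opposition_isolated hPhi hDelta opp bd_le1) => // y yI.
  apply/negP => xy; have : x \in @big_part D I by apply/big_partP; split=> //;
    exists y.
  by rewrite upB leqNgt hx.
have t_up x : a <= h x -> a <= h (t x).
  move=> ax; have xI := upI x ax; rewrite leqNgt; apply/negP => lt_t.
  have tI := opposition_mem hDelta opp xI.
  have := isolated _ tI lt_t => /(opposition_inj hPhi hDelta opp tI xI) e.
  by rewrite e ltnNge ax in lt_t.
have a3 : a + 3 <= n by lia.
have cong x (ax : a <= h x) := spin_congruence opp a3 upI out_a (upI x ax).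
have e2 : t (q (n - 2)) = q (n - 1).
  have ax : a <= h (q (n - 2)) by rewrite qK; lia.
  have := cong _ ax; have := t_up _ ax.
  have [hy|->|-> //] := chart_cases (t (q (n - 2))).
    by move=> ay; rewrite qK ?spin_end2 ?spin_chain ?ay //; try lia;
      case/dvdzP => k; lia.
  by rewrite !qK ?spin_end2; try lia; case/dvdzP => k; lia.
have e1 : t (q (n - 1)) = q (n - 2).
  have ax : a <= h (q (n - 1)) by rewrite qK; lia.
  have := cong _ ax; have := t_up _ ax.
  have [hy|-> //|->] := chart_cases (t (q (n - 1))).
    by move=> ay; rewrite qK ?spin_end1 ?spin_chain ?ay //; try lia;
      case/dvdzP => k; lia.
  by rewrite !qK ?spin_end1; try lia; case/dvdzP => k; lia.
have t_adj x y : a <= h x -> a <= h y -> edge_D n (h x) (h y) ->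
    edge_D n (h (t x)) (h (t y)).
  by move=> ax ay; rewrite -!adjE (opposition_bonds hPhi hDelta opp) //; apply: upI.
have t_inj x y : a <= h x -> a <= h y -> t x = t y -> x = y.
  by move=> ax ay; apply: (opposition_inj hPhi hDelta opp); apply: upI.
(* Induction on the distance [d] to the branching vertex, which is the only possible image of itself
   since it stays adjacent to the ends. *)
have chain d j : j + d = n - 3 -> a <= j -> t (q j) = q j.
  elim/ltn_ind: d j => d IHd j ej aj; have hj : j < n - 2 by lia.
  have hjn : j < n by lia.
  have [d0|d0] := posnP d.
    have := t_adj (q j) (q (n - 2)); rewrite e2 !qK; try lia.
    rewrite !edge_D_end //; try lia; move=> h1; have {}h1 : h (t (q j)) = n - 3.
      by apply/eqP/h1; lia.
    by rewrite -[LHS]hK h1; congr q; lia.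
  have f1 : t (q j.+1) = q j.+1 by apply: (IHd d.-1); lia.
  have := t_adj (q j) (q j.+1);
    rewrite f1 !qK ?[edge_D n j _]edge_D_chain /edge_A ?eqxx; try lia.
  move=> adj1; have {}adj1 : edge_D n (h (t (q j))) j.+1 by apply: adj1; lia.
  have [hy|ey|ey] := chart_cases (t (q j)).
  - move: adj1; rewrite edge_D_chain //; last by lia.
    case/orP=> /eqP ey; first by rewrite -[LHS]hK; congr q; lia.
    have f2 : t (q j.+2) = q j.+2 by apply: (IHd d.-2); lia.
    have : q j = q j.+2.
      apply: t_inj; rewrite ?qK //; try lia.
      by rewrite f2 ey hK.
    by move/(congr1 h); rewrite !qK; lia.
  - have : q j = q (n - 1) by apply: t_inj; rewrite ?qK ?ey ?e1 //; lia.
    by move/(congr1 h); rewrite !qK; lia.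
  have : q j = q (n - 2) by apply: t_inj; rewrite ?qK ?ey ?e2 //; lia.
  by move/(congr1 h); rewrite !qK; lia.
move=> x xI; have [ax|xa] := leqP a (h x); last first.
  by rewrite isolated // swaps_chain //; lia.
have [hx|->|->] := chart_cases x.
- by rewrite swaps_chain // -[x]hK; apply: (chain (n - 3 - h x)); lia.
- by rewrite e2 swaps_end2.
by rewrite e1 swaps_end1.
Qed.

Lemma upper_D_subdiagram k J : 3 <= k <= n -> upper (n - k) J ->
  @D_subdiagram D n k J.
Proof.
move=> hk upJ; split.
  have eJ : q (n - 1) \in J by rewrite upJ qK; lia.
  apply: (@of_type_sub_chart D J k (half_D k) (fun x => h x - (n - k))
    (fun i => q (n - k + i)) _ eJ).
    exact: (simply_laced_arrow hPhi hDelta bd_le1).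
  split=> [x|x|i hi|i hi|x y]; rewrite ?upJ ?qK //; try lia.
  - by have := lt_h x; lia.
  - by move=> hx; rewrite -[RHS]hK; congr q; lia.
  move=> hx hy; rewrite hb /edge_D; congr nat_of_bool.
  by have := lt_h x; have := lt_h y; rewrite /half_D; lia.
exists (fun x => Ordinal (lt_h x)); last by apply/setP => x; rewrite upJ inE.
split=> [|x y|x y]; last by rewrite (chart_arrow ch).
  exists (fun i => q (nat_of_ord i)) => [x|i]; first by rewrite /= hK.
  by apply: val_inj; rewrite /= qK.
by rewrite hb.
Qed.

(** Two numberings differ by an automorphism of D_n, the identity or the exchange of the ends, and
    both preserve the last [k >= 3] vertices. *)
Lemma D_subdiagram_upper k J : 3 <= k <= n ->
  @D_subdiagram D n k J -> upper (n - k) J.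
Proof.
move=> hk [_ [f [bf fb fa] ->]] x; rewrite inE.
have [g fK gK] := bf.
have [|hS|hS] := @aut_D n (fun i => f (q i) : 'I_n) n5.
- split=> [i hi|i j hi hj /val_inj/(can_inj fK)/(congr1 h)|i j hi hj e_ij].
  + exact: ltn_ord.
  + by rewrite !qK.
  have := fb (q i) (q j); rewrite hb !qK // e_ij /=.
  by rewrite -[_ || _]/(edge_D n (f (q i) : 'I_n) (f (q j) : 'I_n));
    case: (edge_D _ _ _).
- by rewrite -{1}(hK x) hS.
rewrite -{1}(hK x) hS //.
by case: (swap_DP (i := h x) (n := n)) => [||[-> ->]|[-> ->]|[_ ->]] //; lia.
Qed.

End TypeD.

(** * Type D_4, a star with three leaves *)

Section TypeD4.
Variables (R : archiRcfType) (r : nat).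
Variables (Phi : seq 'rV[R]_r) (Delta : 'I_r -> 'rV[R]_r).
Hypothesis hPhi : reduced_root_system Phi.
Hypothesis hDelta : is_base Phi Delta.
Local Notation D := (dynkin Delta).
Local Notation bd := (@bonds (dynkin Delta)).
Local Notation adj := (fun x y : 'I_r => 0 < bd x y).
Implicit Types (I J : {set 'I_r}) (x y z : 'I_r).

Variables (h : 'I_r -> nat) (q : nat -> 'I_r).
Hypothesis ch : @chart D 4 (edge_D 4) h q.

Let lt_h : forall x, h x < 4 := chart_lt ch.
Let hK : cancel h q := chartK ch.
Let qK : forall i, i < 4 -> h (q i) = i := chartVK ch.
Let hb : forall x y, bd x y = edge_D 4 (h x) (h y) := chart_bonds ch.
Let bd_le1 x y : bd x y <= 1. Proof. by rewrite hb leq_b1. Qed.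

(** The centre. The leaves play symmetric parts, and the lemmas take them in any order [x], [y],
    [z]. *)
Let c := q 1.

Let hE x y : (x == y) = (h x == h y).
Proof. by rewrite (can_eq hK). Qed.

Lemma star_adj x y : (0 < bd x y) = ((x == c) != (y == c)).
Proof.
rewrite hb lt0b !hE qK //; move: (h x) (lt_h x) (h y) (lt_h y).
by move=> [|[|[|[|]]]] // _ [|[|[|[|]]]].
Qed.

Lemma star_cover x y z v : uniq [:: c; x; y; z] ->
  [\/ v = c, v = x, v = y | v = z].
Proof.
rewrite /= !inE !hE qK // => u.
have := lt_h x; have := lt_h y; have := lt_h z; have := lt_h v => *.
have : [|| v == c, v == x, v == y | v == z] by rewrite !hE qK //; lia.
case/or4P=> /eqP->.
- by constructor 1.
- by constructor 2.
- by constructor 3.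
by constructor 4.
Qed.

Lemma star_extremal x : @extremal D x = (x != c).
Proof.
rewrite /extremal; have [->|xc] := eqVneq x c.
  apply/negbTE; have : [set q 0; q 2] \subset [set y | 0 < bd c y].
    apply/subsetP => y; rewrite !inE star_adj eqxx => /orP[]/eqP->;
    by rewrite hE !qK.
  move/subset_leq_card; rewrite cards2 hE !qK //= => c2.
  by apply/eqP => e; rewrite e in c2.
apply/cards1P; exists c; apply/setP => y; rewrite !inE star_adj (negbTE xc).
by case: (y == c).
Qed.

Section Opposition.
Variables (I : {set 'I_r}) (t : 'I_r -> 'I_r).
Hypothesis opp : opposition_on Delta I t.
Hypothesis cI : c \in I.

Lemma star_two x y z : uniq [:: c; x; y; z] -> x \in I -> y \in I -> z \notin I ->
  [/\ t x = y, t c = c & t y = x].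
Proof.
move=> u xI yI zI; have := u;
  rewrite /= !inE !negb_or => /and4P[/and3P[cx cy cz] /andP[xy xz] yz _].
have := @opposition_chain _ _ _ _ hPhi hDelta I t opp bd_le1 3 (nth c [:: x; c; y]).
move=> hc; suff e i : i < 3 -> t (nth c [:: x; c; y] i) = nth c [:: x; c; y] (2 - i).
  by split; [exact: (e 0) | exact: (e 1) | exact: (e 2)].
apply: hc => {i} [[|[|[|]]]|i j hi hj /eqP|[|[|]]|i v] //.
- by rewrite nth_uniq //= ?inE ?negb_or ?xy ?cy ?(eq_sym x) ?cx // => /eqP.
- by rewrite /= star_adj eqxx (eq_sym x) (negbTE cx).
- by rewrite /= star_adj eqxx (eq_sym y) (negbTE cy).
move=> hi vI; rewrite star_adj; case: (star_cover v u) vI => -> //.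
- by case: i hi => [|[|[|]]] //= _ _; rewrite ?eqxx //; exists 1.
- by case: i hi => [|[|[|]]] //= _ _;
    rewrite ?(eq_sym x) ?(eq_sym y) ?(negbTE cx) ?(negbTE cy) ?eqxx //; exists 0.
- by case: i hi => [|[|[|]]] //= _ _;
    rewrite ?(eq_sym x) ?(eq_sym y) ?(negbTE cx) ?(negbTE cy) ?eqxx //; exists 2.
by rewrite (negbTE zI).
Qed.

Lemma star_one x y z : uniq [:: c; x; y; z] -> x \in I -> y \notin I -> z \notin I ->
  t c = x.
Proof.
move=> u xI yI zI; have := u;
  rewrite /= !inE !negb_or => /and4P[/and3P[cx cy cz] /andP[xy xz] yz _].
have := @opposition_chain _ _ _ _ hPhi hDelta I t opp bd_le1 2 (nth c [:: c; x]).
move=> hc; apply: (hc _ _ _ _ 0) => // [[|[|]]|i j hi hj /eqP|[|]|i v] //.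
- by rewrite nth_uniq //= ?inE ?negb_or ?cx // => /eqP.
- by rewrite /= star_adj eqxx (eq_sym x) (negbTE cx).
move=> hi vI; rewrite star_adj; case: (star_cover v u) vI => -> //.
- by case: i hi => [|[|]] //= _ _; rewrite ?eqxx //; exists 0.
- by case: i hi => [|[|]] //= _ _; rewrite ?(eq_sym x) ?(negbTE cx) ?eqxx //;
    exists 1.
- by rewrite (negbTE yI).
by rewrite (negbTE zI).
Qed.

(* Half the sum of the simple roots of two leaves is a weight. *)
Lemma star_three x y z : uniq [:: c; x; y; z] -> x \in I -> y \in I -> z \in I ->
  t x = x \/ t x = y.
Proof.
move=> u xI yI zI; have := u;
  rewrite /= !inE !negb_or => /and4P[/and3P[cx cy cz] /andP[xy xz] yz _].
pose C v : int := (v == x) || (v == y).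
have := @opposition_congruence _ _ _ _ hPhi hDelta I t opp bd_le1 2%:Z C.
move=> /(_ _ _ x xI) cong; have : (2%:Z %| C x + C (t x))%Z%R.
  apply: cong => [v|v _]; first by case: (star_cover v u) => ->;
    rewrite ?cI ?xI ?yI ?zI.
  have [->|vc] := eqVneq v c.
    rewrite (@neighbour_sum _ _ Delta C [:: x; y]).
    - rewrite big_cons big_seq1 /C !eqxx orbT (negbTE cx) (negbTE cy) /=.
      by apply/dvdzP; exists (-1)%R; arith.
    - by rewrite /= inE xy.
    - move=> w; rewrite !inE star_adj eqxx => /orP[]/eqP->.
        by rewrite (eq_sym x) (negbTE cx).
      by rewrite (eq_sym y) (negbTE cy).
    by move=> w _; rewrite !inE; apply: contraR; rewrite /C => /negbTE->.
  rewrite big1 => [|w]; first by rewrite subr0 dvdz_mulr.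
  rewrite star_adj (negbTE vc); have [-> _|] := eqVneq w c; last by [].
  by rewrite /C (negbTE cx) (negbTE cy).
rewrite /C eqxx /=; have [->|tx] := eqVneq (t x) x; first by left.
by have [->|ty] := eqVneq (t x) y; first by right.
Qed.

End Opposition.

Lemma star_types x y z I : uniq [:: c; x; y; z] -> I = ~: [set z] ->
  of_type (@subdiagram D I) (type_D 3) /\ of_type (@subdiagram D I) (type_A 3).
Proof.
move=> u ->; have := u;
  rewrite /= !inE !negb_or => /and4P[/and3P[cx cy cz] /andP[xy xz] yz _].
have xc : (x == c) = false by rewrite eq_sym (negbTE cx).
have yc : (y == c) = false by rewrite eq_sym (negbTE cy).
have cI : c \in ~: [set z] by rewrite !inE.
have sub l : uniq l -> l =i ~: [set z] -> forall e : rel nat,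
    (forall i j, i < size l -> j < size l -> bd (nth c l i) (nth c l j) = (e i
      j || e j i)) ->
    @sub_chart D (~: [set z]) (size l) (fun i j => e i j || e j i)
      (fun v => index v l) (nth c l).
  move=> ul eql e he; split=> [v|v|i hi|i hi|v w].
  - by rewrite -eql index_mem.
  - by rewrite -eql => /nth_index->.
  - by rewrite -eql mem_nth.
  - exact: index_uniq.
  by rewrite -!eql => vl wl; rewrite -he ?index_mem // !nth_index.
have arr := simply_laced_arrow hPhi hDelta bd_le1.
have bdE v w : bd v w = ((v == c) != (w == c)).
  by rewrite -star_adj hb lt0b.
split.
  apply: (@of_type_sub_chart D _ 3 (half_D 3) _ _ c cI arr).
  apply: (sub [:: c; x; y]).
  - by rewrite /= !inE negb_or cx cy xy.
  - move=> v; rewrite !inE; case: (star_cover v u) => ->;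
      rewrite ?eqxx ?orbT ?cz ?xz ?yz //.
    by rewrite !(eq_sym z) (negbTE cz) (negbTE xz) (negbTE yz).
  by move=> [|[|[|]]] // [|[|[|]]] // _ _; rewrite bdE /= ?eqxx ?xc ?yc.
apply: (@of_type_sub_chart D _ 3 (fun i j => i.+1 == j) _ _ c cI arr).
apply: (sub [:: x; c; y]).
- by rewrite /= !inE negb_or eq_sym cx cy xy.
- move=> v; rewrite !inE; case: (star_cover v u) => ->;
    rewrite ?eqxx ?orbT ?cz ?xz ?yz //.
  by rewrite !(eq_sym z) (negbTE cz) (negbTE xz) (negbTE yz).
by move=> [|[|[|]]] // [|[|[|]]] // _ _; rewrite bdE /= ?eqxx ?xc ?yc.
Qed.

Variable sigma : {perm 'I_r}.
Variable I : {set 'I_r}.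
Hypothesis stI : @stable D sigma I.

Lemma star_transposition x y z : uniq [:: c; x; y; z] ->
  sigma x = y -> sigma c = c -> sigma y = x -> sigma = tperm x y.
Proof.
move=> u sx sc sy; have := u;
  rewrite /= !inE !negb_or => /and4P[/and3P[cx cy cz] /andP[xy xz] yz _].
apply/permP => v; case: (star_cover v u) => ->; rewrite ?tpermL ?tpermR //.
  by rewrite tpermD // eq_sym.
rewrite tpermD //; case: (star_cover (sigma z) u) => // e.
- by move: cz; rewrite -(inj_eq (@perm_inj _ sigma)) e sc eqxx.
- by move: yz; rewrite -(inj_eq (@perm_inj _ sigma)) e sy eqxx.
by move: xz; rewrite -(inj_eq (@perm_inj _ sigma)) e sx eqxx.
Qed.

(** The centre is fixed by [sigma], and it lies in [I] because [I] contains an edge. With one leaf,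
    [I] would be an A_2, whose reversal moves the centre; with three, the congruences for two pairs
    of leaves fix each leaf and [sigma] would be trivial. So there are two leaves, and they are
    exchanged. *)
Lemma star_forward : sigma \in diagram_Aut D -> sigma != 1%g ->
  opposition_on Delta I sigma -> @big_part D I != set0 ->
  exists x y z, [/\ uniq [:: c; x; y; z], sigma = tperm x y & I = ~: [set z]].
Proof.
move=> autS nt opp /set0Pn[v /big_partP[vI [w wI vw]]].
have sc : sigma c = c.
  apply: (can_inj hK); rewrite qK //.
  apply: (@aut_D4 (fun i => h (sigma (q i)))).
  by apply: (@chart_graph_aut _ _ Delta) => // x y; rewrite hb lt0b.
have u023 : uniq [:: c; q 0; q 2; q 3] by rewrite /= !inE !hE !qK.
have u203 : uniq [:: c; q 2; q 0; q 3] by rewrite /= !inE !hE !qK.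
have u302 : uniq [:: c; q 3; q 0; q 2] by rewrite /= !inE !hE !qK.
have u032 : uniq [:: c; q 0; q 3; q 2] by rewrite /= !inE !hE !qK.
have u230 : uniq [:: c; q 2; q 3; q 0] by rewrite /= !inE !hE !qK.
have cI : c \in I.
  move: vw; rewrite star_adj; have [ev _|_] := eqVneq v c; first by rewrite -ev.
  by have [ew _|_] := eqVneq w c; first by rewrite -ew.
have two x y z : uniq [:: c; x; y; z] -> x \in I -> y \in I -> z \notin I ->
    exists x y z, [/\ uniq [:: c; x; y; z], sigma = tperm x y & I = ~: [set z]].
  move=> u xI yI zI; exists x, y, z; split=> //.
    by have [s1 s2 s3] := star_two opp cI u xI yI zI;
      apply: star_transposition u _ _ _.
  have := u; rewrite /= !inE !negb_or => /and4P[/and3P[cx cy cz] /andP[xy xz] yz _].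
  apply/setP => a; rewrite !inE; case: (star_cover a u) => ->;
    by rewrite ?cI ?xI ?yI ?eqxx ?(negbTE zI) ?cz ?xz ?yz.
have one x y z : uniq [:: c; x; y;
  z] -> x \in I -> y \notin I -> z \notin I -> False.
  move=> u xI yI zI; have := star_one opp cI u xI yI zI; rewrite sc => e.
  by move: u; rewrite /= !inE e eqxx.
have [i0|o0] := boolP (q 0 \in I); have [i2|o2] := boolP (q 2 \in I);
  have [i3|o3] := boolP (q 3 \in I).
- case/eqP: nt; apply/permP => a; rewrite perm1.
  have fix_leaf x y z : uniq [:: c; x; y;
    z] -> x \in I -> y \in I -> z \in I -> sigma x = x.
    move=> u xI yI zI; have [//|e1] := star_three opp cI u xI yI zI.
    have u' : uniq [:: c; x; z; y].
      by move: u; rewrite /= !inE (eq_sym z y) (orbC (c == y)) (orbC (x == y)).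
    have [//|e2] := star_three opp cI u' xI zI yI.
    by move: u; rewrite /= !inE -e1 -e2 eqxx !andbF.
  case: (star_cover a u023) => -> //.
  + exact: fix_leaf u023 _ _ _.
  + exact: fix_leaf u203 _ _ _.
  exact: fix_leaf u302 _ _ _.
- exact: two u023 _ _ _.
- exact: two u032 _ _ _.
- by case: (one _ _ _ u023).
- exact: two u230 _ _ _.
- by case: (one _ _ _ u203).
- by case: (one _ _ _ u302).
move: vw; rewrite star_adj; case: (star_cover v u023) => ev;
  rewrite ev ?(negbTE o0) ?(negbTE o2) ?(negbTE o3) in vI *;
  case: (star_cover w u023) => ew;
    rewrite ew ?(negbTE o0) ?(negbTE o2) ?(negbTE o3) // in wI *.
by rewrite eqxx.
Qed.

Lemma star_backward x y z : x != c -> y != c -> z != c -> x != y ->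
  sigma = tperm x y -> I = ~: [set z] -> acts_as_opposition Delta I sigma.
Proof.
move=> xc yc zc xy es eI.
(* Stability of [I] makes [sigma] fix the omitted leaf, which is therefore neither [x] nor [y]. *)
have sz : sigma z = z.
  have : sigma z \notin I.
    apply/negP; rewrite -stI => /imsetP[v vI /perm_inj ev].
    by rewrite -ev eI !inE eqxx in vI.
  by rewrite eI !inE negbK => /eqP.
have xz : x != z by apply/eqP => e; move: xy; rewrite -e es tpermL in sz;
  rewrite sz eqxx.
have yz : y != z by apply/eqP => e; move: xy; rewrite -e es tpermR in sz;
  rewrite sz eqxx.
have u : uniq [:: c; x; y;
  z] by rewrite /= !inE !negb_or !(eq_sym c) xc yc zc xy xz yz.
have [t opp] := opposition_exists hPhi hDelta I.
suff e : {in I, t =1 sigma} by apply/(opposition_onP _ e).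
have inI v : (v \in I) = (v != z) by rewrite eI !inE.
have [||||t1 t2 t3] := star_two opp _ u; rewrite ?inI ?eqxx //;
  first by rewrite eq_sym.
move=> v; rewrite inI => vz; rewrite es; case: (star_cover v u) vz => -> vz.
- by rewrite t2 tpermD.
- by rewrite t1 tpermL.
- by rewrite t3 tpermR.
by rewrite eqxx in vz.
Qed.

End TypeD4.

(** * Type E *)

Lemma edge_E6C i j : edge_E6 i j = edge_E6 j i.
Proof. exact: orbC. Qed.

(* The vertices of a subset of [E_6] stable under the flip, which exchanges   *)
(* [0] and [5], [2] and [4].                                                  *)
Definition flip_list (b0 b1 b2 b3 : bool) : seq nat :=
  [seq i <- iota 0 6 | nth false [:: b0; b1; b2; b3; b2; b0] i].

Definition nbr_E6 (i : nat) : seq nat := [seq j <- iota 0 6 | edge_E6 j i].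

Definition has_nbr_E6 (l : seq nat) := all (fun i => has (edge_E6 i) l) l.

(* [c] is a component of type [A] of the subset [l] of [E_6]. *)
Definition chain_in (l c : seq nat) :=
  [&& uniq c, all (mem l) c,
      all (fun i => edge_E6 (nth 0 c i) (nth 0 c i.+1)) (iota 0 (size c).-1) &
      all (fun i => all (fun j => edge_E6 (nth 0 c i) j ==>
                   (j \in c) && edge_A i (index j c)) l) (iota 0 (size c))].

(** The flip-stable subsets containing an edge: those with a component A_2, the D_4 around vertex 3,
    and the three admissible ones, of types A_3, A_5 and E_6. *)
Lemma flip_list_cases b0 b1 b2 b3 : has (fun i => has (edge_E6 i) (flip_list b0
  b1 b2 b3))
    (flip_list b0 b1 b2 b3) ->
  let l := flip_list b0 b1 b2 b3 in
  [\/ exists2 c, chain_in l c & c \in [:: [:: 0; 2]; [:: 1; 3]],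
      l = [:: 1; 2; 3; 4] |
      l \in [:: [:: 2; 3; 4]; [:: 0; 2; 3; 4; 5]; iota 0 6]].
Proof.
by case: b0; case: b1; case: b2; case: b3 => // _ /=;
  first [ by constructor 1; exists [:: 0; 2] | by constructor 1; exists [:: 1; 3]
        | by constructor 2 | by constructor 3 ].
Qed.

(** Cardinality and the absence of isolated vertices suffice to recognize the three admissible
    subsets, hence the uniqueness of the stable sub-diagrams of types A_3, A_5 and E_6. *)
Lemma flip_list_unique b0 b1 b2 b3 (l l' : seq nat) : l = flip_list b0 b1 b2 b3 ->
  l' \in [:: [:: 2; 3; 4]; [:: 0; 2; 3; 4; 5]; iota 0 6] ->
  has_nbr_E6 l -> size l = size l' -> l = l'.
Proof.
by move=> ->; rewrite !inE => /or3P[]/eqP->;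
  case: b0; case: b1; case: b2; case: b3.
Qed.

Section TypeE6.
Variables (R : archiRcfType) (r : nat).
Variables (Phi : seq 'rV[R]_r) (Delta : 'I_r -> 'rV[R]_r).
Hypothesis hPhi : reduced_root_system Phi.
Hypothesis hDelta : is_base Phi Delta.
Local Notation D := (dynkin Delta).
Local Notation bd := (@bonds (dynkin Delta)).
Local Notation adj := (fun x y : 'I_r => 0 < bd x y).
Implicit Types (I J : {set 'I_r}) (x y z : 'I_r).

Variables (h : 'I_r -> nat) (q : nat -> 'I_r).
Hypothesis ch : @chart D 6 edge_E6 h q.

Let lt_h : forall x, h x < 6 := chart_lt ch.
Let hK : cancel h q := chartK ch.
Let qK : forall i, i < 6 -> h (q i) = i := chartVK ch.
Let hb : forall x y, bd x y = edge_E6 (h x) (h y) := chart_bonds ch.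
Let bd_le1 x y : bd x y <= 1. Proof. by rewrite hb leq_b1. Qed.
Let adjE x y : (0 < bd x y) = edge_E6 (h x) (h y). Proof. by rewrite hb lt0b. Qed.

Definition listed (l : seq nat) I := forall x, (x \in I) = (h x \in l).

Definition flips (s : {perm 'I_r}) := forall x, h (s x) = flip_E6 (h x).

Lemma flips_aut s : s \in diagram_Aut D -> s != 1%g -> flips s.
Proof.
move=> autS nt.
have [|hS|hS] := @aut_E6 (fun i => h (s (q i))).
- by apply: (@chart_graph_aut _ _ Delta) => // x y; rewrite hb lt0b.
- by case: (perm_neq1 nt hK lt_h).
by move=> x; rewrite -[in LHS](hK x) hS.
Qed.

Lemma flips_neq1 s : flips s -> s != 1%g.
Proof. by move=> hs; apply/eqP => e; have := hs (q 0); rewrite e perm1 qK. Qed.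

Lemma flips_stable s I : flips s -> @stable D s I ->
  listed (flip_list (q 0 \in I) (q 1 \in I) (q 2 \in I) (q 3 \in I)) I.
Proof.
move=> hs stI x.
have stE y : (s y \in I) = (y \in I).
  apply/idP/idP => [|yI]; last by rewrite -stI imset_f.
  by rewrite -{1}stI => /imsetP[z zI /perm_inj->].
have flipE i : i < 6 -> (q (flip_E6 i) \in I) = (q i \in I).
  by move=> hi; rewrite -stE; congr (_ \in I); apply: (can_inj hK);
    rewrite hs !qK //;
    case: i hi => [|[|[|[|[|[|]]]]]].
have f4 : (q 2 \in I) = (q 4 \in I) := flipE 4 isT.
have f5 : (q 0 \in I) = (q 5 \in I) := flipE 5 isT.
rewrite mem_filter mem_iota lt_h andbT -{1}(hK x).
by move: (h x) (lt_h x) => [|[|[|[|[|[|]]]]]] // _; rewrite /= ?f4 ?f5 ?leq0n ?andbT.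
Qed.

Lemma listed_eq l I J : listed l I -> listed l J -> I = J.
Proof. by move=> lI lJ; apply/setP => x; rewrite lI lJ. Qed.

Lemma listed_big_part l I : listed l I -> has_nbr_E6 l -> @big_part D I = I.
Proof.
move=> lI /allP nl; apply/setP => x; apply/idP/idP => [/big_partP[]//|xI].
apply/big_partP; split=> //; have /nl/hasP[j jl e] : h x \in l by rewrite -lI.
have j6 : j < 6 by move: e; move: (h x) (lt_h x) => [|[|[|[|[|[|]]]]]] // _;
  case: j {jl} => [|[|[|[|[|[|]]]]]].
by exists (q j); rewrite ?lI ?adjE qK.
Qed.

Lemma listed_sub_chart l I (e : rel nat) : uniq l -> all (fun i => i < 6) l ->
  listed l I ->
  (forall i j, i < size l -> j < size l ->
    edge_E6 (nth 0 l i) (nth 0 l j) = e i j || e j i) ->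
  @sub_chart D I (size l) (fun i j => e i j || e j i) (fun x => index (h x) l)
    (fun i => q (nth 0 l i)).
Proof.
move=> ul /allP l6 lI he; split=> [x|x|i hi|i hi|x y].
- by rewrite lI index_mem.
- by rewrite lI => xl; rewrite nth_index // hK.
- by rewrite lI qK ?mem_nth // l6 // mem_nth.
- by rewrite qK ?index_uniq // l6 // mem_nth.
rewrite !lI => xl yl; rewrite hb -he ?index_mem // !nth_index //.
Qed.

Lemma listed_of_type l I (e : rel nat) m : uniq l -> all (fun i => i < 6) l ->
  listed l I -> size l = m -> 0 < m ->
  (forall i j, i < size l -> j < size l ->
    edge_E6 (nth 0 l i) (nth 0 l j) = e i j || e j i) ->
  of_type (@subdiagram D I) (simply_laced (fun i j : 'I_m => e i j)).
Proof.
move=> ul l6 lI <- l0 he; have l0I : q (nth 0 l 0) \in I.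
  by rewrite lI qK ?mem_nth //; apply: (allP l6); apply: mem_nth.
apply: (@of_type_sub_chart D I (size l) e _ _ _ l0I (simply_laced_arrow hPhi
  hDelta bd_le1)).
exact: listed_sub_chart.
Qed.

Lemma listed_card l I : uniq l -> all (fun i => i < 6) l -> listed l I -> #|I|
  = size l.
Proof.
move=> ul l6 lI.
have := @listed_sub_chart l I (fun i j => edge_E6 (nth 0 l i) (nth 0 l j)) ul l6 lI.
move=> h0; apply: sub_chart_card (h0 _) => i j _ _.
by rewrite (edge_E6C (nth 0 l j)) orbb.
Qed.

Lemma of_type_has_nbr J m (e : rel nat) : 0 < m ->
  (forall i, i < m -> exists2 j, j < m & e i j || e j i) ->
  of_type (@subdiagram D J) (simply_laced (fun i j : 'I_m => e i j)) ->
  #|J| = m /\ forall x, x \in J -> exists2 y, y \in J & 0 < bd x y.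
Proof.
move=> m0 he /(sub_chart_of_type m0)[h' [q' sc]]; split;
  first exact: sub_chart_card sc.
move=> x xJ; have [j jm ej] := he _ (sub_chart_lt sc xJ).
exists (q' j); first exact: (sub_chart_mem sc).
by rewrite (sub_chart_bonds sc) ?(sub_chart_mem sc) // (sub_chartVK sc) // ej.
Qed.

Lemma listed_unique s J l' m (e : rel nat) : flips s -> @stable D s J ->
  l' \in [:: [:: 2; 3; 4]; [:: 0; 2; 3; 4; 5]; iota 0 6] -> size l' = m ->
  0 < m -> (forall i, i < m -> exists2 j, j < m & e i j || e j i) ->
  of_type (@subdiagram D J) (simply_laced (fun i j : 'I_m => e i j)) ->
  listed l' J.
Proof.
move=> hs stJ l'l sz m0 he /(of_type_has_nbr m0 he)[cJ nJ].
have lJ := flips_stable hs stJ; set l := flip_list _ _ _ _ in lJ.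
have ul : uniq l by apply: filter_uniq; apply: iota_uniq.
have l6 : all (fun i => i < 6) l.
  by apply/allP => i; rewrite mem_filter mem_iota => /and3P[].
suff <- : l = l' by [].
apply: flip_list_unique => //; last by rewrite -(listed_card ul l6 lJ) cJ.
apply/allP => i il; have i6 := allP l6 i il.
have qiJ : q i \in J by rewrite lJ qK.
have [y yJ] := nJ _ qiJ; rewrite adjE qK // => e_iy.
by apply/hasP; exists (h y); rewrite -?lJ.
Qed.

Section Opposition.
Variables (I : {set 'I_r}) (t : 'I_r -> 'I_r) (l : seq nat).
Hypothesis opp : opposition_on Delta I t.
Hypothesis lI : listed l I.
Hypothesis l6 : all (fun i => i < 6) l.

Lemma listed_chain c : chain_in l c -> forall i, i < size c ->
  t (q (nth 0 c i)) = q (nth 0 c ((size c).-1 - i)).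
Proof.
case/and4P=> uc /allP cl /allP cS /allP c_nbr.
have c6 i : i < size c -> nth 0 c i < 6.
  by move=> hi; apply: (allP l6); apply: cl; apply: mem_nth.
apply: (opposition_chain hPhi hDelta opp bd_le1 (q := fun i => q (nth 0 c i))).
- by move=> i hi; rewrite lI qK ?c6 //; apply: cl; apply: mem_nth.
- move=> i j hi hj /(congr1 h); rewrite !qK ?c6 // => /eqP.
  by rewrite nth_uniq // => /eqP.
- move=> i hi; rewrite adjE !qK ?c6 //; try lia.
  by apply: cS; rewrite mem_iota; lia.
move=> i y hi; rewrite lI adjE qK ?c6 // => yl e_iy.
have hi' : i \in iota 0 (size c) by rewrite mem_iota.
have /allP/(_ _ yl) := c_nbr i hi'; rewrite e_iy => /andP[yc e_A].
by exists (index (h y) c); rewrite ?index_mem // nth_index ?hK.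
Qed.

Lemma listed_congruence (N : int) (C : nat -> int) :
  (forall i, i < 6 -> i \notin l -> C i = 0%R) ->
  (forall j, j \in l -> (N %| 2 * C j - \sum_(i <- nbr_E6 j) C i)%Z%R) ->
  forall i, i \in l -> (N %| C i + C (h (t (q i))))%Z%R.
Proof.
move=> C0 Cw i il; have i6 := allP l6 i il; rewrite -{1}(qK i6).
apply: (@opposition_congruence _ _ _ _ hPhi hDelta I t opp bd_le1 N (fun x => C
  (h x))).
- by move=> x; rewrite lI => /(C0 _ (lt_h x)).
- move=> y; rewrite lI => yl.
  rewrite (chart_neighbour_sum (C := C) (L := nbr_E6 (h y)) ch); first exact: Cw.
  + by apply: filter_uniq; apply: iota_uniq.
  + by move=> k; rewrite mem_filter mem_iota => /and3P[].
  by move=> k k6 e_k _; rewrite mem_filter mem_iota e_k.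
by rewrite lI qK.
Qed.

End Opposition.

(* Three times the fundamental weight of the vertex [0] modulo [3]. *)
Let weight_E6 (i : nat) : int := nth 0%R [:: 1; 0; 2; 0; 1; 2]%R i.

(** As an automorphism of E_6, [t] is trivial or the flip; if it were trivial, 3 would divide twice
    the coefficient 1 at vertex 0. *)
Lemma opposition_E6 t : opposition_on Delta [set: 'I_r] t -> forall x, h (t x)
  = flip_E6 (h x).
Proof.
move=> opp.
have lT : listed (iota 0 6) [set: 'I_r] by move=> x; rewrite inE mem_iota lt_h.
have cong : (3%:Z %| weight_E6 0 + weight_E6 (h (t (q 0))))%Z%R.
  apply: (listed_congruence opp lT) => // [i i6|j]; first by rewrite mem_iota i6.
  by rewrite !inE => /or4P[|||/or3P[]] /eqP->; rewrite unlock.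
have [|hS|hS] := @aut_E6 (fun i => h (t (q i))).
- split=> // [i j hi hj /(can_inj hK)|i j hi hj e_ij].
    by move/(opposition_inj hPhi hDelta opp);
      rewrite !inE => /(_ isT isT)/(congr1 h); rewrite !qK.
  by rewrite -adjE (opposition_bonds hPhi hDelta opp) ?inE // adjE !qK.
- by rewrite hS in cong.
by move=> x; rewrite -{1}(hK x) hS.
Qed.

Lemma flips_opposition s : flips s -> acts_as_opposition Delta [set: 'I_r] s.
Proof.
move=> hs; have [t opp] := opposition_exists hPhi hDelta [set: 'I_r].
suff e : {in [set: 'I_r], t =1 s} by apply/(opposition_onP _ e).
by move=> x _; apply: (can_inj hK); rewrite hs (opposition_E6 opp).
Qed.

Variable sigma : {perm 'I_r}.
Hypothesis sigma_flips : flips sigma.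

Let sq i : i < 6 -> sigma (q i) = q (flip_E6 i).
Proof.
move=> hi; apply: (can_inj hK); rewrite sigma_flips !qK //.
by case: i hi => [|[|[|[|[|[|]]]]]].
Qed.

(** A component A_2 is reversed by the opposition but not by the flip. In the D_4 on 1, 2, 3, 4,
    half the sum of the simple roots 1 and 2 is a weight, so the opposition cannot send 2 to 4 as
    the flip does. *)
Lemma E6_forward I : @stable D sigma I -> opposition_on Delta I sigma ->
  @big_part D I != set0 -> exists2 l,
  l \in [:: [:: 2; 3; 4]; [:: 0; 2; 3; 4; 5]; iota 0 6] & listed l I.
Proof.
move=> stI opp /set0Pn[x /big_partP[xI [y yI]]]; rewrite adjE => xy.
have lI := flips_stable sigma_flips stI.
have nb : has (fun i => has (edge_E6 i) (flip_list (q 0 \in I) (q 1 \in I) (q 2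
  \in I) (q 3 \in I)))
    (flip_list (q 0 \in I) (q 1 \in I) (q 2 \in I) (q 3 \in I)).
  apply/hasP; exists (h x); first by rewrite -lI.
  by apply/hasP; exists (h y); first by rewrite -lI.
have l6 : all (fun i => i < 6)
    (flip_list (q 0 \in I) (q 1 \in I) (q 2 \in I) (q 3 \in I)).
  by apply/allP => i; rewrite mem_filter mem_iota => /and3P[].
have := flip_list_cases nb; move: (flip_list _ _ _ _) lI l6 {nb} => l lI l6 /= hl.
case: hl => [[c cl]|el|ll].
- have := listed_chain opp lI l6 cl (i := 0).
  rewrite !inE => h0 /orP[]/eqP ec; move: (h0); rewrite ec => /(_ isT) /=;
    by rewrite sq // => /(congr1 h); rewrite !qK.
- have : (2%:Z %| (nth 0%R [:: 0; 1; 1; 0; 0; 0]%R 2 : int) + nth 0%R [:: 0; 1;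
    1; 0; 0; 0]%R (h (sigma (q 2))))%Z%R.
    apply: (listed_congruence opp lI l6 (C := nth 0%R [:: 0; 1; 1; 0; 0;
      0]%R)); rewrite el //.
      by case=> [|[|[|[|[|[|]]]]]].
    by move=> j; rewrite !inE => /or4P[] /eqP->; rewrite unlock.
  by rewrite sq // qK.
by exists l.
Qed.

Lemma E6_backward I l : l \in [:: [:: 2; 3; 4]; [:: 0; 2; 3; 4; 5]; iota 0 6] ->
  listed l I -> acts_as_opposition Delta I sigma.
Proof.
move=> hl lI.
have [t opp] := opposition_exists hPhi hDelta I.
suff e : {in I, t =1 sigma} by apply/(opposition_onP _ e).
have l6 : all (fun i => i < 6) l by move: hl; rewrite !inE => /or3P[]/eqP->.
move=> x xI; rewrite -(hK x) sq //; have xl : h x \in l by rewrite -lI.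
move: hl; rewrite !inE => /or3P[]/eqP el.
- have cl : chain_in l [:: 2; 3; 4] by rewrite el.
  have := listed_chain opp lI l6 cl; rewrite el !inE in xl *.
  by case/or3P: xl => /eqP-> e; [apply: (e 0) | apply: (e 1) | apply: (e 2)].
- have cl : chain_in l [:: 0; 2; 3; 4; 5] by rewrite el.
  have := listed_chain opp lI l6 cl; rewrite el !inE in xl *.
  by case/or4P: xl => [|||/orP[]] /eqP-> e;
    [apply: (e 0) | apply: (e 1) | apply: (e 2) | apply: (e 3) | apply: (e 4)].
have eI : I = [set: 'I_r] by apply/setP => y; rewrite lI el mem_iota lt_h inE.
rewrite eI in opp; apply: (can_inj hK); rewrite (opposition_E6 opp) !qK //.
by case: (h x) (lt_h x) => [|[|[|[|[|[|]]]]]].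
Qed.

End TypeE6.

(** * The four cases *)

Section Cases.
Variables (R : archiRcfType) (r : nat).
Variables (Phi : seq 'rV[R]_r) (Delta : 'I_r -> 'rV[R]_r).
Hypothesis hPhi : reduced_root_system Phi.
Hypothesis hDelta : is_base Phi Delta.
Variables (I : {set 'I_r}) (sigma : {perm 'I_r}).
Local Notation D := (dynkin Delta).
Local Notation I2 := (@big_part D I).
Hypothesis sigma_aut : sigma \in diagram_Aut D.
Hypothesis stable_I : @stable D sigma I.

Let conditions :=
  [/\ sigma != 1%g, I2 != set0 & acts_as_opposition Delta I sigma].

Definition case_A :=
  exists n : nat,
    [/\ 2 <= n, of_type D (type_A n), acts_as_opposition Delta [set: 'I_r] sigma &
        exists m : nat,
          [/\ 2 <= m <= n, m = n %[mod 2], I2 = I &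
              unique (fun J : {set vertex D} =>
                @stable D sigma J /\ of_type (subdiagram J) (type_A m)) I2]].

Definition case_D4 :=
  [/\ of_type D (type_D 4),
      (exists x y : vertex D,
         [/\ extremal x, extremal y, x != y & sigma = tperm x y]),
      I2 = I,
      of_type (subdiagram I2) (type_D 3) /\ of_type (subdiagram I2) (type_A 3) &
      exists2 x : vertex D, extremal x & I2 = ~: [set x]].

Definition case_D :=
  exists n : nat,
    [/\ 5 <= n, of_type D (type_D n),
        unique (fun s : {perm vertex D} => s \in diagram_Aut D /\ s != 1%g) sigma &
        exists m : nat,
          1 <= m /\ 2 * m <= n - 1 /\
          unique (fun J : {set vertex D} => D_subdiagram n (2 * m + 1) J) I2].

Definition case_E6 :=
  [/\ of_type D type_E6, acts_as_opposition Delta [set: 'I_r] sigma &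
      exists2 E : diagram, [\/ E = type_A 3, E = type_A 5 | E = type_E6] &
        unique (fun J : {set vertex D} =>
          @stable D sigma J /\ of_type (subdiagram J) E) I2].

Lemma acts_as_oppositionP (J : {set 'I_r}) :
  acts_as_opposition Delta J sigma -> opposition_on Delta J sigma.
Proof. by have /opposition_onP-> : {in J, sigma =1 sigma} by []. Qed.

Lemma forward_A n : 2 <= n -> of_type D (type_A n) -> conditions -> case_A.
Proof.
move=> n2 ty [nt ne /acts_as_oppositionP opp].
have n0 : 0 < n by arith.
have [h [q ch]] := @of_type_chart D n (fun i j => i.+1 == j) n0 ty.
have rv := reverses_aut ch sigma_aut nt.
have [x xB] := set0Pn _ ne; have := xB => /big_partP[xI [y yI xy]].
have I0 : I != set0 by apply/set0Pn; exists x.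
have [a a2 cI] := opposition_centred hPhi hDelta ch rv opp I0.
have lt_h z : h z < n by apply: (chart_lt ch).
have m2 : 2 <= n - a.*2.
  move: xy; rewrite (chart_bonds ch) lt0b; move: xI yI; rewrite !cI.
  by have := lt_h x; have := lt_h y; arith.
have eB : I2 = I.
  apply/setP => z; apply/idP/idP => [/big_partP[]//|zI]; apply/big_partP; split=> //.
  have hz := lt_h z; move: (zI); rewrite cI => az.
  have [lt_z|ge_z] := ltnP (h z) (n.-1 - a).
    exists (q (h z).+1); first by rewrite cI (chartVK ch); arith.
    by rewrite (chart_bonds ch) (chartVK ch) /edge_A ?eqxx //; arith.
  exists (q (h z).-1); first by rewrite cI (chartVK ch); arith.
  by rewrite (chart_bonds ch) lt0b (chartVK ch); arith.
exists n; split=> //.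
  apply: (centred_opposition hPhi hDelta ch rv (a := 0)); first by arith.
  by move=> z; rewrite inE; have := lt_h z; arith.
(* Removing [a] vertices at each end keeps the parity, whence the congruence between [m] and [n]. *)
exists (n - a.*2); split=> //; try lia.
rewrite eB; split=> [|J [stJ tJ]].
  by split=> //; apply: (centred_type hPhi hDelta ch a2 cI).
have m0 : 0 < n - a.*2 by arith.
have [b nb cJ] := type_A_centred ch rv m0 stJ tJ.
have eab : b = a by arith.
by apply/setP => z; rewrite cI cJ eab.
Qed.

Lemma backward_A : case_A -> conditions.
Proof.
case=> n [n2 ty /acts_as_oppositionP opp [m [hm _ eB [[stB tB] _]]]].
have n0 : 0 < n by arith.
have [h [q ch]] := @of_type_chart D n (fun i j => i.+1 == j) n0 ty.
have rv := reverses_opposition hPhi hDelta ch opp.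
have m0 : 0 < m by arith.
have [a na cB] := type_A_centred ch rv m0 stB tB.
split.
- exact: (reverses_neq1 ch rv n2).
- apply/set0Pn; exists (q a); rewrite cB (chartVK ch); arith.
rewrite -eB; apply: (centred_opposition hPhi hDelta ch rv (a := a)) cB; arith.
Qed.

Lemma forward_D4 : of_type D (type_D 4) -> conditions -> case_D4.
Proof.
move=> ty [nt ne /acts_as_oppositionP opp].
have [h [q ch]] := @of_type_chart D 4 (half_D 4) isT ty.
have [x [y [z [u es eI]]]] := star_forward hPhi hDelta ch sigma_aut nt opp ne.
have := u; rewrite /= !inE !negb_or => /and4P[/and3P[cx cy cz] /andP[xy xz] yz _].
have eB : I2 = I.
  apply/setP => v; apply/idP/idP => [/big_partP[]//|vI]; apply/big_partP; split=> //.
  have [vc|vc] := eqVneq v (q 1).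
    exists x; first by rewrite eI !inE.
    by rewrite (star_adj ch) vc eqxx (eq_sym x) (negbTE cx).
  by exists (q 1); [rewrite eI !inE | rewrite (star_adj ch) (negbTE vc) eqxx].
have ext v : q 1 != v -> @extremal D v by rewrite (star_extremal ch) eq_sym.
split=> //.
- by exists x, y; split; rewrite ?ext.
- by rewrite eB; apply: (star_types hPhi hDelta ch u eI).
by exists z; rewrite ?ext // eB.
Qed.

Lemma backward_D4 : case_D4 -> conditions.
Proof.
case=> ty [x [y [ex ey xy es]]] eB _ [z ez eI].
have [h [q ch]] := @of_type_chart D 4 (half_D 4) isT ty.
rewrite !(star_extremal ch) in ex ey ez.
split.
- apply/eqP => s1; have := tpermL x y; rewrite -es s1 perm1 => e.
  by rewrite e eqxx in xy.
- by apply/set0Pn; exists (q 1); rewrite eI !inE eq_sym.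
apply: (star_backward hPhi hDelta ch stable_I ex ey ez xy es).
by rewrite -eB.
Qed.

Lemma forward_D n : 5 <= n -> of_type D (type_D n) -> conditions -> case_D.
Proof.
move=> n5 ty [nt ne /acts_as_oppositionP opp]; have n0 : 0 < n by lia.
have [h [q ch]] := @of_type_chart D n (half_D n) n0 ty.
have sw := swaps_aut n5 ch sigma_aut nt.
have [m [m1 mn upB]] := opposition_fork hPhi hDelta n5 ch sw stable_I opp ne.
have hm : 3 <= 2 * m + 1 <= n by lia.
exists n; split=> //.
  split=> // s [autS nt']; apply: (swaps_unique ch) => //.
  exact: (swaps_aut n5 ch autS nt').
exists m; split=> //; split; first by lia.
split; first exact: (upper_D_subdiagram hPhi hDelta n5 ch hm upB).
move=> J /(D_subdiagram_upper n5 ch hm) upJ.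
by apply/setP => x; rewrite upB upJ.
Qed.

Lemma backward_D : case_D -> conditions.
Proof.
case=> n [n5 ty [[_ nt] _] [m [m1 [mn [subB _]]]]]; have n0 : 0 < n by lia.
have [h [q ch]] := @of_type_chart D n (half_D n) n0 ty.
have sw := swaps_aut n5 ch sigma_aut nt.
have hm : 3 <= 2 * m + 1 <= n by lia.
have upB := D_subdiagram_upper n5 ch hm subB.
split=> //.
  by apply/set0Pn; exists (q (n - 1)); rewrite upB (chartVK ch); lia.
by apply: (fork_opposition hPhi hDelta n5 ch sw m1 _ upB); lia.
Qed.

Lemma path_has_nbr m : 2 <= m -> forall i, i < m ->
  exists2 j, j < m & (i.+1 == j) || (j.+1 == i).
Proof.
move=> m2 i hi; have [lt_i|ge_i] := ltnP i.+1 m; first by exists i.+1; rewrite ?eqxx.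
by exists i.-1; lia.
Qed.

Lemma E6_has_nbr i : i < 6 -> exists2 j, j < 6 & half_E6 i j || half_E6 j i.
Proof.
have : all (fun i => has (fun j => half_E6 i j || half_E6 j i) (iota 0 6))
  (iota 0 6).
  by vm_compute.
move=> /allP hi i6; have /hi/hasP[j] : i \in iota 0 6 by rewrite mem_iota.
by rewrite mem_iota => /andP[_ j6] e; exists j.
Qed.

Lemma forward_E6 : of_type D type_E6 -> conditions -> case_E6.
Proof.
move=> ty [nt ne /acts_as_oppositionP opp].
have [h [q ch]] := @of_type_chart D 6 half_E6 isT ty.
have fl := flips_aut ch sigma_aut nt.
have [l hl lI] := E6_forward hPhi hDelta ch fl stable_I opp ne.
split=> //; first exact: (flips_opposition hPhi hDelta ch fl).
have nl : has_nbr_E6 l by move: hl; rewrite !inE => /or3P[]/eqP->.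
rewrite (listed_big_part ch lI nl).
have ul : uniq l by move: hl; rewrite !inE => /or3P[]/eqP->.
have l6 : all (fun i => i < 6) l by move: hl; rewrite !inE => /or3P[]/eqP->.
have edge_check (e : rel nat) : all (fun i => all (fun j =>
    edge_E6 (nth 0 l i) (nth 0 l j) == e i j || e j i) (iota 0 (size l))) (iota
      0 (size l)) ->
    forall i j, i < size l -> j < size l -> edge_E6 (nth 0 l i) (nth 0 l j) = e
      i j || e j i.
  move=> /allP he i j hi hj;
    have /he/allP hi' : i \in iota 0 (size l) by rewrite mem_iota.
  by apply/eqP/hi'; rewrite mem_iota.
have finish m (e : rel nat) : size l = m -> 0 < m ->
    all (fun i => all (fun j =>
      edge_E6 (nth 0 l i) (nth 0 l j) == e i j || e j i) (iota 0 (size l)))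
        (iota 0 (size l)) ->
    (forall i, i < m -> exists2 j, j < m & e i j || e j i) ->
    unique (fun J : {set vertex D} => @stable D sigma J /\
      of_type (subdiagram J) (simply_laced (fun i j : 'I_m => e i j))) I.
  move=> sz m0 he e_nbr; split=> [|J [stJ tJ]].
    by split=> //; apply: (listed_of_type hPhi hDelta ch ul l6 lI sz m0);
      apply: edge_check.
  have lJ := listed_unique ch fl stJ hl sz m0 e_nbr tJ.
  exact: (listed_eq lI lJ).
move: hl; rewrite !inE => /or3P[]/eqP el.
- exists (type_A 3); first by constructor 1.
  by apply: (finish 3 (fun i j => i.+1 == j)); rewrite ?el //; apply: path_has_nbr.
- exists (type_A 5); first by constructor 2.
  by apply: (finish 5 (fun i j => i.+1 == j)); rewrite ?el //; apply: path_has_nbr.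
exists type_E6; first by constructor 3.
by apply: (finish 6 half_E6); rewrite ?el //; apply: E6_has_nbr.
Qed.

Lemma backward_E6 : case_E6 -> conditions.
Proof.
case=> ty /acts_as_oppositionP opp [E hE [[stB tB] _]].
have [h [q ch]] := @of_type_chart D 6 half_E6 isT ty.
have fl : flips h sigma := opposition_E6 hPhi hDelta ch opp.
have [l hl lB] : exists2 l,
    l \in [:: [:: 2; 3; 4]; [:: 0; 2; 3; 4; 5]; iota 0 6] & listed h l I2.
  case: hE tB => -> tB.
  - exists [:: 2; 3; 4]; first by [].
    by apply: (@listed_unique _ _ _ h q ch sigma I2 _ 3 (fun i j => i.+1 == j))
      => //; apply: path_has_nbr.
  - exists [:: 0; 2; 3; 4; 5]; first by [].
    by apply: (@listed_unique _ _ _ h q ch sigma I2 _ 5 (fun i j => i.+1 == j))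
      => //; apply: path_has_nbr.
  exists (iota 0 6); first by [].
  by apply: (@listed_unique _ _ _ h q ch sigma I2 _ 6 half_E6) => //;
    apply: E6_has_nbr.
(* Every vertex outside one of the three subsets has a neighbour in it, so [I] has no isolated
   vertex besides [I2] and the two coincide. *)
have dominating : all (fun i => (i \in l) || has (edge_E6 i) l) (iota 0 6).
  by move: hl; rewrite !inE => /or3P[]/eqP->.
have l6 : all (fun i => i < 6) l by move: hl; rewrite !inE => /or3P[]/eqP->.
have eB : I2 = I.
  apply/setP => x; apply/idP/idP => [/big_partP[]//|xI].
  have hx : h x \in iota 0 6 by rewrite mem_iota (chart_lt ch).
  have := allP dominating _ hx; rewrite -lB => /orP[//|/hasP[j jl e]];
    have j6 := allP l6 j jl.
  have jB : q j \in I2 by rewrite lB (chartVK ch).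
  apply/big_partP; split=> //; exists (q j); first by have /big_partP[] := jB.
  by rewrite (chart_bonds ch) (chartVK ch) // -/(edge_E6 _ _) e.
split.
- exact: (flips_neq1 ch fl).
- have [i il] : exists i, i \in l.
    by move: hl; rewrite !inE => /or3P[]/eqP->; [exists 2 | exists 2 | exists 2].
  by apply/set0Pn; exists (q i); rewrite lB (chartVK ch) // (allP l6).
by rewrite eB in lB; apply: (E6_backward hPhi hDelta ch fl hl lB).
Qed.

End Cases.
Local Close Scope ring_scope.

Theorem theoremA3p4 (R : archiRcfType) (r : nat)
  (Phi : seq 'rV[R]_r) (Delta : 'I_r -> 'rV[R]_r) (I : {set 'I_r})
  (sigma : {perm 'I_r})
  (hPhi : reduced_root_system Phi) (hDelta : is_base Phi Delta)
  (hsigma : sigma \in diagram_Aut (dynkin Delta))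
  (hI : @stable (dynkin Delta) sigma I)
  (htrans : @transitive_on_components (dynkin Delta) sigma) :
  let D := dynkin Delta in
  let I2 : {set vertex D} := @big_part D I in
  let conditions :=
    [/\ sigma != 1%g, I2 != set0 & acts_as_opposition Delta I sigma] in
  let sigma_is_opposition := acts_as_opposition Delta [set: 'I_r] sigma in
  (conditions ->
     connected_diagram D /\
     [\/ exists2 n : nat, (2 <= n)%N & of_type D (type_A n),
         exists2 n : nat, (4 <= n)%N & of_type D (type_D n)
       | of_type D type_E6])
  /\
  (conditions <->
     [\/ (exists n : nat,
            [/\ (2 <= n)%N, of_type D (type_A n), sigma_is_opposition &
                exists m : nat,
                  [/\ (2 <= m <= n)%N, m = n %[mod 2],
                      I2 = I &
                      unique (fun J : {set vertex D} =>
                        @stable D sigma J /\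
                        of_type (subdiagram J) (type_A m)) I2]]),
         [/\ of_type D (type_D 4),
             (exists x y : vertex D,
                [/\ extremal x, extremal y, x != y & sigma = tperm x y]),
             I2 = I,
             of_type (subdiagram I2) (type_D 3) /\
             of_type (subdiagram I2) (type_A 3) &
             exists2 x : vertex D, extremal x & I2 = ~: [set x]],
         (exists n : nat,
            [/\ (5 <= n)%N, of_type D (type_D n),
                unique (fun s : {perm vertex D} =>
                  s \in diagram_Aut D /\ s != 1%g) sigma &
                exists m : nat,
                  (1 <= m)%N /\ (2 * m <= n - 1)%N /\
                  unique (fun J : {set vertex D} =>
                    D_subdiagram n (2 * m + 1) J) I2])
       | [/\ of_type D type_E6, sigma_is_opposition &
             exists2 E : diagram,
               [\/ E = type_A 3, E = type_A 5 | E = type_E6] &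
               unique (fun J : {set vertex D} =>
                 @stable D sigma J /\ of_type (subdiagram J) E) I2]]).
Proof.
move=> D I2 conditions sigma_is_opposition.
have full : conditions -> connected_diagram D /\
    [\/ exists2 n : nat, (2 <= n)%N & of_type D (type_A n),
        exists2 n : nat, (4 <= n)%N & of_type D (type_D n)
      | of_type D type_E6].
  case=> nt ne opp; have /set0Pn[x /big_partP[xI _]] := ne.
  have conn := opposition_connected hPhi hDelta xI hsigma htrans (acts_as_oppositionP opp).
  split; last exact: (classification hPhi hDelta conn hsigma nt).
  by apply: connected_diagramP conn; apply: leq_ltn_trans (ltn_ord x).
split=> //; split=> [cond|].
  have [_ [[n n2 ty]|[n n4 ty]|ty]] := full cond.
  - by constructor 1; exact: (forward_A hPhi hDelta hsigma hI n2 ty cond).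
  - move: n4; rewrite leq_eqVlt => /orP[/eqP n4|n5].
      by constructor 2; rewrite -n4 in ty; exact: (forward_D4 hPhi hDelta hsigma ty cond).
    by constructor 3; exact: (forward_D hPhi hDelta hsigma hI n5 ty cond).
  by constructor 4; exact: (forward_E6 hPhi hDelta hsigma hI ty cond).
case=> h.
- exact: (backward_A hPhi hDelta h).
- exact: (backward_D4 hPhi hDelta hI h).
- exact: (backward_D hPhi hDelta hsigma h).
exact: (backward_E6 hPhi hDelta hsigma h).
Qed.
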